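(* Let $X$ be a recurrent Markov process with state space $E$ and local time process $(L^x_t,x\in E,t\ge0)$. For $a\in E$, let $T_a=\inf\{t\ge0:X_t=a\}$, $\tau_r=\inf\{t\ge0:L^a_t>r\}$, and let $S_\theta$ be an exponential time with parameter $\theta$, independent of $X$. Let $\phi$ and $\psi$ be the permanental processes with index $2$ associated respectively to the transient Markov processes $X$ killed at $T_a$ and $X$ killed at $\tau_{S_\theta}$. Then for every $a\in E$, every $r>0$ and every functional $F$ on measurable functions from $E$ to $\mathbb{R}$, $$\mathbb{P}_a\Big\langle F\big(L^x_{\tau_r}+\tfrac12\phi_x;\ x\in E\big)\Big\rangle=\Big\langle F\big(\tfrac12\psi_x;\ x\in E\big)\,\Big|\,\psi_a=r\Big\rangle.$$ Besides, the law of $(\psi_x,x\in E)$ conditioned on $\psi_a=0$ is equal to the law of $(\phi_x,x\in E)$.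
   Context: The process $X$ is not assumed symmetric. $\mathbb{P}_a$ denotes the probability (and here also the expectation) under which $X$ starts at $a$. The permanental processes $\phi$ and $\psi$ are defined on a probability space unrelated to $X$, on which expectation is denoted $\langle\cdot\rangle$; thus $\mathbb{P}_a\langle\cdot\rangle$ is expectation over both $X$ and the permanental process, taken independent. For a transient Markov process with local times, the Green function is $g(x,y)=\mathbb{E}_x(\text{total accumulated local time at }y)$. The permanental process with index $2$ associated to a transient Markov process with Green function $g$ is the nonnegative process $(\psi_x,x\in E)$ such that $\langle\exp\{-\frac12\sum_{i=1}^n\alpha_i\psi_{x_i}\}\rangle=|I+\alpha G|^{-1/2}$ for all $n$, all $\alpha_1,\dots,\alpha_n\ge0$ and all $x_1,\dots,x_n\in E$, where $I$ is the $n\times n$ identity matrix, $\alpha=\mathrm{diag}(\alpha_i)_{1\le i\le n}$, $G=(g(x_i,x_j))_{1\le i,j\le n}$ and $|\cdot|$ is the determinant.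
   Formalization: The displayed identity is proved with the condition ψ_a = 2r in place of ψ_a = r; as printed it fails for F(p) = 1{p(a) = r}, since the left side is 1 and the right side is 0. *)

(* Defs.v *)
From HB Require Import structures.
From mathcomp Require Import all_boot all_order all_algebra.
From mathcomp Require Import all_classical all_reals all_analysis.
From mathcomp Require Import measurable_realfun.

Set Implicit Arguments.
Unset Strict Implicit.
Unset Printing Implicit Defensive.

Import Order.TTheory GRing.Theory Num.Theory.
Import numFieldNormedType.Exports.

Local Open Scope classical_set_scope.
Local Open Scope ring_scope.

(* A space with a sigma-algebra and a topology. The two are linked only by
   [open_measurable_state] below, so that the sigma-algebra may be the Borel one
   or a larger one, such as the universally measurable sets. *)
#[short(type="measTopologicalType")]
HB.structure Definition MeasTopological d :=
  {T of Measurable d T & Topological T}.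

Section random_times.
Context {R : realType} {d} {W : measurableType d}.
Implicit Types (F : R -> set (set W)) (T : W -> \bar R).

Definition stopping_time F T : Prop :=
  (forall w, (0 <= T w)%E) /\
  (forall t, 0 <= t -> F t [set w | (T w <= t%:E)%E]).

Definition stopped_sigma_algebra F T : set (set W) :=
  [set A | measurable A /\
    forall t, 0 <= t -> F t (A `&` [set w | (T w <= t%:E)%E])].

End random_times.

Definition first_time {R : realType} (A : set R) : \bar R :=
  ereal_inf [set t%:E | t in [set t | 0 <= t /\ A t]].

Section markov_process.
Context {R : realType} {dE} {E : measTopologicalType dE}
  {d} {W : measurableType d}.

Definition hitting_time (X : R -> W -> E) (a : E) (w : W) : \bar R :=
  first_time [set t | X t w = a].

(* A strong Markov process with right-continuous paths and infinite lifetime,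
   with its laws, its shifts and its filtration. All time parameters range over
   the nonnegative reals; values at negative times are irrelevant. *)
Record markov_process := MarkovProcess {
  law : R.-pker E ~> W ;
  path : R -> W -> E ;
  shift : R -> W -> W ;
  history : R -> set (set W) ;
  hausdorff_state : hausdorff_space E ;
  open_measurable_state : @open E `<=` measurable ;
  history_sigma : forall t, 0 <= t -> sigma_algebra setT (history t) ;
  history_measurable : forall t, 0 <= t -> history t `<=` measurable ;
  history_le : forall s t, 0 <= s -> s <= t -> history s `<=` history t ;
  history_right_continuous : forall t, 0 <= t ->
    \bigcap_(s in [set s | t < s]) history s `<=` history t ;
  path_adapted : forall t (B : set E), 0 <= t -> measurable B ->
    history t (path t @^-1` B) ;
  path_right_continuous : forall w t, 0 <= t ->
    path s w @[s --> t^'+] --> path t w ;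
  path_start : forall x, {ae law x, forall w, path 0 w = x} ;
  path_shift : forall s t w, 0 <= s -> 0 <= t ->
    path t (shift s w) = path (s + t) w ;
  (* Automatic (debut theorem) when the filtration is augmented; augmentation
     is not required here. *)
  hitting_stopping : forall a, stopping_time history (hitting_time path a) ;
  shift_stopping_measurable : forall T, stopping_time history T ->
    measurable_fun [set w | (T w < +oo)%E] (fun w => shift (fine (T w)) w) ;
  strong_markov : forall T, stopping_time history T ->
    forall x (A B : set W), stopped_sigma_algebra history T A -> measurable B ->
    law x (A `&` [set w | (T w < +oo)%E /\ B (shift (fine (T w)) w)]) =
    (\int[law x]_(w in A `&` [set w | (T w < +oo)%E])
       law (path (fine (T w)) w) B)%E
}.

Definition recurrent (X : markov_process) : Prop :=
  forall x y : E, {ae law X x, forall w,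
    forall t, 0 <= t -> exists2 s, t <= s & path X s w = y}.

End markov_process.
Arguments markov_process R {dE} E {d} W.

Section local_times.
Context {R : realType} {dE} {E : measTopologicalType dE}
  {d} {W : measurableType d}.

Definition inverse_local_time (L : E -> R -> W -> R) (a : E) (r : R) (w : W) :
    \bar R :=
  first_time [set t | r < L a t w].

(* For each y, L y is a local time at y: a continuous additive functional of X
   with fine support {y}. *)
Record local_time_process (X : markov_process R E W) (L : E -> R -> W -> R) :
    Prop := LocalTimeProcess {
  local_time_start : forall y w, L y 0 w = 0 ;
  local_time_nondecreasing : forall y w s t, 0 <= s -> s <= t ->
    L y s w <= L y t w ;
  local_time_continuous : forall y w,
    {within `[0, +oo[, continuous (fun t => L y t w)} ;
  local_time_adapted : forall y t (B : set R), 0 <= t -> measurable B ->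
    history X t (L y t @^-1` B) ;
  local_time_additive : forall x y, {ae law X x, forall w, forall s t,
    0 <= s -> 0 <= t -> L y (s + t) w = L y s w + L y t (shift X s w)} ;
  local_time_support : forall y,
    [set x | {ae law X x, forall w, inverse_local_time L y 0 w = 0%E}] = [set y]
}.

End local_times.

Section green.
Context {R : realType} {E : Type} {d} {W : measurableType d}.

(* Killing a process at time T stops its local times at T. *)
Definition killed_local_time (L : E -> R -> W -> R) (T : W -> \bar R) :
    E -> R -> W -> R :=
  fun y t w => L y (fine (mine t%:E (T w))) w.

Definition total_local_time (L : E -> R -> W -> R) (y : E) (w : W) : \bar R :=
  ereal_sup [set (L y t w)%:E | t in [set t | 0 <= t]].

Definition green (P : E -> {measure set W -> \bar R}) (L : E -> R -> W -> R)
    (x y : E) : \bar R :=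
  (\int[P x]_w total_local_time L y w)%E.

End green.

Section killed_processes.
Context {R : realType} {dE} {E : measTopologicalType dE}
  {d} {W : measurableType d}.
Variables (X : markov_process R E W) (L : E -> R -> W -> R) (a : E).

Definition green_killed_at_hitting : E -> E -> \bar R :=
  green (law X) (killed_local_time L (hitting_time (path X) a)).

(* X killed at the inverse local time at a evaluated at an independent random
   level S: X and S live on the product space. *)
Definition green_killed_at_inverse {dS} {WS : measurableType dS}
    (PS : probability WS R) (S : WS -> R) : E -> E -> \bar R :=
  green (fun x => (law X x \x PS)%E)
    (killed_local_time (fun y t w => L y t w.1)
       (fun w : W * WS => inverse_local_time L a (S w.2) w.1)).

End killed_processes.

(* The permanental process of index 2 with kernel g. Only finite kernels are
   meant, such as the Green functions of a transient process; fine then merely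
   casts the values of g to R. *)
Record permanental2 {R : realType} {E : Type} {d} {W : measurableType d}
    (P : probability W R) (psi : E -> {RV P >-> R}) (g : E -> E -> \bar R) :
    Prop := Permanental2 {
  permanental2_ge0 : forall x w, 0 <= psi x w ;
  permanental2_laplace :
    forall n (alpha : 'rV[R]_n) (x : 'I_n -> E), (forall i, 0 <= alpha 0 i) ->
    ('E_P[fun w => expR (- (2^-1 * \sum_i alpha 0 i * psi (x i) w))] =
     ((Num.sqrt (\det (1%:M + diag_mx alpha *m
         (\matrix_(i, j) fine (g (x i) (x j))))))^-1)%:E)%E
}.

Definition coordinate_sets (R : realType) (E : Type) : set (set (E -> R)) :=
  [set A | exists x (B : set R), measurable B /\ A = [set p | B (p x)]].
Arguments coordinate_sets : clear implicits.

(* All functions from E to R, with the sigma-algebra of the coordinates. *)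
Definition functionSpace (R : realType) (E : Type) : Type :=
  g_sigma_algebraType (coordinate_sets R E).
HB.instance Definition _ (R : realType) (E : Type) :=
  Measurable.on (functionSpace R E).

(* kappa r is the law of psi conditioned on psi a = r. Disintegration determines
   kappa r only for almost every r; the continuity of the finite-dimensional
   laws in r >= 0 selects the version that gives a meaning to each r,
   including r = 0. *)
Record conditional_law {R : realType} {E : Type} {d} {W : measurableType d}
    (P : probability W R) (psi : E -> {RV P >-> R}) (a : E)
    (kappa : R.-pker R ~> functionSpace R E) : Prop := ConditionalLaw {
  conditional_law_disintegration :
    forall (A : set (functionSpace R E)) (B : set R),
    measurable A -> measurable B ->
    (P [set w | A (fun x => psi x w) /\ B (psi a w)] =
     \int[distribution P (psi a)]_(r in B) kappa r A)%E ;
  conditional_law_continuous :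
    forall n (x : 'I_n -> E) (f : 'rV[R]_n -> R), continuous f ->
    (exists M, forall v, `|f v| <= M) ->
    {within `[0, +oo[,
      continuous (fun r => \int[kappa r]_p f (\row_i p (x i)))}
}.

(* Main.v *)
(* Fix points x_1, ..., x_n and weights al_i >= 0, let A = sum_i al_i L^(x_i), let
   h be the function z |-> E_z exp (- A (T_a)) and g0 the Green function of X
   killed at T_a. By the strong Markov property the function r |-> E_a exp (- A (tau_r))
   is exp (- r c) for a constant c, and E_a L^y (tau_r) = r rho_y. Integrating
   d exp (- A) against the inverse local times of the points x_i, and applying the
   strong Markov property there, gives h z + sum_i al_i g0 (z, x_i) h (x_i) = 1
   and c = sum_i al_i rho_(x_i) h (x_i). Moreover X killed at tau_(S_theta) has the
   Green function g = g0 + m rho with m = E S_theta > 0. As g is a rank-one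
   perturbation of g0, the first equation yields
   det (1 + al G) = det (1 + al G0) (1 + m c). Taking powers -1/2, with
   E exp (- c psi_a / 2) = (1 + m c)^(-1/2), this says that 2 L_(tau_(r/2)) + phi,
   mixed over the law of r = psi_a, has the Laplace transform of psi, hence its law.
   That process equals r at a, so it is a disintegration of psi along psi_a; it is
   continuous in r since the local times have no jump at a fixed level of L^a. Any
   two such disintegrations agree at every r >= 0 because psi_a, being distributed
   as the square of a centred Gaussian, charges every interval of [0, +oo[. *)
From HB Require Import structures.
Require Import Defs.
From mathcomp Require Import all_boot all_order all_algebra.
From mathcomp Require Import all_classical all_reals all_analysis.
From mathcomp Require Import measurable_realfun ring lra.

Set Implicit Arguments.
Unset Strict Implicit.
Unset Printing Implicit Defensive.

Import Order.TTheory GRing.Theory Num.Theory.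
Import numFieldNormedType.Exports.

Local Open Scope classical_set_scope.
Local Open Scope ring_scope.

(** * Nondecreasing continuous paths and their inverses *)

(** No duality is available, so no Gaussian field is at hand and everything goes through Laplace
    transforms. The exponential identity is taken in the form 1 - exp (- A (T)) = sum_i al_i times
    the integral over [0, T] of exp (A (t) - A (T)) against the local time at x_i: the exponent
    involves only the path after t, so the strong Markov property at t produces the factor h (x_i).
    Each integral runs over the levels of its own local time, through the inverse, so that Lebesgue
    measure suffices. The hitting time is a terminal time and gives an exact equation for h; tau_r
    is not, and c is only bracketed by two bounds that merge as r tends to 0. Finiteness of the
    Green functions is derived from recurrence and the strong Markov property; it makes the casts to
    reals in the two permanental kernels faithful. Disintegration fixes a conditional law only
    almost everywhere, hence the effort spent on continuity in r, down to r = 0. *)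

Section first_time.
Context {R : realType}.
Implicit Types (A : set R) (s t : R).

Lemma first_time_ge0 A : (0 <= first_time A)%E.
Proof. by apply: le_ereal_inf_tmp => _ [t [t0 _] <-]; rewrite lee_fin. Qed.

Lemma first_time_lt A t :
  (first_time A < t%:E)%E <-> exists s : R, [/\ 0 <= s, s < t & A s].
Proof.
split=> [/ereal_inf_lt[_ [s [s0 As] <-]]|[s [s0 st As]]].
  by rewrite lte_fin => st; exists s.
by apply: (@le_lt_trans _ _ s%:E); [apply: ereal_inf_lbound; exists s|rewrite lte_fin].
Qed.

Lemma first_time_le A t : 0 <= t -> A t -> (first_time A <= t%:E)%E.
Proof. by move=> t0 At; apply: ereal_inf_lbound; exists t. Qed.

Lemma first_time_fin A : (first_time A < +oo)%E -> first_time A \is a fin_num.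
Proof. by move=> foo; rewrite ge0_fin_numE// first_time_ge0. Qed.

Lemma first_time_pinfty A : first_time A = +oo%E <-> forall t : R, 0 <= t -> ~ A t.
Proof.
split=> [h t t0 At|h]; first by have := first_time_le t0 At; rewrite h.
apply/eqP; rewrite eq_le leey/=; apply: le_ereal_inf_tmp => x [t [t0 At]].
by have := h t t0 At.
Qed.

Lemma eq_of_lt (x y : \bar R) : (0 <= x)%E -> (0 <= y)%E ->
  (forall t : R, 0 <= t -> (x < t%:E)%E <-> (y < t%:E)%E) -> x = y.
Proof.
wlog xy : x y / (x <= y)%E.
  move=> H x0 y0 h; have [xy|yx] := leP x y; first exact: H.
  by apply/esym; apply: H => //; [exact: ltW|move=> t t0; split=> /(h _ t0)].
move=> x0 y0 h; apply/eqP; rewrite eq_le xy/= leNgt; apply/negP => xLy.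
case: x x0 xy h xLy => [x| |] x0 xy h xLy; last 2 first.
- by move: xLy; rewrite ltNge leey.
- by move: x0; rewrite leNgt ltNy0.
have x0' : 0 <= x by rewrite -lee_fin.
have xx1 : (x%:E < (x + 1)%:E)%E by rewrite lte_fin ltrDl.
case: y y0 xy h xLy => [y| |]// y0 xy h xLy.
  by have [/(_ xLy)] := h y y0; rewrite ltxx.
by have [/(_ xx1)] := h (x + 1) (addr_ge0 x0' ler01); rewrite ltNge leey.
Qed.

End first_time.

Section clock.
Context {R : realType}.

Record clock (l : R -> R) : Prop := Clock {
  clock0 : l 0 = 0 ;
  clock_le : forall s t, 0 <= s -> s <= t -> l s <= l t ;
  clock_cts : {within `[0, +oo[, continuous l}
}.

Definition clock_inv (l : R -> R) (r : R) : \bar R :=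
  first_time [set t | r < l t].

Lemma clock_ge0 l (t : R) : clock l -> 0 <= t -> 0 <= l t.
Proof. by move=> [l0 ll _] t0; rewrite -l0; exact: ll. Qed.

Lemma clock_near l (t e : R) : clock l -> 0 <= t -> 0 < e ->
  exists2 d : R, 0 < d & forall s : R, 0 <= s -> `|t - s| < d -> `|l t - l s| < e.
Proof.
move=> [_ _ /subspace_continuousP/(_ t)] lc t0 e0.
have /cvgrPdist_lt/(_ _ e0) : l @ within `[0, +oo[ (nbhs t) --> l t.
  by apply: lc; rewrite /= in_itv/= t0.
rewrite /within/= => -[d /= d0 h]; exists d => // s s0 ts.
by apply: h => //=; rewrite in_itv/= s0.
Qed.

(** By continuity a level exceeded at [t] is already exceeded a little earlier; this is why the
    inequality is strict on both sides. *)
Lemma clock_inv_lt l (r t : R) : clock l -> 0 <= r -> 0 <= t ->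
  (clock_inv l r < t%:E)%E <-> r < l t.
Proof.
move=> lC r0 t0; rewrite first_time_lt; split=> [[s [s0 st /= rs]]|rt].
  exact: (lt_le_trans rs (clock_le lC s0 (ltW st))).
have tp : 0 < t.
  rewrite lt_neqAle t0 andbT; apply/eqP => t00; move: rt.
  by rewrite -t00 (clock0 lC) ltNge r0.
have [|d d0 h] := @clock_near l t (l t - r) lC t0; first by rewrite subr_gt0.
pose s := Num.max 0 (t - d / 2).
have s0 : 0 <= s by rewrite le_max lexx.
have st : s < t by rewrite gt_max tp/= ltrBlDr ltrDl divr_gt0.
exists s; split=> //=.
have : `|t - s| < d.
  rewrite ger0_norm ?subr_ge0 ?(ltW st)// ltrBlDr -ltrBlDl lt_max; apply/orP; right.
  by rewrite ltrD2l ltrN2; lra.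
move=> /(h _ s0); rewrite ger0_norm ?subr_ge0 ?(clock_le lC)// ?(ltW st)//.
by rewrite ltrD2l ltrN2.
Qed.

Lemma clock_inv_le l (r t : R) : clock l -> 0 <= t -> 0 <= r ->
  (clock_inv l r <= t%:E)%E <-> forall s, t < s -> r < l s.
Proof.
move=> lC t0 r0; split=> [h s ts|h].
  apply/(clock_inv_lt lC r0 (le_trans t0 (ltW ts))).
  by apply: (le_lt_trans h); rewrite lte_fin.
apply/lee_addgt0Pr => e e0; rewrite -EFinD; apply/ltW.
by apply/clock_inv_lt => //; [rewrite addr_ge0// ltW|apply: h; rewrite ltrDl].
Qed.

(** Continuity excludes a jump over the level: [l] can neither exceed [r] at the inverse time nor be
    still below it, as it would then stay below just after. *)
Lemma clock_at_inv l (r : R) : clock l -> 0 <= r -> (clock_inv l r < +oo)%E ->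
  l (fine (clock_inv l r)) = r.
Proof.
move=> lC r0 foo; have fE := fineK (first_time_fin foo).
have := first_time_ge0 [set t | r < l t]; rewrite -[first_time _]fE lee_fin.
rewrite /clock_inv; set t := fine _ => t0.
apply/eqP; rewrite eq_le; apply/andP; split.
  rewrite leNgt; apply/negP => /(clock_inv_lt lC r0 t0).
  by rewrite /clock_inv -fE ltxx.
rewrite leNgt; apply/negP => tr.
have [|d d0 h] := @clock_near l t (r - l t) lC t0; first by rewrite subr_gt0.
have : r < l (t + d / 2).
  apply/clock_inv_lt => //; first by rewrite addr_ge0// ltW// divr_gt0.
  by rewrite /clock_inv -fE lte_fin ltrDl divr_gt0.
have d2 : 0 < d / 2 by rewrite divr_gt0.
have s0 : 0 <= t + d / 2 by rewrite addr_ge0// ltW.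
have : `|t - (t + d / 2)| < d by rewrite opprD addNKr normrN gtr0_norm//; lra.
move=> /(h _ s0); rewrite distrC ger0_norm; last first.
  by rewrite subr_ge0 (clock_le lC)// lerDl ltW.
by rewrite ltrD2r => /lt_trans lr /lr; rewrite ltxx.
Qed.

Lemma clock_inv_fin l (r t : R) : clock l -> 0 <= t -> r < l t ->
  (clock_inv l r < +oo)%E.
Proof.
by move=> lC t0 rt; apply: (le_lt_trans (first_time_le t0 rt)); rewrite ltry.
Qed.

Lemma clock_inv_homo l : {homo clock_inv l : r s / r <= s >-> (r <= s)%E}.
Proof.
move=> r s rs; apply: le_ereal_inf => _ [t [t0 /= st] <-].
by exists t => //; split => //=; exact: le_lt_trans st.
Qed.

Lemma clock_inv_lt0 l (r : R) : clock l -> r < 0 -> clock_inv l r = 0%E.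
Proof.
move=> lC r0; apply/eqP; rewrite eq_le first_time_ge0 andbT.
by apply: first_time_le => //=; rewrite (clock0 lC).
Qed.

Lemma clock_inv_shift l l' (T r : R) : clock l -> clock l' -> 0 <= T ->
  l T <= r -> (forall t : R, 0 <= t -> l (T + t) = l T + l' t) ->
  clock_inv l r = (T%:E + clock_inv l' (r - l T))%E.
Proof.
move=> lC l'C T0 lT h.
have r0 : 0 <= r := le_trans (clock_ge0 lC T0) lT.
apply: eq_of_lt; rewrite ?first_time_ge0 ?adde_ge0 ?first_time_ge0 ?lee_fin//.
move=> t t0; rewrite (clock_inv_lt lC r0 t0).
have -> : (T%:E + clock_inv l' (r - l T) < t%:E)%E =
    (clock_inv l' (r - l T) < (t - T)%:E)%E.
  case: (clock_inv _ _) => [x| |]; first by rewrite -EFinD !lte_fin ltrBrDl.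
  - by rewrite addey// !ltNge !leey.
  - by rewrite addeNy !ltNyr.
have [Tt|tT] := ltP T t.
  rewrite clock_inv_lt ?subr_ge0// ?(ltW Tt)//.
  by rewrite ltrBlDl -h ?subr_ge0 ?(ltW Tt)// subrKC.
split=> [rt|].
  by move: (lt_le_trans rt (clock_le lC t0 tT)); rewrite ltNge lT.
move=> /(le_lt_trans (first_time_ge0 _)); rewrite lte_fin subr_gt0.
by rewrite ltNge tT.
Qed.

End clock.

(** * The exponential identity along a single path *)

Section pathwise_exponential.
Context {R : realType}.
Notation mu := (@lebesgue_measure R).
Local Open Scope ereal_scope.

Lemma integral_Ico_derive (F f : R -> R) (a b : R) : (a <= b)%R ->
  (forall x : R, is_derive x (1%R : R) F (f x)) -> continuous f ->
  \int[mu]_(x in `[a, b[) (f x)%:E = (F b - F a)%:E.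
Proof.
move=> ab dF cf; have [->|anb] := eqVneq a b.
  by rewrite set_itvco0 integral_set0 subrr.
have {anb}ab : (a < b)%R by rewrite lt_neqAle anb.
have cF : continuous F.
  by move=> x; apply: differentiable_continuous; apply/derivable1_diffP/ex_derive.
rewrite EFinB -(@continuous_FTC2 _ f F a b)//; last 3 first.
- exact: continuous_subspaceT.
- split => [x _| |]; first exact: ex_derive.
  + exact/cvg_at_right_filter/cF.
  + exact/cvg_at_left_filter/cF.
- by move=> x _; rewrite derive1E; exact: derive_val.
apply: integral_itv_bndo_bndc.
by apply/measurable_EFinP; apply: measurable_funTS; exact: continuous_measurable_fun.
Qed.

Lemma lebesgue_Ico (a b : R) : (a <= b)%R ->
  mu (`[a, b[%classic) = (b - a)%:E.
Proof.
move=> ab; rewrite /= lebesgue_measure_itv/= lte_fin.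
case: ltP => [_|ba]; first by rewrite EFinB.
by rewrite (_ : a = b) ?subrr//; apply/eqP; rewrite eq_le ab ba.
Qed.

Lemma integral_expR_shift (V a b : R) : (a <= b)%R ->
  \int[mu]_(x in `[a, b[) (expR (x - V))%:E = (expR (b - V) - expR (a - V))%:E.
Proof.
move=> ab.
have dF (x : R) : is_derive x (1%R : R) (fun y => expR (y - V)) (expR (x - V)).
  have dg : is_derive x (1%R : R) (fun y : R => (y - V)%R) (1%R : R).
    by apply: (is_derive_eq (is_deriveB _ _)); rewrite subr0.
  by apply: (is_derive_eq (is_derive1_comp _ dg)); rewrite mulr1.
rewrite (integral_Ico_derive ab dF)// => x.
apply: continuous_comp; last exact: continuous_expR.
by apply: cvgB; [exact: cvg_id|exact: cvg_cst].
Qed.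

(** Layer-cake formula: [expR (a s - V)] is [expR (- V)] plus the integral of [expR (u - V)] over
    [0 <= u < a s], and Tonelli exchanges [u] and [s]. *)
Lemma integral_expR_layer (a : R -> R) (l V : R) : (0 <= l)%R -> (0 <= V)%R ->
  measurable_fun setT a -> (forall s, (0 <= s < l)%R -> (0 <= a s <= V)%R) ->
  \int[mu]_(s in `[0%R, l[) (expR (a s - V))%:E =
  (l * expR (- V))%:E + \int[mu]_(u in `[0%R, V[)
     ((expR (u - V))%:E * mu (`[0%R, l[ `&` [set s | (u < a s)%R])).
Proof.
move=> l0 V0 ma aV.
pose D := [set z : R * R | [/\ (0 <= z.1 < l)%R, (0 <= z.2 < V)%R &
  (z.2 < a z.1)%R]].
pose g (z : R * R) : \bar R := (expR (z.2 - V) * \1_D z)%:E.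
have mD : measurable D.
  have -> : D = (`[0%R, l[ `*` `[0%R, V[) `&`
      ((fun z : R * R => (z.2 < a z.1)%R) @^-1` [set true]).
    apply/seteqP; split=> [[s u]/= [s0 u0 ua]|[s u] /= [[]]].
      by rewrite /= !in_itv/= s0 u0 ua.
    by rewrite /= !in_itv/= => s0 u0 ua.
  apply: measurableI; first exact: measurableX.
  rewrite -[X in measurable X]setTI.
  apply: (measurable_fun_ltr (f := snd) (g := a \o fst)) => //.
  exact: measurableT_comp.
have mk : measurable_fun setT (fun u : R => expR (u - V)).
  by apply: measurableT_comp => //; exact: measurable_funB.
have mg : measurable_fun setT g.
  apply/measurable_EFinP; apply: measurable_funM.
    exact: (measurableT_comp mk).
  exact: measurable_indic.
have g0 z : 0 <= g z by rewrite lee_fin mulr_ge0 ?expR_ge0.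
have := @fubini_tonelli _ _ _ _ R mu mu g mg g0.
have -> : \int[mu]_y \int[mu]_x g (x, y) = \int[mu]_(u in `[0%R, V[)
     ((expR (u - V))%:E * mu (`[0%R, l[ `&` [set s | (u < a s)%R])).
  rewrite [RHS]integral_mkcond; apply: eq_integral => u _.
  rewrite patchE; case: ifPn => [|] uV.
    have mE : measurable (`[0%R, l[ `&` [set s | (u < a s)%R]).
      apply: measurableI => //.
      rewrite -[X in measurable X]setTI.
      rewrite (_ : [set s | (u < a s)%R] = a @^-1` `]u, +oo[); first exact: ma.
      by apply/seteqP; split => s /=; rewrite in_itv/= andbT.
    rewrite -[X in mu X]setIT -integral_indic// -ge0_integralZl//; last first.
      exact/measurable_EFinP/measurable_indic.
    apply: eq_integral => s _; rewrite /g -EFinM; congr (_ * _)%:E.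
    rewrite !indicE; congr (_%:R); congr nat_of_bool.
    rewrite inE/= in_itv/= in uV.
    by apply/idP/idP; rewrite !inE /D/= in_itv/=; [case|case=> sl ua; split].
  rewrite integral0_eq// => s _; rewrite /g indicE memNset ?mulr0//.
  by move=> [_ /= uV' _]; move: uV; rewrite notin_setE/= in_itv/= uV'.
move=> <-.
have -> : (l * expR (- V))%:E = \int[mu]_(s in `[0%R, l[) (expR (- V))%:E.
  by rewrite integral_cst//= lebesgue_Ico// subr0 -EFinM mulrC.
rewrite [LHS]integral_mkcond [X in _ = X + _]integral_mkcond.
have mf : measurable_fun setT (fun x => \int[mu]_y g (x, y)).
  by have := @measurable_fun_fubini_tonelli_F _ _ _ _ R mu g mg g0; apply.
rewrite -ge0_integralD//; last 3 first.
- by move=> s _; rewrite patchE; case: ifP => // _; rewrite lee_fin expR_ge0.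
- by apply/(measurable_restrictT _ _).1 => //; exact: measurable_cst.
- by move=> s _; exact: integral_ge0.
apply: eq_integral => s _; rewrite !patchE.
case: ifPn => sl; last first.
  rewrite integral0_eq ?adde0// => u _; rewrite /g indicE memNset ?mulr0//.
  by move=> [/= sl' _ _]; move: sl; rewrite notin_setE/= in_itv/= sl'.
move: sl; rewrite inE/= in_itv/= => sl.
have /andP[as0 asV] := aV s sl.
have -> : \int[mu]_y g (s, y) = \int[mu]_(u in `[0%R, a s[) (expR (u - V))%:E.
  rewrite [RHS]integral_mkcond; apply: eq_integral => u _.
  rewrite patchE /g indicE; case: ifPn; rewrite ?inE ?notin_setE/= in_itv/=.
    move=> /andP[u0 ua]; rewrite mem_set ?mulr1//; split => //=.
    by rewrite u0 (lt_le_trans ua).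
  move=> ua; rewrite memNset ?mulr0//= => -[_ /= /andP[u0 _] ua'].
  by move: ua; rewrite u0 ua'.
by rewrite integral_expR_shift// sub0r -EFinD subrKC.
Qed.

Lemma clock_sum n (L : 'I_n -> R -> R) (al : 'I_n -> R) :
  (forall i, clock (L i)) -> (forall i, 0 <= al i)%R ->
  clock (fun t => \sum_i al i * L i t)%R.
Proof.
move=> LC al0; split.
- by apply: big1 => i _; rewrite (clock0 (LC i)) mulr0.
- by move=> s t s0 st; apply: ler_sum => i _; rewrite ler_wpM2l// (clock_le (LC i)).
- apply/subspace_continuousP => x Ax; apply: (cvg_big (op := +%R) (x0 := 0%R)) => [|i _]; first exact: add_continuous.
  apply: cvgM; first exact: cvg_cst.
  by move/subspace_continuousP: (clock_cts (LC i)); apply.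
Qed.

(* [l] read at the inverse of [k], frozen from time [T] on so as to be monotone
   on the whole line. *)
Definition clock_at (l k : R -> R) (T s : R) : R :=
  if (s < k T)%R then l (fine (clock_inv k s)) else l T.

Lemma clock_inv_before (k : R -> R) (T s : R) : clock k -> (0 <= T)%R ->
  (s < k T)%R -> (0 <= fine (clock_inv k s) <= T)%R /\ clock_inv k s \is a fin_num.
Proof.
move=> kC T0 skT.
have foo := clock_inv_fin kC T0 skT.
have ffin := first_time_fin foo.
split=> //; rewrite fine_ge0 ?first_time_ge0//= -lee_fin fineK//.
exact: first_time_le.
Qed.

Lemma clock_at_nondecreasing (l k : R -> R) (T : R) : clock l -> clock k ->
  (0 <= T)%R -> {homo clock_at l k T : s t / (s <= t)%R}.
Proof.
move=> lC kC T0 s t st; rewrite /clock_at.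
have [tk|kt] := ltP t (k T).
  have sk := le_lt_trans st tk; rewrite sk.
  have [/andP[s0 _] sfin] := clock_inv_before kC T0 sk.
  have [_ tfin] := clock_inv_before kC T0 tk.
  by apply: (clock_le lC) => //; apply: fine_le => //; exact: clock_inv_homo.
case: ifPn => // sk.
by have [/andP[s0 sT] _] := clock_inv_before kC T0 sk; exact: (clock_le lC).
Qed.

(** With [v] the inverse of [l] at [u], [l] exceeds [u] exactly after [v]; among the levels of [k]
    these times fill the interval from [k v] to [k T], up to its left end. *)
Lemma lebesgue_clock_gt (l k : R -> R) (T u : R) : clock l -> clock k ->
  (0 <= T)%R -> (0 <= u < l T)%R ->
  mu (`[0%R, k T[ `&` [set s | (u < clock_at l k T s)%R]) =
    (k T - k (fine (clock_inv l u)))%:E.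
Proof.
move=> lC kC T0 /andP[u0 ulT].
have [] := clock_inv_before lC T0 ulT.
set v := fine _ => /andP[v0 vT] fu.
have lv : l v = u by apply: clock_at_inv => //; exact: (clock_inv_fin lC T0).
have kv0 : (0 <= k v)%R by exact: clock_ge0.
have kvT : (k v <= k T)%R by exact: (clock_le kC).
have sub1 : `]k v, k T[ `<=`
    `[0%R, k T[ `&` [set s | (u < clock_at l k T s)%R].
  move=> s /=; rewrite !in_itv/= => /andP[vs sT].
  rewrite sT (ltW (le_lt_trans kv0 vs)); split => //.
  have s0 := ltW (le_lt_trans kv0 vs).
  rewrite /clock_at sT.
  have [/andP[w0 _] wfin] := clock_inv_before kC T0 sT.
  have kw : k (fine (clock_inv k s)) = s.
    by apply: clock_at_inv => //; exact: (clock_inv_fin kC T0).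
  have vw : (v < fine (clock_inv k s))%R.
    rewrite ltNge; apply/negP => wv.
    by have := clock_le kC w0 wv; rewrite kw leNgt vs.
  by apply/(clock_inv_lt lC u0 w0); rewrite -(fineK fu) lte_fin.
have sub2 : `[0%R, k T[ `&` [set s | (u < clock_at l k T s)%R] `<=`
    `[k v, k T[.
  move=> s /=; rewrite !in_itv/= => -[/andP[s0 sT]].
  rewrite /clock_at sT andbT.
  have [/andP[w0 _] wfin] := clock_inv_before kC T0 sT.
  have kw : k (fine (clock_inv k s)) = s.
    by apply: clock_at_inv => //; exact: (clock_inv_fin kC T0).
  rewrite -{2}kw => /(clock_inv_lt lC u0 w0).
  by rewrite -(fineK fu) lte_fin -/v => /ltW vw; exact: (clock_le kC).
have mm : measurable (`[0%R, k T[ `&` [set s | (u < clock_at l k T s)%R]).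
  apply: measurableI => //; rewrite -[X in measurable X]setTI.
  rewrite (_ : [set s | (u < clock_at l k T s)%R] = clock_at l k T @^-1` `]u, +oo[).
    by apply: nondecreasing_measurable => //; exact: clock_at_nondecreasing.
  by apply/seteqP; split => s /=; rewrite in_itv/= andbT.
apply/eqP; rewrite eq_le -(lebesgue_Ico kvT) le_measure ?inE//=.
have -> : mu `[k v, k T[ = mu `]k v, k T[.
  by rewrite /= !lebesgue_measure_itv/= !lte_fin.
by rewrite le_measure ?inE.
Qed.

(** Integration by parts for the integral of [expR (l - l T)] against [k] over [[0, T]]: the left
    side integrates in the levels of [k], the right side in those of [l]. *)
Lemma integral_clock_at (l k : R -> R) (T : R) : clock l -> clock k ->
  (0 <= T)%R ->
  \int[mu]_(s in `[0%R, k T[) (expR (clock_at l k T s - l T))%:E =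
  (k T * expR (- l T))%:E + \int[mu]_(u in `[0%R, l T[)
     ((expR (u - l T))%:E * (k T - clock_at k l T u)%:E).
Proof.
move=> lC kC T0; rewrite (@integral_expR_layer _ (k T) (l T)).
- congr +%E; apply: eq_integral => u; rewrite inE/= in_itv/= => ulT.
  by rewrite lebesgue_clock_gt// {1}/clock_at; case/andP: ulT => _ ->.
- exact: clock_ge0.
- exact: clock_ge0.
- by apply: nondecreasing_measurable => //; exact: clock_at_nondecreasing.
- move=> s /andP[s0 sT]; rewrite /clock_at sT.
  have [/andP[w0 wT] _] := clock_inv_before kC T0 sT.
  by rewrite (clock_ge0 lC)// (clock_le lC).
Qed.

(** This is d exp (A) = exp (A) dA, with each part of dA carried by the levels of its own [L i].
    Keeping [A T] in the exponent leaves only the increment of [A] after the inverse time. *)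
Lemma expR_clock_sum n (L : 'I_n -> R -> R) (al : 'I_n -> R) (T : R) :
  (forall i, clock (L i)) -> (forall i, 0 <= al i)%R -> (0 <= T)%R ->
  let A := (fun t => \sum_i al i * L i t)%R in
  \sum_i (al i)%:E * \int[mu]_(s in `[0%R, L i T[)
     (expR (A (fine (clock_inv (L i) s)) - A T))%:E = (1 - expR (- A T))%:E.
Proof.
move=> LC al0 T0 A; have AC : clock A := clock_sum LC al0.
pose k i (u : R) : \bar R := (expR (u - A T))%:E * (L i T - clock_at (L i) A T u)%:E.
have mclock (l m : R -> R) : clock l -> clock m -> measurable_fun setT (clock_at l m T).
  by move=> lC mC; apply: nondecreasing_measurable => //; exact: clock_at_nondecreasing.
have mexp : measurable_fun setT (fun u : R => expR (u - A T)).
  by apply: measurableT_comp => //; exact: measurable_funB.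
have clock_at_le i u : (clock_at (L i) A T u <= L i T)%R.
  rewrite /clock_at; case: ifPn => // uA.
  have [/andP[w0 wT] _] := clock_inv_before AC T0 uA.
  exact: (clock_le (LC i)).
have mk i : measurable_fun setT (k i).
  apply: emeasurable_funM; apply/measurable_EFinP => //.
  by apply: measurable_funB => //; exact: mclock.
have k0 i u : 0 <= k i u.
  by rewrite mule_ge0// lee_fin ?expR_ge0// subr_ge0.
transitivity (\sum_i ((al i * L i T * expR (- A T))%:E +
    \int[mu]_(u in `[0%R, A T[) ((al i)%:E * k i u))).
  apply: eq_bigr => i _; rewrite ge0_integralZl ?lee_fin//; last first.
    by apply: measurable_funTS; exact: mk.
  rewrite -mulrA EFinM -ge0_muleDr//; last 2 first.
  - by rewrite lee_fin mulr_ge0 ?expR_ge0// (clock_ge0 (LC i)).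
  - exact: integral_ge0.
  rewrite -integral_clock_at//; congr (_ * _); apply: eq_integral => s.
  by rewrite inE/= in_itv/= => /andP[_ sT]; rewrite /clock_at sT.
rewrite big_split/= -ge0_integral_sum//; last 2 first.
- by move=> i; apply: measurable_funTS; apply: emeasurable_funM; [exact: measurable_cst|exact: mk].
- by move=> i u _; rewrite mule_ge0// lee_fin.
(* At the inverse of [A] at [u] the weighted sum of the clocks is [A] itself, that is [u]. *)
have -> : \int[mu]_(u in `[0%R, A T[) (\sum_i (al i)%:E * k i u) =
    \int[mu]_(u in `[0%R, A T[) ((expR (u - A T))%:E * (A T - u)%:E).
  apply: eq_integral => u; rewrite inE/= in_itv/= => /andP[u0 uA].
  under eq_bigr do rewrite /k -!EFinM; rewrite sumEFin -EFinM; congr EFin.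
  under eq_bigr do rewrite mulrCA; rewrite -mulr_sumr; congr (_ * _)%R.
  under eq_bigr do rewrite mulrBr; rewrite sumrB; congr (_ - _)%R.
  have uoo := clock_inv_fin AC T0 uA.
  by rewrite -[RHS](clock_at_inv AC u0 uoo); apply: eq_bigr => i _; rewrite /clock_at uA.
(* The layer formula for [A] in its own levels, with [a s = s], has the explicit left side
   [1 - expR (- A T)]; its right side is the sum obtained so far. *)
have AT0 : (0 <= A T)%R by exact: clock_ge0.
have mid : measurable_fun [set: R] (idfun : R -> R) by exact: measurable_id.
have idle (s : R) : (0 <= s < A T)%R -> (0 <= idfun s <= A T)%R.
  by move=> /= /andP[-> /ltW ->].
have := integral_expR_layer AT0 AT0 mid idle.
rewrite integral_expR_shift// subrr expR0 sub0r => ->.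
rewrite sumEFin -!mulr_suml; congr (_ + _); apply: eq_integral => u.
rewrite inE/= in_itv/= => /andP[u0 uA]; congr (_ * _).
rewrite (_ : _ `&` _ = `]u, A T[%classic).
  by rewrite /= lebesgue_measure_itv/= lte_fin uA EFinB.
apply/seteqP; split => s /=; rewrite !in_itv/=; first by case=> /andP[_ ->] ->.
by move=> /andP[us ->]; rewrite us (ltW (le_lt_trans u0 us)).
Qed.

End pathwise_exponential.

(** * Measurability of inverses and stopped values *)

Section measurability_criteria.
Context {R : realType} {d} {T : measurableType d}.
Implicit Type D : set T.

Lemma measurable_fun_gt D (f : T -> R) :
  (forall c : R, measurable (D `&` [set w | c < f w])) -> measurable_fun D f.
Proof.
move=> h mD; apply: (measurability _ (RGenOInfty.measurableE R)) => //.
move=> _ /= -[_ [c ->] <-]; rewrite (_ : f @^-1` _ = [set w | c < f w]) => [//|].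
by apply/seteqP; split => w /=; rewrite in_itv/= andbT.
Qed.

Lemma measurable_fun_gt_ge0 D (f : T -> R) : measurable D ->
  (forall w, D w -> 0 <= f w) ->
  (forall c : R, 0 <= c -> measurable (D `&` [set w | c < f w])) -> measurable_fun D f.
Proof.
move=> mD f0 h; apply: measurable_fun_gt => c.
have [c0|c0] := leP 0 c; first exact: h.
rewrite (_ : _ `&` _ = D)//; apply/seteqP; split => w; first by case.
by move=> Dw; split => //=; apply: (lt_le_trans c0); exact: f0.
Qed.

Lemma emeasurable_fun_gt_ge0 D (f : T -> \bar R) : measurable D ->
  (forall w, D w -> (0 <= f w)%E) ->
  (forall c : R, 0 <= c -> measurable (D `&` [set w | (c%:E < f w)%E])) ->
  measurable_fun D f.
Proof.
move=> mD f0 h _; apply: (measurability _ (ErealGenOInfty.measurableE R)) => //.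
move=> _ /= -[_ [c ->] <-].
rewrite (_ : f @^-1` _ = [set w | (c%:E < f w)%E]); last first.
  by apply/seteqP; split => w /=; rewrite in_itv/= andbT.
have [c0|c0] := leP 0 c; first exact: h.
rewrite (_ : _ `&` _ = D)//; apply/seteqP; split => w; first by case.
by move=> Dw; split => //=; apply: (@lt_le_trans _ _ 0%E); [rewrite lte_fin|exact: f0].
Qed.

Lemma emeasurable_fun_lt D (f : T -> \bar R) :
  (forall c : R, measurable (D `&` [set w | (f w < c%:E)%E])) ->
  measurable_fun D f.
Proof.
move=> h mD; apply: (measurability _ (ErealGenInftyO.measurableE R)) => //.
move=> _ /= -[_ [c ->] <-].
rewrite (_ : f @^-1` _ = [set w | (f w < c%:E)%E]) => [//|].
by apply/seteqP; split => w /=; rewrite in_itv/=.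
Qed.

End measurability_criteria.

Section clock_processes.
Context {R : realType} {d} {T : measurableType d}.

Record clock_process (l : R -> T -> R) : Prop := ClockProcess {
  clock_path : forall w, clock (l ^~ w) ;
  clock_measurable : forall t, 0 <= t -> measurable_fun setT (l t) }.

Variable l : R -> T -> R.
Hypothesis lP : clock_process l.

Let m_gt t (rho : T -> R) : 0 <= t -> measurable_fun setT rho ->
  measurable [set w | rho w < l t w].
Proof.
move=> t0 mrho; rewrite -[X in measurable X]setTI.
by apply: (measurable_fun_ltr mrho (clock_measurable lP t0)) => //.
Qed.

Lemma measurable_clock_inv (rho : T -> R) : measurable_fun setT rho ->
  measurable_fun setT (fun w => clock_inv (l ^~ w) (rho w)).
Proof.
move=> mrho; apply: emeasurable_fun_lt => c; rewrite setTI.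
rewrite (_ : [set _ | _] = \bigcup_(q : rat)
    [set w : T | 0 <= (ratr q : R) < c /\ rho w < l (ratr q) w]); last first.
  apply/seteqP; split => w /=.
    move=> /first_time_lt[s [s0 sc /= rs]].
    have [q] := rat_in_itvoo sc; rewrite in_itv/= => /andP[sq qc].
    exists q => //; split; first by rewrite qc (ltW (le_lt_trans s0 sq)).
    exact: (lt_le_trans rs (clock_le (clock_path lP w) s0 (ltW sq))).
  move=> [q _ [/andP[q0 qc] rq]]; apply/first_time_lt.
  by exists (ratr q); split.
apply: bigcupT_measurable_rat => q.
have [/andP[q0 qc]|qc] := boolP (0 <= (ratr q : R) < c).
  rewrite (_ : [set _ | _] = [set w | rho w < l (ratr q) w]); first exact: m_gt.
  by apply/seteqP; split => w /=; [case|].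
by rewrite (_ : [set _ | _] = set0)//; apply/seteqP; split => w //= -[].
Qed.

Lemma clock_gt_rat (w : T) (t c : R) : 0 <= c -> 0 <= t -> c < l t w ->
  exists2 q : rat, 0 <= (ratr q : R) < t & c < l (ratr q) w.
Proof.
move=> c0 t0 ct; have lC := clock_path lP w.
have /(clock_inv_lt lC c0 t0)/first_time_lt[s [s0 st /= cs]] := ct.
have [q] := rat_in_itvoo st; rewrite in_itv/= => /andP[sq qt].
exists q; first by rewrite (ltW (le_lt_trans s0 sq)).
exact: (lt_le_trans cs (clock_le lC s0 (ltW sq))).
Qed.

Lemma clock_at_time_gtE (S : T -> \bar R) (c : R) : 0 <= c ->
  (forall w, 0 <= S w)%E ->
  [set w | (S w < +oo)%E] `&` [set w | c < l (fine (S w)) w] =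
  [set w | (S w < +oo)%E] `&` \bigcup_(q : rat)
    [set w | 0 <= (ratr q : R) /\ c < l (ratr q) w /\ ((ratr q)%:E < S w)%E].
Proof.
move=> c0 S0; apply/seteqP; split => w /= [Soo].
  move=> /(clock_gt_rat c0 (fine_ge0 (S0 w)))[q /andP[q0 qS] cq]; split => //.
  exists q => //; split => //; split => //.
  by rewrite -[S w]fineK ?lte_fin// ge0_fin_numE.
move=> [q _ /= [q0 [cq qS]]]; split => //.
apply: (lt_le_trans cq); apply: (clock_le (clock_path lP w)) => //.
by apply/ltW; move: qS; rewrite -[S w]fineK ?lte_fin// ge0_fin_numE.
Qed.

Lemma measurable_clock_at_time (S : T -> \bar R) : measurable_fun setT S ->
  (forall w, 0 <= S w)%E -> measurable_fun setT (fun w => l (fine (S w)) w).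
Proof.
move=> mS S0; apply: measurable_fun_gt_ge0 => //.
  by move=> w _; apply: (clock_ge0 (clock_path lP w)); exact: fine_ge0.
move=> c c0; rewrite setTI.
have mfin : measurable [set w | (S w < +oo)%E].
  by rewrite -[X in measurable X]setTI; exact: emeasurable_fun_infty_o.
(* [fine] sends an infinite [S w] to 0, where the clock vanishes, so [c < l] with [0 <= c] forces
   [S w] to be finite. *)
rewrite (_ : [set w | c < l (fine (S w)) w] =
    [set w | (S w < +oo)%E] `&` [set w | c < l (fine (S w)) w]); last first.
  apply/seteqP; split => w /=; last by case.
  move=> cl; split => //; rewrite ltNge leye_eq; apply/negP => /eqP Soo.
  by move: cl; rewrite Soo/= (clock0 (clock_path lP w)) ltNge c0.
rewrite clock_at_time_gtE//; apply: measurableI => //.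
apply: bigcupT_measurable_rat => q.
have [q0|q0] := leP 0 (ratr q : R); last first.
  by rewrite (_ : [set _ | _] = set0)//; apply/seteqP; split => w //= -[].
rewrite (_ : [set _ | _] = [set w | c < l (ratr q) w] `&`
    [set w | ((ratr q)%:E < S w)%E]); last first.
  by apply/seteqP; split => w /=; [case=> _ []|case=> ? ?].
apply: measurableI; first by apply: m_gt => //; exact: measurable_cst.
by rewrite -[X in measurable X]setTI; exact: emeasurable_fun_o_infty.
Qed.

(** The [total_local_time] of a process killed at [S], for a single clock; the two unfold to the
    same supremum. *)
Definition stopped_total (S : T -> \bar R) (w : T) : \bar R :=
  ereal_sup [set (l (fine (mine t%:E (S w))) w)%:E | t in [set t | 0 <= t]].

Lemma stopped_total_fin (S : T -> \bar R) (w : T) : (0 <= S w)%E ->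
  (S w < +oo)%E -> stopped_total S w = (l (fine (S w)) w)%:E.
Proof.
move=> S0 Soo; apply/eqP; rewrite eq_le; apply/andP; split.
  apply: ge_ereal_sup => _ [t /= t0 <-]; rewrite lee_fin.
  have Sfin : S w \is a fin_num by rewrite ge0_fin_numE.
  apply: (clock_le (clock_path lP w)).
    by rewrite fine_ge0// /mine; case: ifP; rewrite ?lee_fin.
  rewrite fine_le//; last by rewrite ge_min lexx orbT.
  by rewrite /mine; case: ifP.
apply: ereal_sup_ubound; exists (fine (S w)); first exact: fine_ge0.
by rewrite fineK ?ge0_fin_numE// minxx.
Qed.

Lemma measurable_stopped_total (S : T -> \bar R) : measurable_fun setT S ->
  (forall w, 0 <= S w)%E -> measurable_fun setT (stopped_total S).
Proof.
move=> mS S0; apply: emeasurable_fun_gt_ge0 => //.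
  move=> w _; apply: ereal_sup_ubound; exists 0 => //=.
  rewrite (_ : mine _ _ = 0%E) ?(clock0 (clock_path lP w))//.
  by apply/eqP; rewrite eq_minl.
move=> c c0; rewrite setTI.
rewrite (_ : [set _ | _] = \bigcup_(q : rat)
    [set w | 0 <= (ratr q : R) /\ (c < l (ratr q) w /\ ((ratr q)%:E < S w)%E)]).
  apply: bigcupT_measurable_rat => q.
  have [q0|q0] := leP 0 (ratr q : R); last first.
    by rewrite (_ : [set _ | _] = set0)//; apply/seteqP; split => w //= -[].
  rewrite (_ : [set _ | _] = [set w | c < l (ratr q) w] `&`
      [set w | ((ratr q)%:E < S w)%E]); last first.
    by apply/seteqP; split => w /=; [case=> _ []|case=> ? ?].
  apply: measurableI; first by apply: m_gt => //; exact: measurable_cst.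
  by rewrite -[X in measurable X]setTI; exact: emeasurable_fun_o_infty.
apply/seteqP; split => w /=.
  move=> /ereal_sup_gt[_ [t /= t0 <-]]; rewrite lte_fin => ct.
  have m0 : (0 <= mine t%:E (S w))%E by rewrite le_min lee_fin t0 S0.
  have mfin : mine t%:E (S w) \is a fin_num.
    by rewrite ge0_fin_numE// gt_min ltry.
  have [q /andP[q0 qm] cq] := clock_gt_rat c0 (fine_ge0 m0) ct.
  exists q => //; split => //; split => //.
  by move: qm; rewrite -lte_fin fineK// lt_min => /andP[].
move=> [q _ [q0 [cq qS]]]; apply: (@lt_le_trans _ _ (l (ratr q) w)%:E).
  by rewrite lte_fin.
apply: ereal_sup_ubound; exists (ratr q) => //=.
by rewrite (_ : mine _ _ = (ratr q)%:E)//; apply/eqP; rewrite eq_minl ltW.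
Qed.

End clock_processes.

Lemma clock_process_comp {R : realType} {d d'} {T : measurableType d}
    {T' : measurableType d'} (l : R -> T -> R) (f : T' -> T) :
  measurable_fun setT f -> clock_process l ->
  clock_process (fun t w => l t (f w)).
Proof.
move=> mf [lC lm]; split => [w|t t0]; first exact: lC.
by apply: measurableT_comp => //; exact: lm.
Qed.

(** * Laws, image measures and independence *)

Definition pker_law {R : realType} {d d'} {E : measurableType d}
  {W : measurableType d'} (k : R.-pker E ~> W) (x : E) : set W -> \bar R := k x.

HB.instance Definition _ (R : realType) d d' (E : measurableType d)
  (W : measurableType d') (k : R.-pker E ~> W) (x : E) :=
  Measure.on (pker_law k x).

HB.instance Definition _ (R : realType) d d' (E : measurableType d)
  (W : measurableType d') (k : R.-pker E ~> W) (x : E) :=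
  Measure_isProbability.Build _ _ _ (pker_law k x) (prob_kernel x).

(* The pushforward of a finite measure, with the measurability proof as an
   argument so that its structures can be inferred. *)
Definition image_measure {R : realType} {d d'} {T : measurableType d}
  {T' : measurableType d'} (m : {finite_measure set T -> \bar R}) (f : T -> T')
  (mf : measurable_fun setT f) : set T' -> \bar R := pushforward m f.

Section image_measure.
Context {R : realType} {d d'} {T : measurableType d} {T' : measurableType d'}.
Variables (m : {finite_measure set T -> \bar R}) (f : T -> T')
  (mf : measurable_fun setT f).

Let im : {measure set T' -> \bar R} :=
  measure_function_pushforward__canonical__measure_function_Measure m mf.

HB.instance Definition _ := isMeasure.Build _ _ _ (image_measure m mf)
  (measure0 im) (measure_ge0 im) (@measure_semi_sigma_additive _ _ _ im).

Let fin_num_image : fin_num_fun (image_measure m mf).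
Proof.
move=> A mA; apply: fin_num_measure.
by rewrite -[X in measurable X]setTI; exact: mf.
Qed.

HB.instance Definition _ := @Measure_isFinite.Build _ _ _ (image_measure m mf)
  fin_num_image.

Lemma ge0_integral_image (h : T' -> \bar R) : measurable_fun setT h ->
  (forall y, 0 <= h y)%E ->
  (\int[image_measure m mf]_y h y = \int[m]_x h (f x))%E.
Proof. by move=> mh h0; rewrite (@ge0_integral_pushforward _ _ _ _ R _ mf). Qed.

End image_measure.

Section independence.
Context {R : realType} {d d'} {W : measurableType d} {V : measurableType d'}.
Variables (P : probability W R) (Q : probability V R) (D : set W).
Variables (G : W -> R) (Phi : W -> V).
Hypotheses (mD : measurable D) (mG : measurable_fun setT G)
  (mPhi : measurable_fun setT Phi).
Hypothesis indep : forall A B, measurable A -> measurable B ->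
  (P (D `&` (G @^-1` A `&` Phi @^-1` B)) = P (D `&` G @^-1` A) * Q B)%E.
Local Open Scope ereal_scope.

(** Under [P] restricted to [D] the pair of [G] and [Phi] has a product law, since it has one on
    rectangles; Tonelli then separates the factors. *)
Lemma integral_indep (H : V -> \bar R) : measurable_fun setT H ->
  (forall v, 0 <= H v) -> (forall w, D w -> 0 <= G w)%R ->
  \int[P]_(w in D) ((G w)%:E * H (Phi w)) =
  (\int[P]_(w in D) (G w)%:E) * \int[Q]_v H v.
Proof.
move=> mH H0 G0.
pose PD : {finite_measure set W -> \bar R} := mrestr P mD.
have mGP : measurable_fun setT (fun w => (G w, Phi w)).
  exact/measurable_fun_pairP.
pose m1 : {finite_measure set R -> \bar R} := image_measure PD mG.
pose m12 : {measure set (R * V) -> \bar R} := image_measure PD mGP.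
have E (X : set (R * V)) : measurable X -> (m1 \x Q) X = m12 X.
  apply: product_measure_unique => A B mA mB.
  by rewrite /m12/= /m1/= /image_measure /pushforward/= /mrestr setIC indep// setIC.
(* [G] is nonnegative only on [D]; [Num.max 0] makes the integrand nonnegative everywhere and
   changes nothing on [D]. *)
pose f (z : R * V) : \bar R := (Num.max 0 z.1)%:E * H z.2.
have mmax : measurable_fun setT (fun r : R => (Num.max 0 r)%:E).
  apply/measurable_EFinP; apply: measurable_maxr => //.
have mf : measurable_fun setT f.
  apply: emeasurable_funM; last exact: measurableT_comp.
  exact: (measurableT_comp mmax).
have f0 z : 0 <= f z by rewrite mule_ge0// lee_fin le_max lexx.
have DE (h : W -> \bar R) : measurable_fun setT h -> (forall w, 0 <= h w) ->
    \int[P]_(w in D) h w = \int[PD]_w h w.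
  move=> mh h0; rewrite (@ge0_negligible_integral _ _ _ _ setT (~` D))//; last 2 first.
  - exact: measurableC.
  - by rewrite /PD/= /mrestr setICl measure0.
  rewrite setTD setCK; apply: eq_measure_integral => A mA AD.
  by rewrite /PD/= /mrestr setIidl.
have DG (h : V -> \bar R) : \int[P]_(w in D) ((G w)%:E * h (Phi w)) =
    \int[P]_(w in D) ((Num.max 0 (G w))%:E * h (Phi w)).
  by apply: eq_integral => w /[!inE] /G0 Gw; rewrite max_r.
have mGm : measurable_fun setT (fun w => (Num.max 0 (G w))%:E).
  exact: (measurableT_comp mmax).
have DG1 : \int[P]_(w in D) (G w)%:E = \int[P]_(w in D) (Num.max 0 (G w))%:E.
  by apply: eq_integral => w /[!inE] /G0 Gw; rewrite max_r.
have max0 (r : R) : 0 <= (Num.max 0 r)%:E :> \bar R by rewrite lee_fin le_max lexx.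
rewrite DG DG1 !DE//; last 2 first.
- by apply: emeasurable_funM => //; exact: measurableT_comp.
- by move=> w; rewrite mule_ge0.
transitivity (\int[m12]_z f z); first by rewrite ge0_integral_image.
transitivity (\int[m1 \x Q]_z f z).
  by apply: eq_measure_integral => A mA _; exact/esym/E.
rewrite fubini_tonelli1//.
transitivity (\int[m1]_r ((\int[Q]_v H v) * (Num.max 0 r)%:E)).
  apply: eq_integral => r _; rewrite muleC /fubini_F/= -ge0_integralZl//.
rewrite ge0_integralZl//; last exact: integral_ge0.
by rewrite muleC ge0_integral_image.
Qed.

End independence.

(** * Stopping times and the strong Markov property *)

Section stopping_times.
Context {R : realType} {dE} {E : measTopologicalType dE}
  {d} {W : measurableType d}.
Variable X : markov_process R E W.
Implicit Types (t : R) (A : set W) (S T : W -> \bar R).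

Lemma measurable_sub_sigma (G : set (set W)) A : sigma_algebra setT G ->
  @measurable _ (g_sigma_algebraType G) A <-> G A.
Proof. by move=> sG; rewrite /measurable/= (sigma_algebra_id sG). Qed.

Lemma history_P t A : 0 <= t ->
  @measurable _ (g_sigma_algebraType (history X t)) A <-> history X t A.
Proof. by move=> t0; apply: measurable_sub_sigma; exact: history_sigma. Qed.

Lemma historyI t A B : 0 <= t -> history X t A -> history X t B ->
  history X t (A `&` B).
Proof.
by move=> t0 /(history_P _ t0) mA /(history_P _ t0) mB;
  apply/(history_P _ t0); exact: measurableI.
Qed.

Lemma historyC t A : 0 <= t -> history X t A -> history X t (~` A).
Proof.
by move=> t0 /(history_P _ t0) mA; apply/(history_P _ t0); exact: measurableC.
Qed.

Lemma history_set0 t : 0 <= t -> history X t set0.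
Proof. by move=> t0; apply/(history_P _ t0); exact: measurable0. Qed.

Lemma history_setT t : 0 <= t -> history X t setT.
Proof. by move=> t0; apply/(history_P _ t0); exact: measurableT. Qed.

Lemma history_bigcup_rat t (F : rat -> set W) : 0 <= t ->
  (forall q, history X t (F q)) -> history X t (\bigcup_q F q).
Proof.
move=> t0 h; apply/(history_P _ t0); apply: bigcupT_measurable_rat => q.
exact/(history_P _ t0).
Qed.

Lemma stopping_history T t s : stopping_time (history X) T -> 0 <= s -> s <= t ->
  history X t [set w | (T w <= s%:E)%E].
Proof. by move=> [T0 hT] s0 st; apply: (history_le s0 st); exact: hT. Qed.

Lemma stopping_history_gt T t s : stopping_time (history X) T -> 0 <= s -> s <= t ->
  history X t [set w | (s%:E < T w)%E].
Proof.
move=> hT s0 st; rewrite (_ : [set _ | _] = ~` [set w | (T w <= s%:E)%E]).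
  by apply: historyC; [exact: le_trans st|exact: stopping_history].
by apply/seteqP; split => w /=; rewrite ltNge => /negP.
Qed.

Lemma measurable_stopping T : stopping_time (history X) T -> measurable_fun setT T.
Proof.
move=> hT; have [T0 h] := hT.
apply: emeasurable_fun_gt_ge0 => // c c0; rewrite setTI.
exact: (history_measurable c0 (stopping_history_gt hT c0 (lexx c))).
Qed.

Lemma measurable_finite_time T : stopping_time (history X) T ->
  measurable [set w | (T w < +oo)%E].
Proof.
move=> /measurable_stopping mT.
by rewrite -[X in measurable X]setTI; exact: emeasurable_fun_infty_o.
Qed.

Lemma stopping_cst (r : R) : 0 <= r -> stopping_time (history X) (fun=> r%:E).
Proof.
move=> r0; split => [w|t t0]; first by rewrite lee_fin.
have [rt|rt] := leP r t.
  rewrite (_ : [set _ | _] = setT); first exact: history_setT.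
  by apply/seteqP; split => w //= _; rewrite lee_fin.
rewrite (_ : [set _ | _] = set0); first exact: history_set0.
by apply/seteqP; split => w //=; rewrite lee_fin leNgt rt.
Qed.

Lemma stopped_setT T : stopping_time (history X) T ->
  stopped_sigma_algebra (history X) T setT.
Proof.
by move=> [_ hT]; split => // t t0; rewrite setTI; exact: hT.
Qed.

(** On [S <= t], [S < T] means either that a rational at most [t] separates [S] from [T], or that
    [t < T]; both events are known at time [t]. *)
Lemma stopped_lt S T : stopping_time (history X) S -> stopping_time (history X) T ->
  stopped_sigma_algebra (history X) S [set w | (S w < T w)%E].
Proof.
move=> hS hT; split.
  have mS := measurable_stopping hS; have mT := measurable_stopping hT.
  rewrite (_ : [set _ | _] = \bigcup_(q : rat) ([set w | (S w < (ratr q)%:E)%E] `&`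
      [set w | ((ratr q)%:E < T w)%E])).
    apply: bigcupT_measurable_rat => q.
    apply: measurableI; rewrite -[X in measurable X]setTI.
      exact: emeasurable_fun_infty_o.
    exact: emeasurable_fun_o_infty.
  apply/seteqP; split => w /=; last by move=> [q _ [/= Sq qT]]; exact: lt_trans qT.
  move=> ST; have S0 := hS.1 w.
  have Soo : (S w < +oo)%E by rewrite (lt_le_trans ST)// leey.
  have Sfin : S w \is a fin_num by rewrite ge0_fin_numE.
  pose v := mine (T w) (S w + 1)%E.
  have Sv : (S w < v)%E by rewrite lt_min ST/= lteDl// lte_fin.
  have vfin : v \is a fin_num.
    rewrite ge0_fin_numE; last by rewrite (ltW (le_lt_trans S0 Sv)).
    by rewrite gt_min lte_add_pinfty ?orbT// ltry.
  have : fine (S w) < fine v by rewrite -lte_fin !fineK.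
  move=> /rat_in_itvoo[q]; rewrite in_itv/= => /andP[Sq qv]; exists q => //=.
  split; first by rewrite -(fineK Sfin) lte_fin.
  have : ((ratr q)%:E < v)%E by rewrite -(fineK vfin) lte_fin.
  by rewrite lt_min => /andP[].
move=> t t0.
rewrite (_ : _ `&` _ = (\bigcup_(q : rat)
    [set w | 0 <= (ratr q : R) <= t /\ ((S w <= (ratr q)%:E)%E /\ ((ratr q)%:E < T w)%E)])
    `|` ([set w | (S w <= t%:E)%E] `&` [set w | (t%:E < T w)%E])); last first.
  apply/seteqP; split => w /=.
    move=> [ST St]; have [tT|Tt] := ltP t%:E (T w); [by right|left].
    have S0 := hS.1 w; have T0 := hT.1 w.
    have Tfin : T w \is a fin_num by rewrite ge0_fin_numE// (le_lt_trans Tt) ?ltry.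
    have Sfin : S w \is a fin_num by rewrite ge0_fin_numE// (le_lt_trans St) ?ltry.
    have : fine (S w) < fine (T w) by rewrite -lte_fin !fineK.
    move=> /rat_in_itvoo[q]; rewrite in_itv/= => /andP[Sq qT].
    exists q => //; split.
      rewrite (ltW (le_lt_trans (fine_ge0 S0) Sq))/= -lee_fin (le_trans _ Tt)//.
      by rewrite -(fineK Tfin) lee_fin ltW.
    by rewrite -(fineK Tfin) -(fineK Sfin) lee_fin lte_fin (ltW Sq) qT.
  move=> [[q _ [/andP[q0 qt] [Sq qT]]]|[St tT]].
    by split; [exact: le_lt_trans qT|rewrite (le_trans Sq)// lee_fin].
  by split => //; exact: le_lt_trans tT.
apply/(history_P _ t0); apply: measurableU; last first.
  apply/(history_P _ t0); apply: historyI => //.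
    exact: stopping_history.
  exact: stopping_history_gt.
apply: bigcupT_measurable_rat => q.
have [/andP[q0 qt]|qt] := boolP (0 <= (ratr q : R) <= t); last first.
  by rewrite (_ : [set _ | _] = set0)//; apply/seteqP; split => w //= -[].
apply/(history_P _ t0).
rewrite (_ : [set _ | _] = [set w | (S w <= (ratr q)%:E)%E] `&`
    [set w | ((ratr q)%:E < T w)%E]); last first.
  by apply/seteqP; split => w /=; [case|].
apply: historyI => //; first exact: stopping_history.
exact: stopping_history_gt.
Qed.

Record adapted_clock (l : R -> W -> R) : Prop := AdaptedClock {
  adapted_clock_path : forall w, clock (l ^~ w) ;
  adapted_clock_history : forall t (B : set R), 0 <= t -> measurable B ->
    history X t (l t @^-1` B) }.

Section adapted_clock.
Variable l : R -> W -> R.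
Hypothesis lA : adapted_clock l.

Lemma adapted_clock_process : clock_process l.
Proof.
split => [w|t t0]; first exact: adapted_clock_path.
move=> _ B mB; rewrite setTI; apply: (@history_measurable _ _ _ _ _ X _ t0).
exact: adapted_clock_history.
Qed.

Lemma adapted_clock_gt t (r : R) : 0 <= t -> history X t [set w | r < l t w].
Proof.
move=> t0; rewrite (_ : [set _ | _] = l t @^-1` `]r, +oo[).
  exact: adapted_clock_history.
by apply/seteqP; split => w /=; rewrite in_itv/= andbT.
Qed.

(** The inverse is at most [t] when the level is exceeded at every time after [t], an event that
    looks immediately past [t]: hence the right continuity of the filtration. *)
Lemma stopping_clock_inv (r : R) :
  stopping_time (history X) (fun w => clock_inv (l ^~ w) r).
Proof.
split => [w|t t0]; first exact: first_time_ge0.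
have [r0|r0] := leP 0 r; last first.
  rewrite (_ : [set _ | _] = setT); first exact: history_setT.
  apply/seteqP; split => w //= _.
  by rewrite (clock_inv_lt0 (adapted_clock_path lA w))// lee_fin.
apply: (history_right_continuous t0) => s /= ts.
have s0 := ltW (le_lt_trans t0 ts).
pose u n := t + (s - t) / n.+1%:R.
have st0 : 0 < s - t by rewrite subr_gt0.
have u0 n : t < u n by rewrite ltrDl divr_gt0.
rewrite (_ : [set _ | _] = \bigcap_n [set w | r < l (u n) w]).
  apply/(history_P _ s0); apply: bigcapT_measurable => n; apply/(history_P _ s0).
  apply: (@history_le _ _ _ _ _ X (u n)).
  - exact: (ltW (le_lt_trans t0 (u0 n))).
  - by rewrite /u -lerBrDl ler_pdivrMr// ler_peMr ?(ltW st0)// ler1n.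
  - by apply: adapted_clock_gt; exact: (ltW (le_lt_trans t0 (u0 n))).
apply/seteqP; split => w /=.
  move=> /(clock_inv_le (adapted_clock_path lA w) t0 r0) h n _ /=.
  exact: h.
move=> h; apply/(clock_inv_le (adapted_clock_path lA w) t0 r0) => v tv.
have vt0 : 0 < v - t by rewrite subr_gt0.
(* Chosen so that [u n <= v]. *)
pose n := Num.truncn ((s - t) / (v - t)).
have hn : (s - t) / (v - t) < n.+1%:R by exact: truncnS_gt.
apply: (lt_le_trans (h n I)); apply: (clock_le (adapted_clock_path lA w)).
  exact: (ltW (le_lt_trans t0 (u0 n))).
by rewrite /u -lerBrDl ler_pdivrMr// -ler_pdivrMl// mulrC ltW.
Qed.

(** By continuity the clock exceeds a level [c >= 0] at a finite [T] exactly when it does so at some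
    rational time before [T]; on [T <= t] such times are below [t]. *)
Lemma stopped_clock T (B : set R) : stopping_time (history X) T -> measurable B ->
  stopped_sigma_algebra (history X) T ((fun w => l (fine (T w)) w) @^-1` B).
Proof.
move=> hT mB; have T0 := hT.1; have mT := measurable_stopping hT.
split.
  rewrite -[X in measurable X]setTI.
  exact: (measurable_clock_at_time adapted_clock_process).
move=> t t0; apply/(history_P _ t0); rewrite setIC.
have mD : @measurable _ (g_sigma_algebraType (history X t)) [set w | (T w <= t%:E)%E].
  by apply/(history_P _ t0); exact: stopping_history.
suff : @measurable_fun _ _ (g_sigma_algebraType (history X t)) _
    [set w | (T w <= t%:E)%E] (fun w => l (fine (T w)) w) by apply.
apply: measurable_fun_gt_ge0 => //.
  by move=> w _; apply: (clock_ge0 (adapted_clock_path lA w)); exact: fine_ge0.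
move=> c c0; apply/(history_P _ t0).
have DE : [set w | (T w <= t%:E)%E] =
    [set w | (T w <= t%:E)%E] `&` [set w | (T w < +oo)%E].
  apply/seteqP; split => w /=; last by case.
  by move=> Tt; split => //; apply: (le_lt_trans Tt); rewrite ltry.
rewrite DE -setIA (clock_at_time_gtE adapted_clock_process)// setIA -DE setI_bigcupr.
apply: history_bigcup_rat => // q.
have [/andP[q0 qt]|qt] := boolP (0 <= (ratr q : R) < t); last first.
  rewrite (_ : _ `&` _ = set0); first exact: history_set0.
  apply/seteqP; split => w //= -[Tt [q0 [_ qT]]]; move: qt.
  by rewrite q0/= -lte_fin (lt_le_trans qT).
rewrite (_ : _ `&` _ = [set w | (T w <= t%:E)%E] `&` ([set w | c < l (ratr q) w] `&`
    [set w | ((ratr q)%:E < T w)%E])); last first.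
  by apply/seteqP; split => w /=; [case=> ? [_ []]|case=> ? []].
apply: historyI => //; first exact: stopping_history.
apply: historyI => //; last by apply: stopping_history_gt => //; exact: ltW.
by apply: (history_le q0 (ltW qt)); exact: adapted_clock_gt.
Qed.

End adapted_clock.

Lemma adapted_clock_sum n (L : 'I_n -> R -> W -> R) (al : 'I_n -> R) :
  (forall i, adapted_clock (L i)) -> (forall i, 0 <= al i) ->
  adapted_clock (fun t w => \sum_i al i * L i t w).
Proof.
move=> LA al0; split => [w|t B t0 mB].
  by apply: clock_sum => // i; exact: adapted_clock_path.
apply/(history_P _ t0); rewrite -[X in measurable X]setTI.
suff : @measurable_fun _ _ (g_sigma_algebraType (history X t)) _ setT
    (fun w => \sum_i al i * L i t w) by apply.
apply: measurable_sum => i; apply: measurable_funM; first exact: measurable_cst.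
move=> _ C mC; rewrite setTI; apply/(history_P _ t0).
exact: adapted_clock_history.
Qed.

End stopping_times.

(** * The strong Markov property for integrals and null sets *)

Section strong_markov_integral.
Context {R : realType} {dE} {E : measTopologicalType dE}
  {d} {W : measurableType d}.
Variable X : markov_process R E W.
Implicit Types (T : W -> \bar R).

Lemma measurable_path t : 0 <= t -> measurable_fun setT (Defs.path X t).
Proof.
move=> t0 _ B mB; rewrite setTI; apply: (@history_measurable _ _ _ _ _ X _ t0).
exact: path_adapted.
Qed.

(** Made total by leaving the path alone where [T] is infinite, so as to be measurable on the whole
    sample space. *)
Definition shift_at T (w : W) : W :=
  if (T w < +oo)%E then Defs.shift X (fine (T w)) w else w.

Lemma measurable_shift_at T : stopping_time (history X) T ->
  measurable_fun setT (shift_at T).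
Proof.
move=> hT; have mfin := measurable_finite_time hT.
apply: measurable_fun_if => //.
- apply: (measurable_fun_bool true); rewrite setTI.
  by rewrite (_ : _ @^-1` _ = [set w | (T w < +oo)%E]).
- rewrite setTI; exact: (shift_stopping_measurable hT).
Qed.

Lemma path_at_time T w : (0 <= T w)%E -> (T w < +oo)%E ->
  Defs.path X (fine (T w)) w = Defs.path X 0 (shift_at T w).
Proof.
by move=> T0 Too; rewrite /shift_at Too path_shift ?addr0// fine_ge0.
Qed.

Lemma measurable_path_at T : stopping_time (history X) T ->
  measurable_fun [set w | (T w < +oo)%E] (fun w => Defs.path X (fine (T w)) w).
Proof.
move=> hT; apply: (eq_measurable_fun (fun w => Defs.path X 0 (shift_at T w))).
  by move=> w /[!inE] Too; rewrite path_at_time//; exact: hT.1.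
apply: measurable_funTS; apply: measurableT_comp; first exact: measurable_path.
exact: measurable_shift_at.
Qed.

Lemma measurable_law_path_at T B : stopping_time (history X) T -> measurable B ->
  measurable_fun [set w | (T w < +oo)%E]
    (fun w => law X (Defs.path X (fine (T w)) w) B).
Proof.
move=> hT mB.
apply: (measurable_comp (F := setT) (f := fun x => law X x B)) => //.
- exact: measurable_kernel.
- exact: measurable_path_at.
Qed.

(** Not the state at [T] but only the law of [Phi] from that state has to be constant. This covers
    fixed times, where the state is random, as well as times at which the path sits at a given
    point. *)
Lemma strong_markov_law T x d' (V : measurableType d') (Q : probability V R)
    (Phi : W -> V) (A : set W) (B : set V) :
  stopping_time (history X) T -> measurable_fun setT Phi ->
  measurable B ->
  {ae law X x, forall w, (T w < +oo)%E ->
    law X (Defs.path X (fine (T w)) w) (Phi @^-1` B) = Q B} ->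
  stopped_sigma_algebra (history X) T A ->
  (law X x ([set w | (T w < +oo)%E] `&` (A `&` (Phi \o shift_at T) @^-1` B)) =
   law X x ([set w | (T w < +oo)%E] `&` A) * Q B)%E.
Proof.
move=> hT mPhi mB hQ hA; have mA := hA.1; have mfin := measurable_finite_time hT.
have mPB : measurable (Phi @^-1` B).
  by rewrite -[X in measurable X]setTI; exact: mPhi.
rewrite (_ : _ `&` _ =
    A `&` [set w | (T w < +oo)%E /\ (Phi @^-1` B) (Defs.shift X (fine (T w)) w)]).
  rewrite strong_markov//.
  transitivity (\int[law X x]_(w in A `&` [set w | (T w < +oo)%E]) cst (Q B) w)%E.
    apply: ae_eq_integral => //; first exact: measurableI.
    - apply: (measurable_funS mfin); first by move=> w [].
      exact: measurable_law_path_at.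
    - by apply: filterS hQ => w h [_ Too]; exact: h.
  rewrite -[Q B]fineK ?fin_num_measure// integral_cst; last exact: measurableI.
  by rewrite muleC setIC.
apply/seteqP; split => w /=; rewrite /shift_at.
  by case=> Too [Aw]; rewrite Too.
by move=> [Aw [Too Bw]]; rewrite Too.
Qed.

Lemma integral_strong_markov T x d' (V : measurableType d') (Q : probability V R)
    (Phi : W -> V) (G : W -> R) (H : V -> \bar R) :
  stopping_time (history X) T -> measurable_fun setT Phi ->
  (forall B, measurable B -> {ae law X x, forall w, (T w < +oo)%E ->
    law X (Defs.path X (fine (T w)) w) (Phi @^-1` B) = Q B}) ->
  (forall B, measurable B -> stopped_sigma_algebra (history X) T (G @^-1` B)) ->
  (forall w, (T w < +oo)%E -> 0 <= G w) ->
  measurable_fun setT H -> (forall v, 0 <= H v)%E ->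
  (\int[law X x]_(w in [set w | T w < +oo]) ((G w)%:E * H (Phi (shift_at T w))) =
   (\int[law X x]_(w in [set w | T w < +oo]) (G w)%:E) * \int[Q]_v H v)%E.
Proof.
move=> hT mPhi hQ hG G0 mH H0.
have mG : measurable_fun setT G by move=> _ B mB; rewrite setTI; exact: (hG B mB).1.
have mfin := measurable_finite_time hT.
have mP : measurable_fun setT (Phi \o shift_at T).
  by apply: measurableT_comp => //; exact: measurable_shift_at.
apply: (@integral_indep _ _ _ _ _ (pker_law (law X) x) Q _ G (Phi \o shift_at T)) => //.
move=> A B mA mB; apply: strong_markov_law => //; [exact: hQ|exact: hG].
Qed.

Lemma strong_markov_at T x y (G : W -> R) (H : W -> \bar R) :
  stopping_time (history X) T ->
  {ae law X x, forall w, (T w < +oo)%E -> Defs.path X (fine (T w)) w = y} ->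
  (forall B, measurable B -> stopped_sigma_algebra (history X) T (G @^-1` B)) ->
  (forall w, (T w < +oo)%E -> 0 <= G w) ->
  measurable_fun setT H -> (forall v, 0 <= H v)%E ->
  (\int[law X x]_(w in [set w | T w < +oo])
     ((G w)%:E * H (Defs.shift X (fine (T w)) w)) =
   (\int[law X x]_(w in [set w | T w < +oo]) (G w)%:E) * \int[law X y]_v H v)%E.
Proof.
move=> hT hy hG G0 mH H0.
have mid : measurable_fun setT (@idfun W) by exact: measurable_id.
have hQ B : measurable B -> {ae law X x, forall w, (T w < +oo)%E ->
    law X (Defs.path X (fine (T w)) w) (@idfun W @^-1` B) = pker_law (law X) y B}.
  by move=> mB; apply: filterS hy => w hw /hw ->.
rewrite -(integral_strong_markov hT mid hQ hG G0 mH H0).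
by apply: eq_integral => w /[!inE] Too; rewrite /shift_at Too.
Qed.

(** The preimage under the shift of a null set [N] is null: its probability is the integral of the
    probabilities of [N] from the states at [T], all equal to [law X y N]. *)
Lemma strong_markov_ae T x y (Q : set W) : stopping_time (history X) T ->
  {ae law X x, forall w, (T w < +oo)%E -> Defs.path X (fine (T w)) w = y} ->
  {ae law X y, forall w, Q w} ->
  {ae law X x, forall w, (T w < +oo)%E -> Q (Defs.shift X (fine (T w)) w)}.
Proof.
move=> hT hy [N [mN N0 QN]]; have mfin := measurable_finite_time hT.
have h0 : law X x (setT `&` [set w | (T w < +oo)%E /\ N (Defs.shift X (fine (T w)) w)]) = 0%E.
  rewrite strong_markov//; last exact: stopped_setT.
  rewrite setTI -[RHS](integral0 (law X x) [set w | (T w < +oo)%E]).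
  apply: ae_eq_integral => //; first exact: measurable_law_path_at.
  by apply: filterS hy => w hw /= /hw ->.
exists (setT `&` [set w | (T w < +oo)%E /\ N (Defs.shift X (fine (T w)) w)]); split => //.
  rewrite setTI (_ : [set _ | _] = [set w | (T w < +oo)%E] `&` shift_at T @^-1` N).
    by apply: measurableI => //; rewrite -[X in measurable X]setTI; exact: measurable_shift_at.
  by apply/seteqP; split => w /= [Too]; rewrite /shift_at Too.
move=> w /= nQ; split => //; have [Too|nToo] := pselect (T w < +oo)%E; last first.
  by exfalso; apply: nQ.
by split => //; apply: QN => Qs; apply: nQ.
Qed.

End strong_markov_integral.

(** * Inverse local times *)

Lemma measure_ae_eq {R : realType} {d} {T : measurableType d}
    (mu : {measure set T -> \bar R}) (A B : set T) :
  measurable A -> measurable B -> {ae mu, forall w, A w <-> B w} -> mu A = mu B.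
Proof.
move=> mA mB AB.
rewrite -[A]setIT -[B]setIT -!integral_indic//; apply: ae_eq_integral => //.
- exact/measurable_EFinP/measurable_indic.
- exact/measurable_EFinP/measurable_indic.
- apply: filterS AB => w AB _; rewrite !indicE; congr (_%:R%:E); congr nat_of_bool.
  by apply/idP/idP; rewrite !inE => /AB.
Qed.

Lemma le_measure_ae {R : realType} {d} {T : measurableType d}
    (mu : {measure set T -> \bar R}) (A B : set T) :
  measurable A -> measurable B -> {ae mu, forall w, A w -> B w} ->
  (mu A <= mu B)%E.
Proof.
move=> mA mB AB; rewrite (@measure_ae_eq _ _ _ mu A (A `&` B))//.
- by apply: le_measure; rewrite ?inE//; exact: measurableI.
- exact: measurableI.
- by apply: filterS AB => w h; split => [Aw|[]//]; split => //; exact: h.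
Qed.

Lemma probability_ae {R : realType} {d} {T : measurableType d}
    (P : probability T R) (A : set T) :
  measurable A -> {ae P, forall w, A w} -> P A = 1%E.
Proof.
move=> mA hA; rewrite -(probability_setT P); apply: measure_ae_eq => //.
exact: filterS hA.
Qed.

Section local_time_facts.
Context {R : realType} {dE} {E : measTopologicalType dE}
  {d} {W : measurableType d}.
Variables (X : markov_process R E W) (L : E -> R -> W -> R).
Hypothesis HL : local_time_process X L.
Implicit Types (x y : E).

Notation tau := (inverse_local_time L).
Notation hit := (hitting_time (Defs.path X)).

Lemma local_time_clock y w : clock (L y ^~ w).
Proof.
split; first exact: local_time_start HL y w.
- exact: local_time_nondecreasing HL y w.
- exact: local_time_continuous HL y w.
Qed.

Lemma local_time_adapted_clock y : adapted_clock X (L y).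
Proof.
split; first exact: local_time_clock.
by move=> t B; exact: local_time_adapted HL y t B.
Qed.

Lemma stopping_tau y r : stopping_time (history X) (tau y r).
Proof. exact: (stopping_clock_inv (local_time_adapted_clock y)). Qed.

Lemma measurable_tau y r : measurable_fun setT (tau y r).
Proof. exact: (measurable_stopping (stopping_tau y r)). Qed.

Lemma tau_ge0 y r w : (0 <= tau y r w)%E. Proof. exact: first_time_ge0. Qed.

Lemma local_time_at_tau y (r : R) w : 0 <= r -> (tau y r w < +oo)%E ->
  L y (fine (tau y r w)) w = r.
Proof. exact: (clock_at_inv (local_time_clock y w)). Qed.

Lemma tau_homo y w : {homo tau y ^~ w : r s / r <= s >-> (r <= s)%E}.
Proof. by move=> r s rs; exact: clock_inv_homo. Qed.

Lemma tau_start y : {ae law X y, forall w, tau y 0 w = 0%E}.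
Proof.
have /seteqP[_ h] := local_time_support HL y; have := h y erefl.
exact.
Qed.

Lemma tau_start_only x y : {ae law X x, forall w, tau y 0 w = 0%E} -> x = y.
Proof. by move=> h; have /seteqP[+ _] := local_time_support HL y; exact. Qed.

(** Just after [tau y r] the local time grows again, so the shifted path has [tau y 0] equal to 0.
    By the strong Markov property this holds almost surely from the state at [tau y r], and the fine
    support then identifies that state with [y]. *)
Lemma path_at_tau x y (r : R) : 0 <= r ->
  {ae law X x, forall w, (tau y r w < +oo)%E ->
    Defs.path X (fine (tau y r w)) w = y}.
Proof.
move=> r0; pose T := tau y r; have hT : stopping_time (history X) T := stopping_tau y r.
have mfin := measurable_finite_time hT.
pose B := [set w | (0 < tau y 0 w)%E].
have mB : measurable B.
  by rewrite -[X in measurable X]setTI; exact: (emeasurable_fun_o_infty _ (measurable_tau _ _)).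
have h0 : law X x (setT `&` [set w | (T w < +oo)%E /\ B (Defs.shift X (fine (T w)) w)]) = 0%E.
  apply/negligibleP.
    rewrite setTI (_ : [set _ | _] = [set w | (T w < +oo)%E] `&` shift_at X T @^-1` B).
      by apply: measurableI => //; rewrite -[X in measurable X]setTI; exact: measurable_shift_at.
    by apply/seteqP; split => w /= [Too]; rewrite /shift_at Too.
  apply: negligibleS (local_time_additive HL x y) => w /= [_ [Too Bw]] h.
  have T0 : 0 <= fine (T w) by exact: fine_ge0 (tau_ge0 _ _ _).
  have lT : L y (fine (T w)) w = r by exact: local_time_at_tau.
  move: Bw; rewrite /B/= ltNge => /negP; apply.
  apply/(clock_inv_le (local_time_clock y _)) => // s s0.
  have : r < L y (fine (T w) + s) w.
    apply: (clock_inv_le (local_time_clock y w) T0 r0).1; last by rewrite ltrDl.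
    by rewrite fineK// ge0_fin_numE// tau_ge0.
  by rewrite h ?(ltW s0)// lT ltrDl.
rewrite strong_markov// in h0; last exact: stopped_setT.
rewrite setTI in h0.
have mf := measurable_law_path_at hT mB.
have : (\int[law X x]_(w in [set w | T w < +oo]) `|law X (Defs.path X (fine (T w)) w) B| = 0)%E.
  by rewrite -[RHS]h0; apply: eq_integral => w _; rewrite gee0_abs.
move=> /(ae_eq_integral_abs _ mfin mf); apply: filterS => w h Too.
apply: tau_start_only; exists B; split => //; first exact: h.
move=> w' /= nz; rewrite /B/= lt_neqAle tau_ge0 andbT; apply/eqP => z.
by apply: nz; rewrite -z.
Qed.

(** A state other than [y] at the hitting time would have a neighbourhood without [y], in which
    right continuity would keep the path for a while, although visits to [y] occur arbitrarily close
    to the infimum. *)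
Lemma path_at_hitting y w : (hit y w < +oo)%E ->
  Defs.path X (fine (hit y w)) w = y.
Proof.
move=> hoo; have h0 := first_time_ge0 [set t | Defs.path X t w = y].
have hfin : hit y w \is a fin_num by rewrite ge0_fin_numE.
set T := fine _; have T0 : 0 <= T by exact: fine_ge0.
apply: contrapT => /eqP Xy.
have [U [oU xU yU]] := hausdorff_accessible (hausdorff_state X) Xy.
have : nbhs (Defs.path X T w) U by apply: open_nbhs_nbhs; split => //; exact: set_mem.
have rc : Defs.path X s w @[s --> T^'+] --> Defs.path X T w.
  exact: path_right_continuous.
move=> /rc[e /= e0 he].
have : (hit y w < (T + e)%:E)%E by rewrite -(fineK hfin) lte_fin ltrDl.
move=> /first_time_lt[s [s0 sT /= Xs]].
have : (hit y w <= s%:E)%E by exact: first_time_le.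
rewrite -(fineK hfin) lee_fin -/T le_eqVlt => /orP[/eqP Ts|Ts].
  by rewrite Ts Xs eqxx in Xy.
have := he s; rewrite /= distrC ger0_norm ?subr_ge0 ?(ltW Ts)// ltrBlDl => /(_ sT Ts).
by rewrite Xs => Uy; exact: (set_mem yU).
Qed.

Lemma stopping_hitting y : stopping_time (history X) (hit y).
Proof. exact: hitting_stopping. Qed.

Lemma hitting_le_tau x y (r : R) : 0 <= r ->
  {ae law X x, forall w, (hit y w <= tau y r w)%E}.
Proof.
move=> r0; apply: filterS (path_at_tau x y r0) => w h.
have [Too|] := ltP (tau y r w) +oo%E; last by rewrite leye_eq => /eqP ->; rewrite leey.
rewrite -[tau y r w]fineK ?ge0_fin_numE ?tau_ge0//.
by apply: first_time_le; [exact: fine_ge0 (tau_ge0 _ _ _)|exact: h].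
Qed.

(** The path is at [y] at time [tau y 0], which therefore does not precede the hitting time: no
    local time has accrued yet. *)
Lemma local_time_at_hitting x y :
  {ae law X x, forall w, L y (fine (hit y w)) w = 0}.
Proof.
apply: filterS (hitting_le_tau x y (lexx 0)) => w h.
have lC := local_time_clock y w.
have h0 : (0 <= hit y w)%E by exact: first_time_ge0.
have [hoo|] := ltP (hit y w) +oo%E; last first.
  by rewrite leye_eq => /eqP ->; exact: (clock0 lC).
have hfin : hit y w \is a fin_num by rewrite ge0_fin_numE.
apply/eqP; rewrite eq_le (clock_ge0 lC) ?fine_ge0// andbT leNgt; apply/negP.
move=> /(clock_inv_lt lC (lexx 0) (fine_ge0 h0)); rewrite fineK//.
by rewrite ltNge h.
Qed.

Hypothesis recX : recurrent X.

Lemma hitting_finite x y : {ae law X x, forall w, (hit y w < +oo)%E}.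
Proof.
apply: filterS (recX x y) => w /(_ 0 (lexx 0))[s s0 Xs].
by rewrite (@le_lt_trans _ _ s%:E) ?ltry//; exact: first_time_le.
Qed.

Lemma tau_after_hitting x y (r : R) : 0 <= r ->
  {ae law X x, forall w, tau y r w =
    ((fine (hit y w))%:E + tau y r (Defs.shift X (fine (hit y w)) w))%E}.
Proof.
move=> r0; apply: filterS2 (local_time_at_hitting x y) (local_time_additive HL x y).
move=> w h0 hadd; have T0 : 0 <= fine (hit y w) by exact: fine_ge0 (first_time_ge0 _).
rewrite -[in RHS](subr0 r) -h0.
apply: clock_inv_shift => //; [exact: local_time_clock|exact: local_time_clock|by rewrite h0|].
by move=> t t0; exact: hadd.
Qed.

Let never (y : E) (s : R) := [set w | tau y s w = +oo%E].

Let measurable_never y s : measurable (never y s).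
Proof.
rewrite (_ : never y s = ~` [set w | (tau y s w < +oo)%E]).
  by apply: measurableC; exact: (measurable_finite_time (stopping_tau y s)).
apply/seteqP; split => w /=; first by move=> ->; rewrite ltxx.
by move=> /negP; rewrite -leNgt leye_eq => /eqP.
Qed.

(** No local time at [y] accrues before the hitting time, so whether the level [s] is ever exceeded
    is decided by the path after it, which starts at [y]. *)
Let never_law z y (s : R) : 0 <= s -> law X z (never y s) = law X y (never y s).
Proof.
move=> s0; have hT := stopping_hitting y.
have mfin := measurable_finite_time hT.
have mid : measurable_fun setT (@idfun W) by exact: measurable_id.
have := @strong_markov_law _ _ _ _ _ X (hit y) z _ W (pker_law (law X) y) idfun
  setT (never y s) hT mid (measurable_never y s).
have hQ : {ae law X z, forall w, (hit y w < +oo)%E ->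
    law X (Defs.path X (fine (hit y w)) w) (idfun @^-1` never y s) =
    pker_law (law X) y (never y s)}.
  by apply: aeW => w hw; rewrite path_at_hitting.
move=> /(_ hQ (stopped_setT hT)); rewrite setTI setIT.
have -> : law X z [set w | (hit y w < +oo)%E] = 1%E.
  exact: (probability_ae (P := pker_law (law X) z) mfin (hitting_finite z y)).
rewrite mul1e => h; refine (etrans _ h); apply: measure_ae_eq => //.
  apply: measurableI => //; rewrite -[X in measurable X]setTI.
  by apply: measurable_shift_at => //; exact: measurable_never.
apply: filterS2 (tau_after_hitting z y s0) (hitting_finite z y) => w tE hoo.
rewrite /never/= /shift_at hoo tE; split => [|[_ ->]]; last by rewrite addey.
by case: (tau y s _).
Qed.

(** Let [f s] be the probability that the level [s] is never exceeded; by [never_law] it is the same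
    from every start. If the local time at time 1 exceeds [e] with probability [p > 0], the Markov
    property at time 1 gives [f s <= (1 - p) * f s + p * f (s - e)], hence [f s <= f (s - e)]; and
    [f] vanishes at negative levels. *)
Lemma tau_finite x y (r : R) : {ae law X x, forall w, (tau y r w < +oo)%E}.
Proof.
have main (e s : R) : 0 < e -> 0 <= s ->
    (law X y [set w | (e < L y 1 w)%R] != 0)%E ->
    (law X y (never y s) <= law X y (never y (s - e)))%E.
  move=> e0 s0 pe.
  pose P : probability W R := pker_law (law X) y.
  have hT := @stopping_cst _ _ _ _ _ X 1 ler01.
  have mid : measurable_fun setT (@idfun W) by exact: measurable_id.
  have ml : measurable_fun setT (L y 1).
    exact: (clock_measurable (adapted_clock_process (local_time_adapted_clock y)) ler01).
  have mgt : measurable [set w | (e < L y 1 w)%R].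
    rewrite (_ : [set _ | _] = L y 1 @^-1` `]e, +oo[).
      by rewrite -[X in measurable X]setTI; exact: ml.
    by apply/seteqP; split => w /=; rewrite in_itv/= andbT.
  have indep (B : set R) (u : R) : 0 <= u -> measurable B ->
      P (L y 1 @^-1` B `&` (fun w => never y u (Defs.shift X 1 w))) =
      (P (L y 1 @^-1` B) * P (never y u))%E.
    move=> u0 mB.
    have := @strong_markov_law _ _ _ _ _ X (fun=> 1%:E) y _ W P idfun
      (L y 1 @^-1` B) (never y u) hT mid (measurable_never y u).
    have hQ : {ae law X y, forall w, (1%:E < +oo :> \bar R)%E ->
        law X (Defs.path X (fine (1%:E : \bar R)) w) (idfun @^-1` never y u) = P (never y u)}.
      by apply: aeW => w _; exact: never_law.
    move=> /(_ hQ (stopped_clock (local_time_adapted_clock y) hT mB)).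
    rewrite (_ : [set w : W | (1%:E < +oo :> \bar R)%E] = setT); last first.
      by apply/seteqP; split => w //= _; rewrite ltry.
    rewrite !setTI => <-; congr (P _); apply/seteqP; split => w /=;
      by rewrite /shift_at ltry.
  have nE (u : R) : u < 0 -> never y u = set0.
    move=> u0; apply/seteqP; split => w //; rewrite /never/=.
    by have -> : tau y u w = 0%E := clock_inv_lt0 (local_time_clock y w) u0.
  have {}indep (B : set R) (u : R) : measurable B ->
      P (L y 1 @^-1` B `&` (fun w => never y u (Defs.shift X 1 w))) =
      (P (L y 1 @^-1` B) * P (never y u))%E.
    move=> mB; have [u0|u0] := leP 0 u; first exact: indep.
    rewrite nE// measure0 mule0 (_ : _ `&` _ = set0) ?measure0//.
    by apply/seteqP; split => w // -[].
  have mle : measurable (L y 1 @^-1` `]-oo, e]).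
    by rewrite -[X in measurable X]setTI; exact: ml.
  have mgt' : measurable (L y 1 @^-1` `]e, +oo[).
    by rewrite -[X in measurable X]setTI; exact: ml.
  have msh (u : R) : measurable (fun w => never y u (Defs.shift X 1 w)).
    rewrite (_ : (fun w => _) = shift_at X (fun=> 1%:E) @^-1` (never y u)).
      by rewrite -[X in measurable X]setTI; exact: (measurable_shift_at hT).
    by apply/seteqP; split => w /=; rewrite /shift_at ltry.
  have sub : (P (never y s) <= P ((L y 1 @^-1` `]-oo, e] `&`
       (fun w => never y s (Defs.shift X 1 w))) `|`
      (L y 1 @^-1` `]e, +oo[ `&` (fun w => never y (s - e) (Defs.shift X 1 w)))))%E.
    apply: le_measure_ae => //; first by apply: measurableU; exact: measurableI.
    apply: filterS (local_time_additive HL y y) => w hadd.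
    move=> /first_time_pinfty/= hs.
    have hs' (t : R) : 0 <= t -> L y 1 w + L y t (Defs.shift X 1 w) <= s.
      move=> t0; rewrite -hadd// leNgt; apply/negP; apply: hs.
      by rewrite addr_ge0.
    have L1 : 0 <= L y 1 w by exact: clock_ge0 (local_time_clock y w) ler01.
    have [le1|lt1] := leP (L y 1 w) e; [left|right]; split.
    - by rewrite /= in_itv.
    - apply/first_time_pinfty => t t0 /=; apply/negP; rewrite -leNgt.
      by have := hs' t t0; lra.
    - by rewrite /= in_itv/= andbT.
    - apply/first_time_pinfty => t t0 /=; apply/negP; rewrite -leNgt.
      by have := hs' t t0; lra.
  have mA : measurable (L y 1 @^-1` `]-oo, e] `&`
      (fun w => never y s (Defs.shift X 1 w))) by exact: measurableI.
  have mB : measurable (L y 1 @^-1` `]e, +oo[ `&`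
      (fun w => never y (s - e) (Defs.shift X 1 w))) by exact: measurableI.
  have {sub} := le_trans sub (measureU2 P mA mB).
  have iA := indep `]-oo, e]%classic s (measurable_itv _).
  have iB := indep `]e, +oo[%classic (s - e) (measurable_itv _).
  have iAB : (P (L y 1 @^-1` `]-oo, e] `&` (fun w => never y s (Defs.shift X 1 w))) +
      P (L y 1 @^-1` `]e, +oo[ `&` (fun w => never y (s - e) (Defs.shift X 1 w))) =
      P (L y 1 @^-1` `]-oo, e]) * P (never y s) +
      P (L y 1 @^-1` `]e, +oo[) * P (never y (s - e)))%E.
    by congr (_ + _)%E; [exact: iA|exact: iB].
  move=> h; have {h iA iB iAB} : (P (never y s) <= _)%E := eq_ind _ (fun z => P (never y s) <= z)%E h _ iAB.
  have -> : L y 1 @^-1` `]-oo, e] = ~` (L y 1 @^-1` `]e, +oo[).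
    by rewrite preimage_setC setCitvr.
  have pE : P (L y 1 @^-1` `]e, +oo[) = law X y [set w | e < L y 1 w].
    by congr (law X y _); apply/seteqP; split => w /=; rewrite in_itv/= andbT.
  rewrite probability_setC//.
  have p0 : (0 < P (L y 1 @^-1` `]e, +oo[))%E by rewrite lt_neqAle measure_ge0 andbT eq_sym pE.
  rewrite -[law X y (never y s)]/(P (never y s)) -[law X y (never y (s - e))]/(P (never y (s - e))).
  move: p0; rewrite -[P (L y 1 @^-1` _)]fineK ?fin_num_measure//.
  rewrite -[P (never y s)]fineK ?fin_num_measure//.
  rewrite -[P (never y (s - e))]fineK ?fin_num_measure//.
  set p := fine _; set g := fine _; set g' := fine _.
  rewrite lte_fin -EFinB -!EFinM -EFinD !lee_fin => p0 h.
  by rewrite -(ler_pM2l p0); lra.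
(* If the local time at time 1 vanished almost surely, [tau y 0] would be at least 1, against
   [tau_start]. *)
have [e e0 pe] : exists2 e : R, 0 < e & (law X y [set w | (e < L y 1 w)%R] != 0)%E.
  apply: contrapT => /forall2NP h.
  have : {ae law X y, forall w : W, False}.
    have hn : {ae law X y, forall w, forall n, ~ (n.+1%:R^-1 < L y 1 w)%R}.
      apply/ae_foralln => n.
      have [] := h n.+1%:R^-1; first by rewrite invr_gt0.
      move=> /negP; rewrite negbK => /eqP /negligibleP hn.
      have mn : measurable [set w | (n.+1%:R^-1 < L y 1 w)%R].
        exact: (@history_measurable _ _ _ _ _ X 1 ler01 _
          (adapted_clock_gt (local_time_adapted_clock y) _ ler01)).
      by apply: negligibleS (hn mn) => w /= /contrapT.
    apply: filterS2 (tau_start y) hn => w t0 hw.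
    have : 0 < L y 1 w.
      by apply/(clock_inv_lt (local_time_clock y w) (lexx 0) ler01); rewrite [clock_inv _ _]t0 lte_fin.
    move=> L1; have [n] := ltr_add_invr L1; rewrite add0r; exact: hw.
  move=> /(probability_ae (P := pker_law (law X) y) (A := set0) measurable0).
  by rewrite measure0 => /eqP; rewrite eq_sym onee_eq0.
(* Negative levels are exceeded at time 0, and [n] steps of size [e] lead there from any
   [s < n%:R * e]. *)
have g0 n (s : R) : s < n%:R * e -> law X y (never y s) = 0%E.
  elim: n s => [|n IHn] s; rewrite ?mul0r => sn.
    rewrite (_ : never y s = set0) ?measure0//; apply/seteqP; split => w //.
    by rewrite /never/= (_ : tau y s w = 0%E)//; exact: (clock_inv_lt0 (local_time_clock y w) sn).
  have [s0|s0] := ltP s 0.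
    rewrite (_ : never y s = set0) ?measure0//; apply/seteqP; split => w //.
    by rewrite /never/= (_ : tau y s w = 0%E)//; exact: (clock_inv_lt0 (local_time_clock y w) s0).
  apply/eqP; rewrite eq_le measure_ge0 andbT (le_trans (main e s e0 s0 pe))//.
  by rewrite IHn// ltrBlDr; apply: lt_le_trans sn _; rewrite -natr1 mulrDl mul1r.
have [r0|r0] := ltP r 0.
  apply: aeW => w; rewrite (_ : tau y r w = 0%E) ?ltry//.
  exact: (clock_inv_lt0 (local_time_clock y w) r0).
have [n rn] : exists n : nat, r < n%:R * e.
  exists (Num.truncn (r / e)).+1; rewrite -ltr_pdivrMr//; exact: truncnS_gt.
have /negligibleP nx : law X x (never y r) = 0%E by rewrite never_law// (g0 n).
apply: negligibleS (nx (measurable_never y r)) => w /= /negP.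
by rewrite -leNgt leye_eq => /eqP.
Qed.

End local_time_facts.

(** * Mean local times and exponential functionals *)

Lemma ge0_integral_ccdf {R : realType} {d} {T : measurableType d}
    (P : probability T R) (f : T -> R) : measurable_fun setT f ->
  (forall w, 0 <= f w) ->
  (\int[P]_w (f w)%:E =
   \int[lebesgue_measure]_(s in `[0%R, +oo[) P [set w | (s < f w)%R])%E.
Proof.
move=> mf f0.
pose mf' := isMeasurableFun.Build _ _ _ _ f mf.
pose Y : {RV P >-> R} := HB.pack f mf'.
have := @ge0_expectation_ccdf _ _ _ P Y f0.
rewrite unlock => ->; apply: eq_integral => s _; rewrite /ccdf /distribution /pushforward.
by congr (P _); apply/seteqP; split => w /=; rewrite in_itv/= andbT.
Qed.

Section stopped_sets.
Context {R : realType} {dE} {E : measTopologicalType dE}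
  {d} {W : measurableType d}.
Variable X : markov_process R E W.
Implicit Types (T : W -> \bar R).

Lemma stopped_indic T (A : set W) : stopping_time (history X) T ->
  stopped_sigma_algebra (history X) T A -> forall B : set R, measurable B ->
  stopped_sigma_algebra (history X) T ((\1_A : W -> R) @^-1` B).
Proof.
move=> hT [mA hA] B mB.
have mI : measurable ((\1_A : W -> R) @^-1` B).
  have mi : measurable_fun setT (\1_A : W -> R) by exact: measurable_indic.
  by rewrite -[X in measurable X]setTI; exact: mi.
split => // t t0.
have hTt : history X t [set w | (T w <= t%:E)%E] by exact: stopping_history.
rewrite (preimage_indic A B); case: ifPn => _; case: ifPn => _.
- by rewrite setTI.
- exact: hA.
- rewrite (_ : _ `&` _ = [set w | (T w <= t%:E)%E] `&`
      ~` (A `&` [set w | (T w <= t%:E)%E])).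
    by apply: historyI => //; apply: historyC => //; exact: hA.
  by apply/seteqP; split => w /=; [case=> nA Tt; split => // -[]|case=> Tt nA; split => // Aw; exact: nA].
- by rewrite set0I; exact: history_set0.
Qed.

Definition additive_clock (l : R -> W -> R) : Prop :=
  forall z : E, {ae law X z, forall w, forall s t, 0 <= s -> 0 <= t ->
    l (s + t) w = l s w + l t (Defs.shift X s w)}.

Lemma additive_clock_sum n (L : 'I_n -> R -> W -> R) (al : 'I_n -> R) :
  (forall i, additive_clock (L i)) ->
  additive_clock (fun t w => \sum_i al i * L i t w).
Proof.
move=> hL z.
have : {ae law X z, forall w, forall i : 'I_n, forall s t, 0 <= s -> 0 <= t ->
    L i (s + t) w = L i s w + L i t (Defs.shift X s w)}.
  by apply: filter_forall => i; exact: hL.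
apply: filterS => w h s t s0 t0; rewrite -big_split/=; apply: eq_bigr => i _.
by rewrite h// mulrDr.
Qed.

End stopped_sets.

(** * The exponential identity in mean *)

Section exponential_functionals.
Context {R : realType} {dE} {E : measTopologicalType dE}
  {d} {W : measurableType d}.
Variables (X : markov_process R E W) (L : E -> R -> W -> R).
Hypotheses (HL : local_time_process X L) (recX : recurrent X).
Variables (n : nat) (x : 'I_n -> E) (al : 'I_n -> R).
Hypothesis al0 : forall i, 0 <= al i.
Notation tau := (inverse_local_time L).
Notation mu := (@lebesgue_measure R).

Definition weighted_time (t : R) (w : W) : R := \sum_i al i * L (x i) t w.
Notation A := weighted_time.

Lemma weighted_time_clock : adapted_clock X A.
Proof.
by apply: adapted_clock_sum => // i; exact: local_time_adapted_clock.
Qed.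

Lemma weighted_time_additive : additive_clock X A.
Proof. by apply: additive_clock_sum => i z; exact: local_time_additive. Qed.

Lemma local_time_process_clock y : clock_process (L y).
Proof. exact: (adapted_clock_process (local_time_adapted_clock HL y)). Qed.

Lemma measurable_local_time_at y (zeta : W -> \bar R) :
  stopping_time (history X) zeta -> measurable_fun setT (fun w => L y (fine (zeta w)) w).
Proof.
move=> hz; apply: (measurable_clock_at_time (local_time_process_clock y)).
- exact: (measurable_stopping hz).
- exact: hz.1.
Qed.

Lemma measurable_expR_time (zeta : W -> \bar R) : stopping_time (history X) zeta ->
  measurable_fun setT (fun w => (expR (- A (fine (zeta w)) w))%:E).
Proof.
move=> hz; apply/measurable_EFinP; apply: measurableT_comp => //.
apply: measurableT_comp => //.
apply: (measurable_clock_at_time (adapted_clock_process weighted_time_clock)).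
- exact: (measurable_stopping hz).
- exact: hz.1.
Qed.

Definition exp_mean (zeta : W -> \bar R) (z : E) : \bar R :=
  (\int[law X z]_w (expR (- A (fine (zeta w)) w))%:E)%E.

Definition mean_time (zeta : W -> \bar R) (z y : E) : \bar R :=
  (\int[law X z]_w (L y (fine (zeta w)) w)%:E)%E.

Lemma integral_finite_time (T : W -> \bar R) (z : E) (f : W -> \bar R) :
  stopping_time (history X) T -> {ae law X z, forall w, (T w < +oo)%E} ->
  measurable_fun setT f -> (forall w, 0 <= f w)%E ->
  (\int[law X z]_(w in [set w | T w < +oo]) f w = \int[law X z]_w f w)%E.
Proof.
move=> hT Too mf f0; have mfin := measurable_finite_time hT.
rewrite [RHS](@ge0_negligible_integral _ _ _ _ setT (~` [set w | (T w < +oo)%E]))//.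
- by rewrite setTD setCK.
- exact: measurableC.
- apply/negligibleP; first exact: measurableC.
  by apply: negligibleS Too => w /= nT h; apply: nT.
Qed.

Let kernel_set (zeta : W -> \bar R) (i : 'I_n) : set (W * R) :=
  [set p | 0 <= p.2 < L (x i) (fine (zeta p.1)) p.1].

Let kernel_fun (zeta : W -> \bar R) (i : 'I_n) (p : W * R) : \bar R :=
  (expR (A (fine (tau (x i) p.2 p.1)) p.1 - A (fine (zeta p.1)) p.1) *
    \1_(kernel_set zeta i) p)%:E.

Let measurable_kernel_fun zeta i : stopping_time (history X) zeta ->
  measurable_fun setT (kernel_fun zeta i).
Proof.
move=> hz; have mz := measurable_stopping hz.
have mset : measurable (kernel_set zeta i).
  rewrite (_ : kernel_set zeta i = (snd @^-1` `[0%R, +oo[) `&`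
      ((fun p : W * R => p.2 < L (x i) (fine (zeta p.1)) p.1) @^-1` [set true])).
    apply: measurableI.
      by rewrite -[X in measurable X]setTI; exact: (measurable_snd).
    rewrite -[X in measurable X]setTI.
    apply: (@measurable_fun_ltr _ _ _ _ snd (fun p => L (x i) (fine (zeta p.1)) p.1)) => //.
    apply: (measurableT_comp (measurable_local_time_at (x i) hz)).
    exact: measurable_fst.
  apply/seteqP; split => p /=; rewrite in_itv/= andbT; first by case/andP => ->.
  by case=> p0 pL; rewrite /kernel_set/= p0 pL.
apply/measurable_EFinP; apply: measurable_funM; last exact: measurable_indic.
apply: measurableT_comp => //; apply: measurable_funB.
  have AP : clock_process (fun t (p : W * R) => A t p.1).
    apply: clock_process_comp; first exact: measurable_fst.
    exact: (adapted_clock_process weighted_time_clock).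
  have LP : clock_process (fun t (p : W * R) => L (x i) t p.1).
    apply: clock_process_comp; first exact: measurable_fst.
    exact: local_time_process_clock.
  apply: (measurable_clock_at_time AP (S := fun p => tau (x i) p.2 p.1)).
    by apply: (measurable_clock_inv LP); exact: measurable_snd.
  by move=> p; exact: tau_ge0.
apply: (measurableT_comp (f := fun w => A (fine (zeta w)) w)); last exact: measurable_fst.
apply: (measurable_clock_at_time (adapted_clock_process weighted_time_clock)) => //.
exact: hz.1.
Qed.

Let kernel_fun_ge0 zeta i p : (0 <= kernel_fun zeta i p)%E.
Proof. by rewrite lee_fin mulr_ge0// expR_ge0. Qed.

Lemma integral_one_sub_exp (zeta : W -> \bar R) (z : E) :
  stopping_time (history X) zeta ->
  (\int[law X z]_w (1 - expR (- A (fine (zeta w)) w))%:E =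
   \sum_i (al i)%:E * \int[mu]_s \int[law X z]_w kernel_fun zeta i (w, s))%E.
Proof.
move=> hz; pose P := pker_law (law X) z.
have mk i := measurable_kernel_fun i hz.
have mF i : measurable_fun setT (fun w => \int[mu]_s kernel_fun zeta i (w, s))%E.
  by have := @measurable_fun_fubini_tonelli_F _ _ _ _ R mu _ (mk i) (kernel_fun_ge0 zeta i); apply.
have F0 i w : (0 <= \int[mu]_s kernel_fun zeta i (w, s))%E.
  by apply: integral_ge0.
transitivity (\int[law X z]_w \sum_i (al i)%:E * \int[mu]_s kernel_fun zeta i (w, s))%E.
  apply: eq_integral => w _.
  have z0 : 0 <= fine (zeta w) by exact: fine_ge0 (hz.1 w).
  rewrite /A -(@expR_clock_sum R n (fun i t => L (x i) t w) al _ _ al0 z0); last first.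
    by move=> i; exact: (local_time_clock HL).
  apply: eq_bigr => i _; congr (_ * _)%E; rewrite integral_mkcond.
  apply: eq_integral => s _; rewrite patchE /kernel_fun indicE; case: ifPn.
    by rewrite inE/= in_itv/= => sL; rewrite mem_set// mulr1.
  by rewrite notin_setE/= in_itv/= => sL; rewrite memNset ?mulr0.
rewrite ge0_integral_sum//; last 2 first.
- by move=> i; apply: emeasurable_funM => //; exact: measurable_cst.
- by move=> i w _; rewrite mule_ge0// lee_fin.
apply: eq_bigr => i _; rewrite ge0_integralZl ?lee_fin//; congr (_ * _)%E.
exact: (@fubini_tonelli _ _ _ _ R P mu _ (mk i) (kernel_fun_ge0 zeta i)).
Qed.

(** The integrand of the exponential identity, with the increment of [A] up to [zeta] replaced by
    the value of [A] on the restarted path at [zeta']. Two times are allowed because for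
    [zeta = tau a r] no choice of [zeta'] is claimed to be exact. *)
Let markov_fun (zeta zeta' : W -> \bar R) i s (w : W) : \bar R :=
  ((\1_[set w | (tau (x i) s w < zeta w)%E] w)%:E *
   (expR (- A (fine (zeta' (shift_at X (tau (x i) s) w)))
       (shift_at X (tau (x i) s) w)))%:E)%E.

Let markov_fun_ge0 zeta zeta' i s w : (0 <= markov_fun zeta zeta' i s w)%E.
Proof. by rewrite mule_ge0// lee_fin ?expR_ge0. Qed.

Let measurable_markov_fun zeta zeta' i s : stopping_time (history X) zeta ->
  stopping_time (history X) zeta' ->
  measurable_fun setT (markov_fun zeta zeta' i s).
Proof.
move=> hz hz'; have hT := stopping_tau HL (x i) s.
apply: emeasurable_funM.
  by apply/measurable_EFinP; apply: measurable_indic; exact: (stopped_lt hT hz).1.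
exact: (measurableT_comp (measurable_expR_time hz') (measurable_shift_at hT)).
Qed.

(** The event [tau (x i) s < zeta] belongs to the past of [tau (x i) s], where the path is at [x i];
    it is almost surely the event that the local time at [zeta] exceeds [s]. *)
Let integral_markov_fun (zeta zeta' : W -> \bar R) (z : E) (i : 'I_n) (s : R) :
  stopping_time (history X) zeta -> stopping_time (history X) zeta' ->
  {ae law X z, forall w, (zeta w < +oo)%E} -> 0 <= s ->
  (\int[law X z]_w markov_fun zeta zeta' i s w =
   law X z [set w | (s < L (x i) (fine (zeta w)) w)%R] * exp_mean zeta' (x i))%E.
Proof.
move=> hz hz' zoo s0; have hT := stopping_tau HL (x i) s.
have hlt := stopped_lt hT hz.
have -> : (\int[law X z]_w markov_fun zeta zeta' i s w =
  \int[law X z]_(w in [set w | tau (x i) s w < +oo])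
    ((\1_[set w | (tau (x i) s w < zeta w)%E] w)%:E *
     (expR (- A (fine (zeta' (Defs.shift X (fine (tau (x i) s w)) w)))
       (Defs.shift X (fine (tau (x i) s w)) w)))%:E))%E.
  rewrite [RHS]integral_mkcond; apply: eq_integral => w _; rewrite patchE.
  rewrite /markov_fun; case: ifPn => [/set_mem/= nT|nT]; first by rewrite /shift_at nT.
  rewrite indicE memNset ?mul0e// => /= h.
  by move: nT; rewrite notin_setE/=; apply; rewrite (lt_le_trans h)// leey.
rewrite (@strong_markov_at _ _ _ _ _ X _ z (x i) (\1_[set w | (tau (x i) s w < zeta w)%E])
  (fun w => (expR (- A (fine (zeta' w)) w))%:E) hT) //; last 3 first.
- exact: (path_at_tau HL).
- by move=> B mB; exact: stopped_indic.
- exact: measurable_expR_time.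
congr (_ * _)%E; rewrite integral_finite_time//; last 2 first.
- exact: (tau_finite HL recX).
- by apply/measurable_EFinP; apply: measurable_indic; exact: hlt.1.
rewrite integral_indic//; last exact: hlt.1.
rewrite setIT; apply: measure_ae_eq.
- exact: hlt.1.
- rewrite -[X in measurable X]setTI.
  apply: (measurable_fun_ltr (f := cst s)) => //.
  exact: measurable_local_time_at.
- apply: filterS zoo => w zoo; rewrite /= -(fineK (x := zeta w)); last first.
    by rewrite ge0_fin_numE// hz.1.
  apply: (clock_inv_lt (local_time_clock HL (x i) w) s0).
  exact: fine_ge0 (hz.1 w).
Qed.

Let kernel_fun_lt0 zeta i w (s : R) : s < 0 -> kernel_fun zeta i (w, s) = 0%E.
Proof.
move=> s0; rewrite /kernel_fun indicE memNset ?mulr0// /kernel_set/=.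
by rewrite leNgt s0.
Qed.

Lemma integral_ccdf_mean_time (zeta : W -> \bar R) (z : E) (i : 'I_n) (c : \bar R) :
  stopping_time (history X) zeta -> (0 <= c)%E ->
  (\int[mu]_(s in `[0%R, +oo[)
     (law X z [set w | (s < L (x i) (fine (zeta w)) w)%R] * c) =
   mean_time zeta z (x i) * c)%E.
Proof.
move=> hz c0; pose P := pker_law (law X) z.
have ml := measurable_local_time_at (x i) hz.
rewrite /mean_time (@ge0_integral_ccdf _ _ _ P)//; last first.
  by move=> w; apply: clock_ge0 (local_time_clock HL (x i) w) (fine_ge0 (hz.1 w)).
rewrite muleC -ge0_integralZl//; first by apply: eq_integral => s _; rewrite muleC.
pose mf' := isMeasurableFun.Build _ _ _ _ (fun w => L (x i) (fine (zeta w)) w) ml.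
pose Y : {RV P >-> R} := HB.pack (fun w => L (x i) (fine (zeta w)) w) mf'.
apply: measurable_funTS; have := ccdf_measurable Y; congr (measurable_fun _ _).
apply/funext => s; rewrite /ccdf /distribution /pushforward.
by congr (P _); apply/seteqP; split => w /=; rewrite in_itv/= andbT.
Qed.

Lemma exp_mean_ge0 zeta z : (0 <= exp_mean zeta z)%E.
Proof. by apply: integral_ge0 => w _; rewrite lee_fin expR_ge0. Qed.

(* Comparing the integrand of the exponential identity with the value read off
   the path restarted at the inverse local time. *)
Let kernel_markov zeta zeta' z i (s : R) :
  stopping_time (history X) zeta -> stopping_time (history X) zeta' ->
  {ae law X z, forall w, (zeta w < +oo)%E} ->
  {ae law X (x i), forall w, (zeta' w < +oo)%E} -> 0 <= s ->
  {ae law X z, forall w,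
    let T := fine (tau (x i) s w) in let z1 := fine (zeta w) in
    let z2 := fine (zeta' (Defs.shift X T w)) in
    [/\ tau (x i) s w = T%:E, zeta w = z1%:E, zeta' (Defs.shift X T w) = z2%:E,
      kernel_fun zeta i (w, s) = (if T < z1 then expR (A T w - A z1 w) else 0)%:E &
      markov_fun zeta zeta' i s w =
        (if T < z1 then expR (A T w - A (T + z2) w) else 0)%:E]}.
Proof.
move=> hz hz' zoo z'oo s0.
have hT := stopping_tau HL (x i) s.
have z'oo' := strong_markov_ae hT (path_at_tau HL z (x i) s0) z'oo.
have aA := weighted_time_additive z.
have Toos := tau_finite HL recX z (x i) s.
apply: filterS2 (filterI zoo Toos) (filterI aA z'oo') => w [{}zoo Too] [{}aA {}z'oo'].
have zfin : zeta w \is a fin_num by rewrite ge0_fin_numE// hz.1.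
have Tfin : tau (x i) s w \is a fin_num by rewrite ge0_fin_numE// tau_ge0.
have T0 : 0 <= fine (tau (x i) s w) by exact: fine_ge0 (tau_ge0 _ _ _ _).
have Tz : (fine (tau (x i) s w) < fine (zeta w)) = (s < L (x i) (fine (zeta w)) w).
  rewrite -lte_fin (fineK Tfin); apply/idP/idP.
    by move/(clock_inv_lt (local_time_clock HL (x i) w) s0 (fine_ge0 (hz.1 w))).
  by move/(clock_inv_lt (local_time_clock HL (x i) w) s0 (fine_ge0 (hz.1 w))).
split; rewrite ?fineK//.
- by rewrite ge0_fin_numE ?hz'.1//; exact: z'oo'.
- rewrite /kernel_fun indicE Tz; case: ifPn => sL.
    by rewrite mem_set ?mulr1// /kernel_set/= s0.
  by rewrite memNset ?mulr0// /kernel_set/= s0/=; exact/negP.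
- rewrite /markov_fun indicE /shift_at Too -EFinM.
  have -> : A (fine (tau (x i) s w) +
      fine (zeta' (Defs.shift X (fine (tau (x i) s w)) w))) w =
      A (fine (tau (x i) s w)) w +
      A (fine (zeta' (Defs.shift X (fine (tau (x i) s w)) w)))
        (Defs.shift X (fine (tau (x i) s w)) w).
    by apply: aA => //; exact: fine_ge0 (hz'.1 _).
  rewrite opprD addrA subrr sub0r.
  rewrite -lte_fin !fineK//; case: ifPn => zT; first by rewrite mem_set// mul1r.
  by rewrite memNset ?mul0r//=; exact/negP.
Qed.

Let measurable_kernel_section zeta i s : stopping_time (history X) zeta ->
  measurable_fun setT (fun w => kernel_fun zeta i (w, s)).
Proof.
by move=> hz; exact: (measurableT_comp (measurable_kernel_fun i hz) (pair2_measurable s)).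
Qed.

Let integral_kernel_le zeta zeta' z i (s : R) :
  stopping_time (history X) zeta -> stopping_time (history X) zeta' ->
  {ae law X z, forall w, (zeta w < +oo)%E} ->
  {ae law X (x i), forall w, (zeta' w < +oo)%E} ->
  {ae law X z, forall w, (tau (x i) s w < zeta w)%E ->
    (tau (x i) s w + zeta' (Defs.shift X (fine (tau (x i) s w)) w) <= zeta w)%E} ->
  0 <= s ->
  (\int[law X z]_w kernel_fun zeta i (w, s) <=
   law X z [set w | (s < L (x i) (fine (zeta w)) w)%R] * exp_mean zeta' (x i))%E.
Proof.
move=> hz hz' zoo z'oo hzz s0; rewrite -integral_markov_fun//.
apply: ae_ge0_le_integral => //.
- exact: measurable_kernel_section.
- exact: measurable_markov_fun.
apply: filterS2 (kernel_markov hz hz' zoo z'oo s0) hzz => w.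
set T := fine _; set z1 := fine _; set z2 := fine _ => -[tE zE z'E -> ->] h _.
rewrite lee_fin; case: ifPn => // Tz.
have := h; rewrite tE zE lte_fin => /(_ Tz); rewrite z'E -EFinD lee_fin => {}h.
rewrite ler_expR lerD2l lerN2.
have T0 : 0 <= T by exact: fine_ge0 (tau_ge0 _ _ _ _).
have z10 : 0 <= z1 by exact: fine_ge0 (hz.1 w).
have z20 : 0 <= z2 by exact: fine_ge0 (hz'.1 _).
by apply: (clock_le (adapted_clock_path weighted_time_clock w)) => //; rewrite addr_ge0.
Qed.

Let integral_kernel_ge zeta zeta' z i (s : R) :
  stopping_time (history X) zeta -> stopping_time (history X) zeta' ->
  {ae law X z, forall w, (zeta w < +oo)%E} ->
  {ae law X (x i), forall w, (zeta' w < +oo)%E} ->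
  {ae law X z, forall w, (tau (x i) s w < zeta w)%E ->
    (zeta w <= tau (x i) s w + zeta' (Defs.shift X (fine (tau (x i) s w)) w))%E} ->
  0 <= s ->
  (law X z [set w | (s < L (x i) (fine (zeta w)) w)%R] * exp_mean zeta' (x i) <=
   \int[law X z]_w kernel_fun zeta i (w, s))%E.
Proof.
move=> hz hz' zoo z'oo hzz s0; rewrite -integral_markov_fun//.
apply: ae_ge0_le_integral => //.
- exact: measurable_markov_fun.
- exact: measurable_kernel_section.
apply: filterS2 (kernel_markov hz hz' zoo z'oo s0) hzz => w.
set T := fine _; set z1 := fine _; set z2 := fine _ => -[tE zE z'E -> ->] h _.
rewrite lee_fin; case: ifPn => // Tz.
have := h; rewrite tE zE lte_fin => /(_ Tz); rewrite z'E -EFinD lee_fin => {}h.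
rewrite ler_expR lerD2l lerN2.
have T0 : 0 <= T by exact: fine_ge0 (tau_ge0 _ _ _ _).
have z10 : 0 <= z1 by exact: fine_ge0 (hz.1 w).
have z20 : 0 <= z2 by exact: fine_ge0 (hz'.1 _).
exact: (clock_le (adapted_clock_path weighted_time_clock w)).
Qed.

Let integral_kernel_ge0 zeta z i :
  stopping_time (history X) zeta ->
  (\int[mu]_s \int[law X z]_w kernel_fun zeta i (w, s) =
   \int[mu]_(s in `[0%R, +oo[) \int[law X z]_w kernel_fun zeta i (w, s))%E.
Proof.
move=> hz; rewrite [RHS]integral_mkcond; apply: eq_integral => s _; rewrite patchE.
case: ifPn => //; rewrite notin_setE/= in_itv/= andbT => /negP; rewrite -ltNge => s0.
by apply: integral0_eq => w _; exact: kernel_fun_lt0.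
Qed.

Let measurable_kernel_integral zeta z i : stopping_time (history X) zeta ->
  measurable_fun setT (fun s => \int[law X z]_w kernel_fun zeta i (w, s))%E.
Proof.
move=> hz.
by have := @measurable_fun_fubini_tonelli_G _ _ _ _ R (pker_law (law X) z) _
  (measurable_kernel_fun i hz) (kernel_fun_ge0 zeta i); apply.
Qed.

Let measurable_ccdf zeta z i : stopping_time (history X) zeta ->
  measurable_fun setT
    (fun s : R => law X z [set w | (s < L (x i) (fine (zeta w)) w)%R]).
Proof.
move=> hz; pose P := pker_law (law X) z.
have ml := measurable_local_time_at (x i) hz.
pose mf' := isMeasurableFun.Build _ _ _ _ (fun w => L (x i) (fine (zeta w)) w) ml.
pose Y : {RV P >-> R} := HB.pack (fun w => L (x i) (fine (zeta w)) w) mf'.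
have := ccdf_measurable Y; congr (measurable_fun _ _).
apply/funext => s; rewrite /ccdf /distribution /pushforward.
by congr (P _); apply/seteqP; split => w /=; rewrite in_itv/= andbT.
Qed.

(** Ending the restarted path at [zeta'], no later than [zeta], can only shorten the increment of
    [A] in the exponent, hence raise the exponential. Integrating the tails over [s] then turns them
    into [mean_time]. *)
Lemma one_sub_exp_mean_le (zeta zeta' : W -> \bar R) (z : E) :
  stopping_time (history X) zeta -> stopping_time (history X) zeta' ->
  {ae law X z, forall w, (zeta w < +oo)%E} ->
  (forall y, {ae law X y, forall w, (zeta' w < +oo)%E}) ->
  (forall i s, 0 <= s -> {ae law X z, forall w, (tau (x i) s w < zeta w)%E ->
    (tau (x i) s w + zeta' (Defs.shift X (fine (tau (x i) s w)) w) <= zeta w)%E}) ->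
  (\int[law X z]_w (1 - expR (- A (fine (zeta w)) w))%:E <=
   \sum_i (al i)%:E * (mean_time zeta z (x i) * exp_mean zeta' (x i)))%E.
Proof.
move=> hz hz' zoo z'oo hzz; rewrite integral_one_sub_exp//.
apply: lee_sum => i _; rewrite lee_wpmul2l ?lee_fin//.
rewrite integral_kernel_ge0// -integral_ccdf_mean_time ?exp_mean_ge0//.
apply: ge0_le_integral => //.
- by move=> s _; exact: integral_ge0.
- by apply: measurable_funTS; exact: measurable_kernel_integral.
- apply: measurable_funTS; apply: emeasurable_funM; last exact: measurable_cst.
  exact: measurable_ccdf.
- by move=> s; rewrite /= in_itv/= andbT => s0; apply: integral_kernel_le => //; exact: hzz.
Qed.

Lemma one_sub_exp_mean_ge (zeta zeta' : W -> \bar R) (z : E) :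
  stopping_time (history X) zeta -> stopping_time (history X) zeta' ->
  {ae law X z, forall w, (zeta w < +oo)%E} ->
  (forall y, {ae law X y, forall w, (zeta' w < +oo)%E}) ->
  (forall i s, 0 <= s -> {ae law X z, forall w, (tau (x i) s w < zeta w)%E ->
    (zeta w <= tau (x i) s w + zeta' (Defs.shift X (fine (tau (x i) s w)) w))%E}) ->
  (\sum_i (al i)%:E * (mean_time zeta z (x i) * exp_mean zeta' (x i)) <=
   \int[law X z]_w (1 - expR (- A (fine (zeta w)) w))%:E)%E.
Proof.
move=> hz hz' zoo z'oo hzz; rewrite integral_one_sub_exp//.
apply: lee_sum => i _; rewrite lee_wpmul2l ?lee_fin//.
rewrite integral_kernel_ge0// -integral_ccdf_mean_time ?exp_mean_ge0//.
apply: ge0_le_integral => //.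
- by move=> s _; rewrite mule_ge0// exp_mean_ge0.
- apply: measurable_funTS; apply: emeasurable_funM; last exact: measurable_cst.
  exact: measurable_ccdf.
- by apply: measurable_funTS; exact: measurable_kernel_integral.
- by move=> s; rewrite /= in_itv/= andbT => s0; apply: integral_kernel_ge => //; exact: hzz.
Qed.

End exponential_functionals.

(** Cauchy's equation: nonnegativity makes [f] monotone, so [f (N * r) = N * f r] is squeezed
    between the values of [f] at two consecutive integers, which differ by [f 1]. The choice of [N]
    makes [f 1 / N] at most [e]. *)
Lemma additive_ge0_linear {R : realType} (f : R -> R) :
  (forall r s, 0 <= r -> 0 <= s -> f (r + s) = f r + f s) ->
  (forall r, 0 <= r -> 0 <= f r) -> forall r, 0 <= r -> f r = r * f 1.
Proof.
move=> fD f0.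
have f00 : f 0 = 0.
  by have := fD 0 0 (lexx 0) (lexx 0); rewrite addr0 => h; lra.
have fhomo (r s : R) : 0 <= r -> r <= s -> f r <= f s.
  move=> r0 rs; rewrite -(subrK r s) addrC fD ?subr_ge0//.
  by rewrite lerDl f0// subr_ge0.
have fn n (r : R) : 0 <= r -> f (n%:R * r) = n%:R * f r.
  move=> r0; elim: n => [|n IH]; first by rewrite !mul0r.
  by rewrite -natr1 mulrDl mul1r fD// ?IH ?mulrDl ?mul1r// mulr_ge0.
have f10 := f0 1 ler01.
move=> r r0; apply/eqP; rewrite -subr_eq0 -normr_le0; apply/ler_addgt0Pl => e e0.
rewrite addr0; pose N := (Num.truncn (f 1 / e)).+1.
have N0 : (0 : R) < N%:R by rewrite ltr0n.
have fN : f 1 <= N%:R * e by rewrite -ler_pdivrMr//; apply/ltW; exact: truncnS_gt.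
pose k := Num.truncn (N%:R * r).
have [kle kgt] : k%:R <= N%:R * r /\ N%:R * r < k.+1%:R.
  by split; [rewrite truncn_le// mulr_ge0// ltW|exact: truncnS_gt].
have NfE : N%:R * f r = f (N%:R * r) by rewrite fn.
have lo : k%:R * f 1 <= N%:R * f r by rewrite NfE -fn// mulr1; exact: fhomo.
have hi : N%:R * f r <= k.+1%:R * f 1.
  by rewrite NfE -fn// mulr1; apply: fhomo; [rewrite mulr_ge0// ltW|exact: ltW].
have lo' : k%:R * f 1 <= N%:R * r * f 1 by rewrite ler_wpM2r.
have hi' : N%:R * r * f 1 <= k.+1%:R * f 1 by rewrite ler_wpM2r// ltW.
have : N%:R * `|f r - r * f 1| <= f 1.
  rewrite -[N%:R in leLHS]gtr0_norm// -normrM mulrBr mulrA ler_norml.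
  by move: hi hi'; rewrite -natr1 mulrDl mul1r => hi hi'; apply/andP; split; lra.
by move=> /le_trans/(_ fN); rewrite ler_pM2l.
Qed.

(** * Regeneration at [a] and mean local times *)

Section regeneration.
Context {R : realType} {dE} {E : measTopologicalType dE}
  {d} {W : measurableType d}.
Variables (X : markov_process R E W) (L : E -> R -> W -> R).
Hypotheses (HL : local_time_process X L) (recX : recurrent X).
Variable a : E.
Notation tau := (inverse_local_time L).
Notation hit := (hitting_time (Defs.path X) a).
Notation mean := (mean_time X L).

Lemma hitting_shift_le (t T : R) w : 0 <= T -> T <= t -> Defs.path X t w = a ->
  (hit (Defs.shift X T w) <= (t - T)%:E)%E.
Proof.
move=> T0 Tt ta; apply: first_time_le; first by rewrite subr_ge0.
by rewrite /= path_shift ?subr_ge0// subrKC.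
Qed.

(** [hit] is a terminal time: as long as [a] has not been visited, restarting the path does not move
    its first visit. *)
Lemma hitting_shift (T : R) w : 0 <= T -> (T%:E < hit w)%E -> (hit w < +oo)%E ->
  hit w = (T%:E + hit (Defs.shift X T w))%E.
Proof.
move=> T0 Th hoo; have hfin : hit w \is a fin_num by rewrite ge0_fin_numE// first_time_ge0.
have Th' : T < fine (hit w) by rewrite -lte_fin fineK.
have ha := path_at_hitting hoo.
have h1 := hitting_shift_le T0 (ltW Th') ha.
have s0 : (0 <= hit (Defs.shift X T w))%E by exact: first_time_ge0.
have sfin : hit (Defs.shift X T w) \is a fin_num.
  by rewrite ge0_fin_numE// (le_lt_trans h1)// ltry.
apply/eqP; rewrite eq_le; apply/andP; split; last first.
  by rewrite -(fineK sfin) -(fineK hfin) -EFinD lee_fin -lerBrDl -lee_fin fineK.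
rewrite -(fineK sfin) -EFinD; apply: first_time_le.
  by rewrite addr_ge0// fine_ge0.
rewrite /= -path_shift ?fine_ge0//; apply: path_at_hitting.
by rewrite -ge0_fin_numE.
Qed.

(** Restarting forgets the local time already spent at [a], so the restarted path exceeds [r] no
    earlier than the original one. The null set is common to all [T], so that [T] may later be
    random. *)
Lemma tau_shift_le z (r : R) :
  0 <= r -> {ae law X z, forall w (T : R), 0 <= T ->
    (tau a r w <= T%:E + tau a r (Defs.shift X T w))%E}.
Proof.
move=> r0; apply: filterS (local_time_additive HL z a) => w hadd T T0.
have lC := local_time_clock HL a.
have [too|] := ltP (tau a r (Defs.shift X T w)) +oo%E; last first.
  by rewrite leye_eq => /eqP ->; rewrite addey// leey.
have tfin : tau a r (Defs.shift X T w) \is a fin_num by rewrite ge0_fin_numE// tau_ge0.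
have t0 : 0 <= fine (tau a r (Defs.shift X T w)) by exact: fine_ge0 (tau_ge0 _ _ _ _).
rewrite -(fineK tfin) -EFinD; apply/(clock_inv_le (lC w) _ r0); first by rewrite addr_ge0.
move=> s ts; rewrite -(subrKC T s) hadd//; last by rewrite subr_ge0; lra.
apply: (@lt_le_trans _ _ (L a (s - T) (Defs.shift X T w))); last first.
  by rewrite lerDr (clock_ge0 (lC w)).
have : (tau a r (Defs.shift X T w) <= (fine (tau a r (Defs.shift X T w)))%:E)%E by rewrite fineK.
by move/(clock_inv_le (lC _) t0 r0); apply; lra.
Qed.

Lemma shift_at_fin (T : W -> \bar R) w : (T w < +oo)%E ->
  shift_at X T w = Defs.shift X (fine (T w)) w.
Proof. by rewrite /shift_at => ->. Qed.

Lemma tau_add z (r s : R) : 0 <= r -> 0 <= s ->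
  {ae law X z, forall w, tau a (r + s) w =
     (tau a r w + tau a s (shift_at X (tau a r) w))%E}.
Proof.
move=> r0 s0; apply: filterS2 (local_time_additive HL z a) (tau_finite HL recX z a r).
move=> w hadd too; have tfin : tau a r w \is a fin_num by rewrite ge0_fin_numE// tau_ge0.
have lC := local_time_clock HL a.
have la := local_time_at_tau HL r0 too.
rewrite shift_at_fin// -{1}(fineK tfin).
have T0 : 0 <= fine (tau a r w) by exact: fine_ge0 (tau_ge0 _ _ _ _).
have := @clock_inv_shift R (L a ^~ w) (L a ^~ (Defs.shift X (fine (tau a r w)) w))
  (fine (tau a r w)) (r + s) (lC _) (lC _) T0.
rewrite la [r + s]addrC addrK lerDr.
apply => // t t0; have := hadd _ t T0 t0; rewrite la; exact.
Qed.

Lemma strong_markov_finite (T : W -> \bar R) z y (G : W -> R) (H : W -> \bar R) :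
  stopping_time (history X) T -> {ae law X z, forall w, (T w < +oo)%E} ->
  {ae law X z, forall w, (T w < +oo)%E -> Defs.path X (fine (T w)) w = y} ->
  (forall B, measurable B -> stopped_sigma_algebra (history X) T (G @^-1` B)) ->
  (forall w, 0 <= G w) ->
  measurable_fun setT H -> (forall v, 0 <= H v)%E ->
  (\int[law X z]_w ((G w)%:E * H (shift_at X T w)) =
   (\int[law X z]_w (G w)%:E) * \int[law X y]_v H v)%E.
Proof.
move=> hT Too hy hG G0 mH H0.
have mG : measurable_fun setT G by move=> _ B mB; rewrite setTI; exact: (hG B mB).1.
have mHs : measurable_fun setT (H \o shift_at X T).
  by apply: measurableT_comp => //; exact: measurable_shift_at.
rewrite -(integral_finite_time hT Too); last 2 first.
- by apply: emeasurable_funM => //; exact/measurable_EFinP.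
- by move=> w; rewrite mule_ge0// lee_fin.
rewrite -[X in _ = (X * _)%E](integral_finite_time hT Too); last 2 first.
- exact/measurable_EFinP.
- by move=> w; rewrite lee_fin.
rewrite -(strong_markov_at hT hy hG)//.
by apply: eq_integral => w /[!inE] Twoo; rewrite /shift_at Twoo.
Qed.

Lemma strong_markov_finite1 (T : W -> \bar R) z y (H : W -> \bar R) :
  stopping_time (history X) T -> {ae law X z, forall w, (T w < +oo)%E} ->
  {ae law X z, forall w, (T w < +oo)%E -> Defs.path X (fine (T w)) w = y} ->
  measurable_fun setT H -> (forall v, 0 <= H v)%E ->
  (\int[law X z]_w H (shift_at X T w) = \int[law X y]_v H v)%E.
Proof.
move=> hT Too hy mH H0.
have := @strong_markov_finite T z y (\1_setT) H hT Too hy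
  (stopped_indic hT (stopped_setT hT)) (fun w => ler0n _ _) mH H0.
under eq_integral do rewrite indicT mul1e.
move=> ->; rewrite [X in (X * _)%E](_ : _ = 1%E) ?mul1e//.
rewrite integral_indic// setIT.
exact: (probability_setT (pker_law (law X) z)).
Qed.

Lemma clock_at_sum_time (l : R -> W -> R) z (T S : W -> \bar R) (ST : W -> \bar R) :
  additive_clock X l -> (forall w, 0 <= T w)%E -> (forall w, 0 <= S w)%E ->
  {ae law X z, forall w, (T w < +oo)%E} ->
  {ae law X z, forall w, (S (shift_at X T w) < +oo)%E} ->
  {ae law X z, forall w, ST w = (T w + S (shift_at X T w))%E} ->
  {ae law X z, forall w, l (fine (ST w)) w =
    l (fine (T w)) w + l (fine (S (shift_at X T w))) (shift_at X T w)}.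
Proof.
move=> lA T0 S0 Too Soo STE.
apply: filterS2 (filterI Too Soo) (filterI (lA z) STE) => w [{}Too {}Soo] [{}lA ->].
rewrite fineD ?ge0_fin_numE// lA ?fine_ge0//.
by rewrite -(shift_at_fin Too).
Qed.

Lemma shift_at_ae (T : W -> \bar R) z y (Q : set W) :
  stopping_time (history X) T -> {ae law X z, forall w, (T w < +oo)%E} ->
  {ae law X z, forall w, (T w < +oo)%E -> Defs.path X (fine (T w)) w = y} ->
  {ae law X y, forall w, Q w} -> {ae law X z, forall w, Q (shift_at X T w)}.
Proof.
move=> hT Too hy hQ; apply: filterS2 Too (strong_markov_ae hT hy hQ) => w Twoo h.
by rewrite shift_at_fin//; exact: h.
Qed.

Lemma path_at_hit z : {ae law X z, forall w, (hit w < +oo)%E ->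
  Defs.path X (fine (hit w)) w = a}.
Proof. by apply: aeW => w; exact: path_at_hitting. Qed.

Lemma hit_finite z : {ae law X z, forall w, (hit w < +oo)%E}.
Proof. exact: (hitting_finite recX z a). Qed.

Lemma tau_after_hit z (r : R) : 0 <= r ->
  {ae law X z, forall w, tau a r w = (hit w + tau a r (shift_at X hit w))%E}.
Proof.
move=> r0; apply: filterS2 (tau_after_hitting HL z a r0) (hit_finite z) => w -> hoo.
by rewrite shift_at_fin// fineK// ge0_fin_numE// first_time_ge0.
Qed.

Lemma additive_clock_local_time y : additive_clock X (L y).
Proof. by move=> z; exact: local_time_additive. Qed.

Lemma mean_time_ge0 (T : W -> \bar R) z y : (forall w, 0 <= T w)%E -> (0 <= mean T z y)%E.
Proof.
move=> T0; apply: integral_ge0 => w _; rewrite lee_fin.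
by rewrite (clock_ge0 (local_time_clock HL y w))// fine_ge0.
Qed.

Lemma mean_time_sum z b y (T S ST : W -> \bar R) :
  stopping_time (history X) T -> stopping_time (history X) S ->
  measurable_fun setT ST -> (forall w, 0 <= ST w)%E ->
  {ae law X z, forall w, (T w < +oo)%E} ->
  {ae law X z, forall w, (T w < +oo)%E -> Defs.path X (fine (T w)) w = b} ->
  {ae law X b, forall w, (S w < +oo)%E} ->
  {ae law X z, forall w, ST w = (T w + S (shift_at X T w))%E} ->
  mean ST z y = (mean T z y + mean S b y)%E.
Proof.
move=> hT hS mST ST0 Too hb Soo STE.
have Ls := local_time_process_clock HL y.
have mS := measurable_local_time_at HL y hS; have mT := measurable_local_time_at HL y hT.
have T0 := hT.1; have S0 := hS.1.
have mSs : measurable_fun setT (fun w => L y (fine (S (shift_at X T w))) (shift_at X T w)).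
  exact: (measurableT_comp mS (measurable_shift_at hT)).
have l0 (U : W -> \bar R) w : (0 <= U w)%E -> 0 <= L y (fine (U w)) w.
  by move=> U0; rewrite (clock_ge0 (local_time_clock HL y w))// fine_ge0.
have -> : mean S b y =
    (\int[law X z]_w (L y (fine (S (shift_at X T w))) (shift_at X T w))%:E)%E.
  rewrite (strong_markov_finite1 (H := fun w => (L y (fine (S w)) w)%:E) hT Too hb)//.
  - exact/measurable_EFinP.
  - by move=> w; rewrite lee_fin l0.
rewrite /mean_time -ge0_integralD//; last 4 first.
- by move=> w _; rewrite lee_fin l0.
- exact/measurable_EFinP.
- by move=> w _; rewrite lee_fin (l0 S).
- exact/measurable_EFinP.
apply: ae_eq_integral => //.
- by apply/measurable_EFinP; exact: measurable_clock_at_time.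
- by apply: emeasurable_funD; exact/measurable_EFinP.
have hh := shift_at_ae hT Too hb Soo.
have := clock_at_sum_time (@additive_clock_local_time y) T0 S0 Too hh STE.
by apply: filterS => w -> _; rewrite EFinD.
Qed.

Lemma mean_time_tau z y (r : R) : 0 <= r ->
  mean (tau a r) z y = (mean hit z y + mean (tau a r) a y)%E.
Proof.
move=> r0; apply: (@mean_time_sum z a y hit (tau a r)).
- exact: stopping_hitting.
- exact: (stopping_tau HL).
- exact: (measurable_tau HL).
- by move=> w; exact: tau_ge0.
- exact: hit_finite.
- exact: path_at_hit.
- exact: (tau_finite HL recX).
- exact: tau_after_hit.
Qed.

Lemma mean_time_tauD y (r s : R) : 0 <= r -> 0 <= s ->
  mean (tau a (r + s)) a y = (mean (tau a r) a y + mean (tau a s) a y)%E.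
Proof.
move=> r0 s0; apply: (@mean_time_sum a a y (tau a r) (tau a s)).
- exact: (stopping_tau HL).
- exact: (stopping_tau HL).
- exact: (measurable_tau HL).
- by move=> w; exact: tau_ge0.
- exact: (tau_finite HL recX).
- exact: (path_at_tau HL).
- exact: (tau_finite HL recX).
- exact: tau_add.
Qed.

(** At [tau y t] the local time at [y] equals [t]; what it gains afterwards is bounded by letting
    the restarted path run up to its own [tau a r], which by [tau_shift_le] ends no earlier. *)
Lemma local_time_tau_le z y (r t : R) : 0 <= r -> 0 <= t ->
  {ae law X z, forall w, L y (fine (tau a r w)) w <= t +
    \1_[set w | (tau y t w < tau a r w)%E] w *
    L y (fine (tau a r (shift_at X (tau y t) w))) (shift_at X (tau y t) w)}.
Proof.
move=> r0 t0.
have zoo := shift_at_ae (stopping_tau HL y t) (tau_finite HL recX z y t)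
  (path_at_tau HL z y t0) (tau_finite HL recX y a r).
apply: filterS2 (filterI (tau_finite HL recX z a r) (tau_finite HL recX z y t))
  (filterI (filterI (local_time_additive HL z y) zoo) (tau_shift_le z r0)).
move=> w [aoo yoo] [[hadd {}zoo] hle].
have lC := local_time_clock HL y w.
have yfin : tau y t w \is a fin_num by rewrite ge0_fin_numE// tau_ge0.
have afin : tau a r w \is a fin_num by rewrite ge0_fin_numE// tau_ge0.
have T0 : 0 <= fine (tau y t w) by exact: fine_ge0 (tau_ge0 _ _ _ _).
have Z0 : 0 <= fine (tau a r w) by exact: fine_ge0 (tau_ge0 _ _ _ _).
have lt := local_time_at_tau HL t0 yoo.
rewrite indicE; have [lta|nlta] := ltP (tau y t w) (tau a r w).
  rewrite mem_set// mul1r -{1}lt; move: zoo; rewrite shift_at_fin// => zoo.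
  rewrite -hadd//; last exact: fine_ge0 (tau_ge0 _ _ _ _).
  apply: (clock_le lC) => //; rewrite -lee_fin EFinD !fineK//.
    by have := hle _ T0; rewrite fineK.
  by rewrite ge0_fin_numE// tau_ge0.
rewrite memNset ?mul0r ?addr0; last by rewrite /= ltNge nlta.
by rewrite -[leRHS]lt; apply: (clock_le lC) => //; rewrite fine_le.
Qed.

Let lt_tau_law z y (r t : R) : 0 <= r -> 0 <= t ->
  (\int[law X z]_w (\1_[set w | (tau y t w < tau a r w)%E] w)%:E =
   law X z [set w | (t < L y (fine (tau a r w)) w)%R])%E.
Proof.
move=> r0 t0; have hlt := (stopped_lt (stopping_tau HL y t) (stopping_tau HL a r)).1.
rewrite integral_indic// setIT; apply: measure_ae_eq => //.
  rewrite -[X in measurable X]setTI; apply: (measurable_fun_ltr (f := cst t)) => //.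
  by apply: (measurable_local_time_at HL); exact: stopping_tau.
apply: filterS (tau_finite HL recX z a r) => w aoo.
rewrite /= -(fineK (x := tau a r w)); last by rewrite ge0_fin_numE// tau_ge0.
apply: (clock_inv_lt (local_time_clock HL y w) t0).
exact: fine_ge0 (tau_ge0 _ _ _ _).
Qed.

Let mean_min_tau_le z y (r t N : R) : 0 <= r -> 0 <= t -> 0 <= N ->
  (\int[law X z]_w (Num.min (L y (fine (tau a r w)) w) N)%:E <=
   t%:E + law X z [set w | (t < L y (fine (tau a r w)) w)%R] *
     \int[law X y]_w (Num.min (L y (fine (tau a r w)) w) N)%:E)%E.
Proof.
move=> r0 t0 N0; have hT := stopping_tau HL y t.
have hlt := stopped_lt hT (stopping_tau HL a r).
have ml := measurable_local_time_at HL y (stopping_tau HL a r).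
have l0 w : 0 <= L y (fine (tau a r w)) w.
  by rewrite (clock_ge0 (local_time_clock HL y w))// fine_ge0// tau_ge0.
have mH : measurable_fun setT (fun w => (Num.min (L y (fine (tau a r w)) w) N)%:E).
  by apply/measurable_EFinP; exact: measurable_minr.
have H0 w : (0 <= (Num.min (L y (fine (tau a r w)) w) N)%:E)%E.
  by rewrite lee_fin le_min l0.
rewrite -lt_tau_law//.
rewrite -(strong_markov_finite hT (tau_finite HL recX z y t) (path_at_tau HL z y t0)
  (stopped_indic hT hlt) (fun w => ler0n _ _) mH H0).
have tE : t%:E = (\int[law X z]_w (cst t%:E) w)%E.
  rewrite integral_cst//.
  by rewrite (_ : law X z setT = 1%E) ?mule1//; exact: (probability_setT (pker_law (law X) z)).
have mG : measurable_fun setT (fun w => (\1_[set w | (tau y t w < tau a r w)%E] w)%:E *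
  (Num.min (L y (fine (tau a r (shift_at X (tau y t) w))) (shift_at X (tau y t) w)) N)%:E)%E.
  apply: emeasurable_funM.
    by apply/measurable_EFinP; apply: measurable_indic; exact: hlt.1.
  exact: (measurableT_comp mH (measurable_shift_at hT)).
rewrite tE -ge0_integralD//; last by move=> w _; rewrite mule_ge0// lee_fin.
apply: ae_ge0_le_integral => //.
- by move=> w _; rewrite adde_ge0// mule_ge0// lee_fin.
- by apply: emeasurable_funD.
- apply: filterS (local_time_tau_le z y r0 t0) => w + _.
  rewrite /cst -EFinM -EFinD lee_fin !indicE.
  set l' := L y _ (shift_at _ _ _); set l := L y _ w => hl.
  case: (boolP (w \in _)) hl => _; rewrite ?mul1r ?mul0r ?addr0 => hl.
    rewrite ge_min; have [//|] := leP l' N; first by rewrite hl.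
    by rewrite lerDr t0 orbT.
  by rewrite ge_min hl.
Qed.

(** Pick [t] that the local time exceeds with probability at most 1/2. The truncated mean [e k]
    satisfies [e k <= t + e k / 2] and, being finite, is at most [2 * t]; monotone convergence
    removes the truncation. *)
Let mean_time_tau_self y (r : R) : 0 <= r -> (mean (tau a r) y y < +oo)%E.
Proof.
move=> r0; pose P := pker_law (law X) y.
pose l w := L y (fine (tau a r w)) w.
have ml : measurable_fun setT l by apply: (measurable_local_time_at HL y); exact: stopping_tau.
have l0 w : 0 <= l w.
  by rewrite (clock_ge0 (local_time_clock HL y w))// fine_ge0// tau_ge0.
pose mf' := isMeasurableFun.Build _ _ _ _ l ml.
pose Y : {RV P >-> R} := HB.pack l mf'.
have [t t0 qt] : exists2 t : R, 0 <= t & (P [set w | (t < l w)%R] <= (2^-1)%:E)%E.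
  have /fine_cvgP[_ /cvgrPdist_lt/(_ 2^-1)] := cvg_ccdfy0 Y.
  rewrite invr_gt0 ltr0n => /(_ isT)[M [_ hM]].
  exists (Num.max 0 (M + 1)); first by rewrite le_max lexx.
  have := hM (Num.max 0 (M + 1)); rewrite /= lt_max ltrDl ltr01 orbT => /(_ isT).
  rewrite sub0r normrN ger0_norm ?fine_ge0// => /ltW.
  have mset : measurable (l @^-1` `]Num.max 0 (M + 1), +oo[).
    by rewrite -[X in measurable X]setTI; apply: (ml measurableT); exact: measurable_itv.
  rewrite -lee_fin fineK ?fin_num_measure//.
  congr (_ <= _)%E; rewrite /ccdf /distribution /pushforward; congr (P _).
  by apply/seteqP; split => w /=; rewrite in_itv/= andbT.
pose e (k : nat) : \bar R := (\int[law X y]_w (Num.min (l w) k%:R)%:E)%E.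
have mm k : measurable_fun setT (fun w => (Num.min (l w) k%:R)%:E).
  by apply/measurable_EFinP; exact: measurable_minr.
have m0 k w : (0 <= (Num.min (l w) k%:R)%:E :> \bar R)%E by rewrite lee_fin le_min l0/=.
have e2 k : (e k <= (2 * t)%:E)%E.
  have e0 : (0 <= e k)%E by apply: integral_ge0.
  have efin : e k \is a fin_num.
    rewrite ge0_fin_numE//; apply: (@le_lt_trans _ _ (\int[law X y]_w (cst k%:R%:E) w)%E).
      by apply: ge0_le_integral => // w _; rewrite lee_fin ge_min lexx orbT.
    rewrite integral_cst//.
    by rewrite (_ : law X y setT = 1%E) ?mule1 ?ltry//; exact: (probability_setT P).
  have := mean_min_tau_le y y r0 t0 (ler0n _ k); rewrite -/(e k) => h.
  have {h} : (e k <= t%:E + (2^-1)%:E * e k)%E.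
    by apply: (le_trans h); rewrite leeD2l// lee_wpmul2r.
  by rewrite -(fineK efin) -EFinM -EFinD !lee_fin; lra.
apply: (@le_lt_trans _ _ (2 * t)%:E); last by rewrite ltry.
have cvgl w : (Num.min (l w) k%:R)%:E @[k --> \oo] --> (l w)%:E.
  apply: cvg_near_cst; exists (Num.truncn (l w)).+1 => // k /= lk.
  rewrite min_l//; apply: (le_trans (ltW (truncnS_gt (l w)))); by rewrite ler_nat.
have -> : mean (tau a r) y y = (\int[law X y]_w limn (fun k => (Num.min (l w) k%:R)%:E))%E.
  by apply: eq_integral => w _; apply/esym/cvg_lim => //; exact: cvgl.
rewrite monotone_convergence//; last first.
  by move=> w _ i j ij; rewrite lee_fin le_min !ge_min lexx/= ler_nat ij orbT.
apply: lime_le.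
  apply: ereal_nondecreasing_is_cvgn => i j ij; apply: ge0_le_integral => //.
  by move=> w _; rewrite lee_fin le_min !ge_min lexx/= ler_nat ij orbT.
by apply: nearW => k; exact: e2.
Qed.

(** From another start, no local time at [y] accrues before [tau y 0], and there the path is at [y]:
    the mean is at most the one from [y]. *)
Lemma mean_time_tau_fin_num z y (r : R) : 0 <= r -> mean (tau a r) z y \is a fin_num.
Proof.
move=> r0; rewrite ge0_fin_numE ?mean_time_ge0//; last by move=> w; exact: tau_ge0.
have hT := stopping_tau HL y 0; have hlt := stopped_lt hT (stopping_tau HL a r).
have ml := measurable_local_time_at HL y (stopping_tau HL a r).
have l0 w : 0 <= L y (fine (tau a r w)) w.
  by rewrite (clock_ge0 (local_time_clock HL y w))// fine_ge0// tau_ge0.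
have mH : measurable_fun setT (fun w => (L y (fine (tau a r w)) w)%:E).
  exact/measurable_EFinP.
apply: (le_lt_trans _ (mean_time_tau_self y r0)).
rewrite [leRHS](_ : _ = \int[law X y]_w (L y (fine (tau a r w)) w)%:E)%E//.
rewrite -(strong_markov_finite1 (H := fun w => (L y (fine (tau a r w)) w)%:E)
  hT (tau_finite HL recX z y 0) (path_at_tau HL z y (lexx 0)))//.
apply: ae_ge0_le_integral => //.
- by move=> w _; rewrite lee_fin.
- by move=> w _; rewrite lee_fin (l0 (shift_at _ _ _)).
- exact: (measurableT_comp mH (measurable_shift_at hT)).
apply: filterS (local_time_tau_le z y r0 (lexx 0)) => w + _.
rewrite add0r lee_fin indicE => /le_trans; apply.
by case: (_ \in _); rewrite ?mul1r ?mul0r.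
Qed.

Lemma mean_time_hit_fin_num z y : mean hit z y \is a fin_num.
Proof.
have := mean_time_tau_fin_num z y ler01; rewrite mean_time_tau//.
by rewrite fin_numD => /andP[].
Qed.

Definition rate y : R := fine (mean (tau a 1) a y).

Lemma mean_time_tauE y (r : R) : 0 <= r -> mean (tau a r) a y = (r * rate y)%:E.
Proof.
move=> r0; rewrite -[LHS]fineK ?mean_time_tau_fin_num//; congr EFin.
apply: (@additive_ge0_linear _ (fun r => fine (mean (tau a r) a y))) r0.
  by move=> s t s0 t0; rewrite mean_time_tauD// fineD// mean_time_tau_fin_num.
move=> s s0; apply: fine_ge0; apply: mean_time_ge0 => w; exact: tau_ge0.
Qed.

Lemma rate_ge0 y : 0 <= rate y.
Proof. by apply: fine_ge0; apply: mean_time_ge0 => w; exact: tau_ge0. Qed.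

Lemma rate_self : rate a = 1.
Proof.
rewrite /rate /mean_time (_ : (\int[_]_w _)%E = 1%E)//.
rewrite -(probability_setT (pker_law (law X) a)) -[X in _ = pker_law _ _ X]setIT.
rewrite -integral_indic//.
apply: ae_eq_integral => //.
- apply/measurable_EFinP; apply: (measurable_local_time_at HL); exact: stopping_tau.
- exact/measurable_EFinP/measurable_indic.
- apply: filterS (tau_finite HL recX a a 1) => w too _.
  by rewrite (local_time_at_tau HL)// indicT.
Qed.

End regeneration.

(** * The exponent of the weighted local time *)

Section laplace_exponent.
Context {R : realType} {dE} {E : measTopologicalType dE}
  {d} {W : measurableType d}.
Variables (X : markov_process R E W) (L : E -> R -> W -> R).
Hypotheses (HL : local_time_process X L) (recX : recurrent X).
Variable a : E.
Variables (n : nat) (x : 'I_n -> E) (al : 'I_n -> R).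
Hypothesis al0 : forall i, 0 <= al i.
Notation tau := (inverse_local_time L).
Notation hit := (hitting_time (Defs.path X) a).
Notation mean := (mean_time X L).
Notation ex := (exp_mean X L x al).
Notation A := (weighted_time L x al).

Let A_clock := weighted_time_clock HL x al0.

Lemma weighted_time_ge0 (T : W -> \bar R) w : (0 <= T w)%E -> 0 <= A (fine (T w)) w.
Proof.
by move=> T0; exact: (clock_ge0 (adapted_clock_path A_clock w) (fine_ge0 T0)).
Qed.

Lemma exp_mean_le1 (T : W -> \bar R) z : stopping_time (history X) T -> (ex T z <= 1)%E.
Proof.
move=> hT; rewrite -(probability_setT (pker_law (law X) z)) -[X in (_ <= pker_law _ _ X)%E]setIT.
rewrite -integral_indic//; apply: ge0_le_integral => //.
- exact: (measurable_expR_time HL x al0 hT).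
- exact/measurable_EFinP/measurable_indic.
- by move=> w _; rewrite indicT lee_fin -expR0 ler_expR oppr_le0 weighted_time_ge0// hT.1.
Qed.

Lemma exp_mean_fin_num (T : W -> \bar R) z : stopping_time (history X) T ->
  ex T z \is a fin_num.
Proof.
move=> hT; rewrite ge0_fin_numE; last exact: exp_mean_ge0.
by rewrite (le_lt_trans (exp_mean_le1 z hT))// ltry.
Qed.

Lemma integral_one_sub_exp_mean (T : W -> \bar R) z : stopping_time (history X) T ->
  (\int[law X z]_w (1 - expR (- A (fine (T w)) w))%:E = (1 - fine (ex T z))%:E)%E.
Proof.
move=> hT; have mT := measurable_expR_time HL x al0 hT.
have one : (\int[law X z]_w (1 : \bar R) = 1)%E.
  rewrite (_ : (fun _ => _) = cst 1%E)// integral_cst// mul1e.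
  exact: (probability_setT (pker_law (law X) z)).
have S : (\int[law X z]_w (1 - expR (- A (fine (T w)) w))%:E + ex T z = 1)%E.
  rewrite /exp_mean -ge0_integralD//; last 2 first.
  - move=> w _; rewrite lee_fin subr_ge0 -expR0 ler_expR oppr_le0 weighted_time_ge0// hT.1.
    by [].
  - apply/measurable_EFinP; apply: measurable_funB => //; exact/measurable_EFinP.
  by rewrite -[RHS]one; apply: eq_integral => w _; rewrite -EFinD subrK.
have fin := exp_mean_fin_num z hT.
move: S; rewrite -{1}(fineK fin) => S.
by rewrite EFinB -S addeK.
Qed.

(** This is what gives a meaning to the logarithm in [exponent]; a null mean would force an
    exponential to vanish almost surely. *)
Lemma exp_mean_gt0 (T : W -> \bar R) z : stopping_time (history X) T ->
  0 < fine (ex T z).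
Proof.
move=> hT; rewrite fine_gt0// lt_neqAle exp_mean_ge0 andbT.
rewrite (le_lt_trans (exp_mean_le1 z hT)) ?ltry// andbT; apply/eqP => h.
have mT := measurable_expR_time HL x al0 hT.
have : (\int[law X z]_w `|(expR (- A (fine (T w)) w))%:E| = 0)%E.
  by rewrite [RHS]h; apply: eq_integral => w _; rewrite gee0_abs// lee_fin expR_ge0.
move=> /(ae_eq_integral_abs _ measurableT mT) h0.
have : {ae law X z, forall w : W, (set0 : set W) w}.
  apply: filterS h0 => w /(_ I)/=[] /eqP; rewrite gt_eqF//; exact: expR_gt0.
move=> /(probability_ae (P := pker_law (law X) z) measurable0).
by rewrite measure0 => /eqP; rewrite eq_sym onee_eq0.
Qed.

Lemma stopped_expR (T : W -> \bar R) (B : set R) : stopping_time (history X) T ->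
  measurable B ->
  stopped_sigma_algebra (history X) T ((fun w => expR (- A (fine (T w)) w)) @^-1` B).
Proof.
move=> hT mB; apply: (stopped_clock A_clock (B := (fun v => expR (- v)) @^-1` B)) => //.
rewrite -[X in measurable X]setTI.
have : measurable_fun setT (fun v : R => expR (- v)) by exact: measurableT_comp.
by apply.
Qed.

Lemma exp_mean_prod z b (T S ST : W -> \bar R) :
  stopping_time (history X) T -> stopping_time (history X) S ->
  stopping_time (history X) ST ->
  {ae law X z, forall w, (T w < +oo)%E} ->
  {ae law X z, forall w, (T w < +oo)%E -> Defs.path X (fine (T w)) w = b} ->
  {ae law X b, forall w, (S w < +oo)%E} ->
  {ae law X z, forall w, ST w = (T w + S (shift_at X T w))%E} ->
  ex ST z = (ex T z * ex S b)%E.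
Proof.
move=> hT hS hST Too hb Soo STE.
have mS := measurable_expR_time HL x al0 hS.
have hG (B : set R) : measurable B -> stopped_sigma_algebra (history X) T
  ((fun w => expR (- A (fine (T w)) w)) @^-1` B) by move=> mB; exact: stopped_expR.
have G0 w : 0 <= expR (- A (fine (T w)) w) by exact: expR_ge0.
have H0 w : (0 <= (expR (- A (fine (S w)) w))%:E)%E by rewrite lee_fin expR_ge0.
have <- := strong_markov_finite hT Too hb hG G0 mS H0.
apply: ae_eq_integral => //.
- exact: (measurable_expR_time HL x al0 hST).
- apply: emeasurable_funM; first exact: (measurable_expR_time HL x al0 hT).
  exact: (measurableT_comp mS (measurable_shift_at hT)).
have hh := shift_at_ae hT Too hb Soo.
have := clock_at_sum_time (weighted_time_additive HL x al) hT.1 hS.1 Too hh STE.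
by apply: filterS => w -> _; rewrite opprD expRD EFinM.
Qed.

Let hit_stop := stopping_hitting X a.
Let tau_stop r := stopping_tau HL a r.

Lemma exp_mean_tau z (r : R) : 0 <= r ->
  ex (tau a r) z = (ex hit z * ex (tau a r) a)%E.
Proof.
move=> r0; apply: (@exp_mean_prod z a hit (tau a r)) => //.
- exact: hit_finite.
- exact: path_at_hit.
- exact: (tau_finite HL recX).
- exact: (tau_after_hit HL recX).
Qed.

Lemma exp_mean_tauD (r s : R) : 0 <= r -> 0 <= s ->
  ex (tau a (r + s)) a = (ex (tau a r) a * ex (tau a s) a)%E.
Proof.
move=> r0 s0; apply: (@exp_mean_prod a a (tau a r) (tau a s)) => //.
- exact: (tau_finite HL recX).
- exact: (path_at_tau HL).
- exact: (tau_finite HL recX).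
- exact: (tau_add HL recX).
Qed.

Definition exponent : R := - ln (fine (ex (tau a 1) a)).

Lemma exp_mean_tauE (r : R) : 0 <= r -> ex (tau a r) a = (expR (- (r * exponent)))%:E.
Proof.
move=> r0; rewrite -[LHS]fineK ?exp_mean_fin_num//; congr EFin.
rewrite -[LHS]lnK; last by rewrite posrE exp_mean_gt0.
congr expR; rewrite -[LHS]opprK; congr (- _).
apply: (@additive_ge0_linear _ (fun r => - ln (fine (ex (tau a r) a)))) r0.
  move=> s t s0 t0; rewrite exp_mean_tauD// fineM ?exp_mean_fin_num//.
  by rewrite lnM ?posrE ?exp_mean_gt0// opprD.
move=> s s0; rewrite oppr_ge0 ln_le0// -lee_fin fineK ?exp_mean_fin_num//.
exact: exp_mean_le1.
Qed.

Lemma exponent_ge0 : 0 <= exponent.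
Proof.
rewrite oppr_ge0 ln_le0// -lee_fin fineK ?exp_mean_fin_num//.
exact: exp_mean_le1.
Qed.

Definition hit_exp z : R := fine (ex hit z).
Definition hit_green z y : R := fine (mean hit z y).

(** As [hit] is a terminal time, both comparisons apply with [zeta = zeta' = hit], and together they
    give an equality. *)
Lemma hit_exp_equation z :
  hit_exp z + \sum_i al i * hit_green z (x i) * hit_exp (x i) = 1.
Proof.
have sumE : (\sum_i (al i)%:E * (mean hit z (x i) * ex hit (x i)) =
    (\sum_i al i * hit_green z (x i) * hit_exp (x i))%:E)%E.
  rewrite -sumEFin; apply: eq_bigr => i _.
  rewrite -[mean hit z _]fineK ?mean_time_hit_fin_num//.
  by rewrite -[ex hit _]fineK ?exp_mean_fin_num// -!EFinM mulrA.
have hitE i s : 0 <= s -> {ae law X z, forall w, (tau (x i) s w < hit w)%E ->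
    hit w = (tau (x i) s w + hit (Defs.shift X (fine (tau (x i) s w)) w))%E}.
  move=> s0; apply: filterS (hit_finite recX a z) => w hoo th.
  have tfin : tau (x i) s w \is a fin_num.
    by rewrite ge0_fin_numE ?tau_ge0// (lt_trans th).
  rewrite -{1}(fineK tfin); apply: hitting_shift; rewrite ?fineK//.
  exact: fine_ge0 (tau_ge0 _ _ _ _).
have le1 := one_sub_exp_mean_le HL recX (x := x) al0 hit_stop hit_stop
  (hit_finite recX a z) (hit_finite recX a).
have ge1 := one_sub_exp_mean_ge HL recX (x := x) al0 hit_stop hit_stop
  (hit_finite recX a z) (hit_finite recX a).
rewrite integral_one_sub_exp_mean// sumE in le1; rewrite integral_one_sub_exp_mean// sumE in ge1.
have : ((1 - hit_exp z)%:E = (\sum_i al i * hit_green z (x i) * hit_exp (x i))%:E)%E.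
  apply/eqP; rewrite eq_le le1 ?ge1// => i s s0; apply: filterS (hitE i s s0) => w h th.
    by rewrite [leLHS]h.
  by rewrite [leRHS]h.
by move=> [<-]; rewrite subrKC.
Qed.

(** The path is at [a] at time [tau a r], so after an earlier visit to [x i] it must still hit [a]
    before that time. Comparing with [zeta' = hit] gives [1 - expR (- (r * exponent)) <= r * K] for
    every [r > 0], and a small [r] yields the bound. *)
Let exponent_le : exponent <= \sum_i al i * rate X L a (x i) * hit_exp (x i).
Proof.
set K := \sum_i _; have K0 : 0 <= K.
  by apply: sumr_ge0 => i _; rewrite !mulr_ge0 ?rate_ge0// fine_ge0// exp_mean_ge0.
have main r : 0 < r -> 1 - expR (- (r * exponent)) <= r * K.
  move=> r0; have r0' := ltW r0.
  have := one_sub_exp_mean_le HL recX (x := x) al0 (tau_stop r) hit_stop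
    (tau_finite HL recX a a r) (hit_finite recX a).
  rewrite integral_one_sub_exp_mean// exp_mean_tauE//.
  rewrite (_ : (\sum_i (al i)%:E * (mean (tau a r) a (x i) * ex hit (x i)))%E = (r * K)%:E).
    rewrite lee_fin; apply => i s s0.
    apply: filterS (path_at_tau HL a a r0') => w hpath lt.
    have tfin : tau (x i) s w \is a fin_num.
      by rewrite ge0_fin_numE ?tau_ge0// (lt_le_trans lt)// leey.
    have [too|] := ltP (tau a r w) +oo%E; last by rewrite leye_eq => /eqP ->; rewrite leey.
    have afin : tau a r w \is a fin_num by rewrite ge0_fin_numE// tau_ge0.
    have T0 : 0 <= fine (tau (x i) s w) by exact: fine_ge0 (tau_ge0 _ _ _ _).
    have Tt : fine (tau (x i) s w) <= fine (tau a r w) by rewrite fine_le// ltW.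
    have h := hitting_shift_le T0 Tt (hpath too).
    have := leeD2l (tau (x i) s w) h.
    by rewrite -[in X in (_ <= X)%E -> _](fineK tfin) -EFinD subrKC (fineK afin).
  rewrite mulr_sumr -sumEFin; apply: eq_bigr => i _.
  rewrite mean_time_tauE// -[ex hit _]fineK ?exp_mean_fin_num// -!EFinM.
  by congr EFin; rewrite /hit_exp; ring.
have k0 := exponent_ge0.
rewrite leNgt; apply/negP => Kk.
have k1 : 0 < exponent := le_lt_trans K0 Kk.
(* An explicit value instead of a limit: [expR (- t) * (1 + t) <= 1] turns the bound at
   [t / exponent] into [exponent <= K * (1 + t)], which this [t] contradicts. *)
pose t := (exponent - K) / (2 * (K + 1)).
have t0 : 0 < t by rewrite divr_gt0 ?subr_gt0//; lra.
have tE : t * (2 * (K + 1)) = exponent - K by rewrite divfK// gt_eqF//; lra.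
have := main (t / exponent) (divr_gt0 t0 k1); rewrite divfK ?gt_eqF//.
have e1 : expR (- t) * (1 + t) <= 1.
  by rewrite -[leRHS](expRxMexpNx_1 t) mulrC ler_wpM2r ?expR_ge0// expR_ge1Dx.
rewrite -(ler_pM2l k1) mulrA (mulrC exponent (t / _)) divfK ?gt_eqF// => h.
have e0 := expR_ge0 (- t).
have h2 : exponent * t <= t * K * (1 + t).
  have : exponent * (1 - expR (- t)) * (1 + t) <= t * K * (1 + t).
    by rewrite ler_pM2r//; lra.
  nra.
have h3 : exponent <= K * (1 + t) by rewrite -(ler_pM2r t0); nra.
nra.
Qed.

(** By [tau_shift_le] the comparison in the other direction holds with [zeta' = tau a r]. Its
    exponential mean from [x i] factors at the hitting of [a] into [hit_exp (x i)] and
    [expR (- (r * exponent))], which tends to 1 with small [r]. *)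
Let exponent_ge : \sum_i al i * rate X L a (x i) * hit_exp (x i) <= exponent.
Proof.
set K := \sum_i _; have K0 : 0 <= K.
  by apply: sumr_ge0 => i _; rewrite !mulr_ge0 ?rate_ge0// fine_ge0// exp_mean_ge0.
have main r : 0 < r -> r * K * expR (- (r * exponent)) <= 1 - expR (- (r * exponent)).
  move=> r0; have r0' := ltW r0.
  have := one_sub_exp_mean_ge HL recX (x := x) al0 (tau_stop r) (tau_stop r)
    (tau_finite HL recX a a r) (fun y => tau_finite HL recX y a r).
  rewrite integral_one_sub_exp_mean// exp_mean_tauE//.
  rewrite (_ : (\sum_i (al i)%:E * (mean (tau a r) a (x i) * ex (tau a r) (x i)))%E =
    (r * K * expR (- (r * exponent)))%:E).
    rewrite lee_fin; apply => i s s0.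
    apply: filterS (tau_shift_le HL a a r0') => w hle lt.
    have tfin : tau (x i) s w \is a fin_num.
      by rewrite ge0_fin_numE ?tau_ge0// (lt_le_trans lt)// leey.
    have := hle (fine (tau (x i) s w)) (fine_ge0 (tau_ge0 _ _ _ _)).
    by rewrite fineK.
  rewrite mulr_sumr mulr_suml -sumEFin; apply: eq_bigr => i _.
  rewrite mean_time_tauE// exp_mean_tau// exp_mean_tauE//.
  rewrite -[ex hit _]fineK ?exp_mean_fin_num// -!EFinM.
  by congr EFin; rewrite /hit_exp; ring.
have k0 := exponent_ge0.
rewrite leNgt; apply/negP => kK.
have K1 : 0 < K := le_lt_trans k0 kK.
(* Small enough to contradict [K * (1 - r * exponent) <= exponent], which follows from [main] and
   [expR_ge1Dx]. *)
pose r := (K - exponent) / (2 * K * (exponent + 1)).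
have D0 : 0 < 2 * K * (exponent + 1) by rewrite !mulr_gt0//; lra.
have r0 : 0 < r by rewrite divr_gt0 ?subr_gt0//.
have rE : r * (2 * K * (exponent + 1)) = K - exponent by rewrite divfK// gt_eqF.
have h := main r r0.
have e1 : 1 - r * exponent <= expR (- (r * exponent)) by exact: expR_ge1Dx.
have rK0 : 0 < r * K by rewrite mulr_gt0.
have h1 : r * K * (1 - r * exponent) <= r * exponent.
  by apply: (@le_trans _ _ (r * K * expR (- (r * exponent)))); [rewrite ler_pM2l|lra].
have h2 : K * (1 - r * exponent) <= exponent by rewrite -(ler_pM2l r0); nra.
nra.
Qed.

Lemma exponentE : exponent = \sum_i al i * rate X L a (x i) * hit_exp (x i).
Proof. by apply/eqP; rewrite eq_le exponent_le exponent_ge. Qed.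

End laplace_exponent.

(** * Green functions of the killed processes *)

(** Matrix determinant lemma: two products of block triangular matrices coincide, and their
    determinants are the two sides. *)
Lemma det_one_add_rank1 {R : comNzRingType} n (u : 'cV[R]_n) (v : 'rV[R]_n) :
  \det (1%:M + u *m v) = 1 + (v *m u) 0 0.
Proof.
have E1 : block_mx (1%:M + u *m v) (- u) 0 (1%:M : 'M[R]_1) *m
    block_mx 1%:M 0 v 1%:M =
    block_mx 1%:M 0 v 1%:M *m block_mx 1%:M (- u) 0 (1%:M + v *m u).
  rewrite !mulmx_block !mul1mx !mulmx1 !mul0mx !mulmx0 !addr0 !add0r.
  by rewrite mulNmx addrK mulmxN [- _ + _]addrC addrK.
have := congr1 determinant E1.
rewrite !det_mulmx !det_ublock !det_lblock !det1 !mulr1 !mul1r => ->.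
by rewrite det_mx11 !mxE eqxx.
Qed.

(** The column [u] of entries [al i * h i] solves [(1 + al G0) u = al], by the equation for [h].
    Hence the rank-one term factors out as [(1 + al G0) (1 + u v)], with [v] the row of the
    [gam j]. *)
Lemma det_one_add_diag_shift {R : comNzRingType} n (al gam h : 'I_n -> R)
    (G0 : 'M[R]_n) (alv : 'rV[R]_n) :
  (forall i, alv 0 i = al i) ->
  (forall i, h i + \sum_j al j * G0 i j * h j = 1) ->
  \det (1%:M + diag_mx alv *m (\matrix_(i, j) (G0 i j + gam j))) =
  \det (1%:M + diag_mx alv *m G0) * (1 + \sum_j al j * gam j * h j).
Proof.
move=> alE hE; pose u := \col_i (al i * h i); pose v := \row_j gam j.
have -> : 1%:M + diag_mx alv *m (\matrix_(i, j) (G0 i j + gam j)) =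
    (1%:M + diag_mx alv *m G0) *m (1%:M + u *m v).
  rewrite mulmxDr mulmx1 mulmxA -addrA; congr (_ + _).
  have -> : (1%:M + diag_mx alv *m G0) *m u = \col_i al i.
    apply/colP => i; rewrite mulmxDl mul1mx -mulmxA !mxE.
    rewrite (bigD1 i)//= big1 ?addr0; last first.
      by move=> j ji; rewrite !mxE eq_sym (negbTE ji) mulr0n mul0r.
    rewrite !mxE eqxx mulr1n alE -[in LHS](mulr1 (al i)) -[in RHS](mulr1 (al i)).
    rewrite -[in RHS](hE i) mulrDr mulr1; congr (_ + _); congr (_ * _).
    by apply: eq_bigr => j _; rewrite !mxE; rewrite mulrCA mulrA.
  apply/matrixP => i j; rewrite !mxE big_ord1 !mxE.
  under eq_bigr do rewrite !mxE mulrDr.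
  rewrite big_split/=; congr (_ + _); first by apply: eq_bigr => k _; rewrite !mxE.
  rewrite (bigD1 i)//= big1 ?addr0 ?eqxx ?mulr1n ?alE//.
  by move=> k ki; rewrite eq_sym (negbTE ki) mulr0n mul0r.
rewrite det_mulmx det_one_add_rank1; congr (_ * (_ + _)).
by rewrite !mxE; apply: eq_bigr => j _; rewrite !mxE; rewrite mulrCA mulrA.
Qed.

(** * The exponential level and its mean *)

Section exponential_level.
Context {R : realType} {dS} {WS : measurableType dS} (PS : probability WS R).
Variables (S : {RV PS >-> R}) (theta : R).
Hypothesis theta0 : 0 < theta.
Hypothesis hS : forall B : set R, measurable B ->
  distribution PS S B = exponential_prob theta B.

Lemma exponential_level_ge0 : {ae PS, forall w, 0 <= S w}.
Proof.
exists (S @^-1` `]-oo, 0[); split.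
- by rewrite -[X in measurable X]setTI; exact: measurable_funP.
- have := hS (measurable_itv `]-oo, 0[); rewrite /distribution /pushforward => ->.
  rewrite /exponential_prob; apply: integral0_eq => x; rewrite /= in_itv/= => x0.
  by rewrite lt0_exponential_pdf.
- by move=> w /= /negP; rewrite -ltNge in_itv/=.
Qed.

(** Truncated at 0 because [S] is nonnegative only almost surely. *)
Definition mean_level : \bar R := (\int[PS]_w (Num.max 0 (S w))%:E)%E.

Let mmax : measurable_fun setT (fun w => Num.max 0 (S w)).
Proof. by apply: measurable_maxr => //; exact: measurable_funP. Qed.

(** The tail of an exponential variable is [theta^-1] times its density, and the density has
    integral 1. *)
Lemma mean_level_fin_num : mean_level \is a fin_num.
Proof.
have max0 w : 0 <= Num.max 0 (S w) by rewrite le_max lexx.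
rewrite ge0_fin_numE; last by apply: integral_ge0 => w _; rewrite lee_fin.
rewrite /mean_level ge0_integral_ccdf//.
have mpdf : measurable_fun setT (fun s => (exponential_pdf theta s)%:E).
  by apply/measurable_EFinP; exact: measurable_exponential_pdf.
have pdf0 s : (0 <= (exponential_pdf theta s)%:E)%E.
  by rewrite lee_fin exponential_pdf_ge0// ltW.
have th0 : (0 <= (theta^-1)%:E)%E by rewrite lee_fin invr_ge0 ltW.
apply: (@le_lt_trans _ _ (\int[lebesgue_measure]_(s in `[0%R, +oo[)
  ((theta^-1)%:E * (exponential_pdf theta s)%:E))%E).
  apply: ge0_le_integral => //.
  - pose mf' := isMeasurableFun.Build _ _ _ _ (fun w => Num.max 0 (S w)) mmax.
    pose Y : {RV PS >-> R} := HB.pack (fun w => Num.max 0 (S w)) mf'.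
    apply: measurable_funTS; have := ccdf_measurable Y; congr (measurable_fun _ _).
    apply/funext => s; rewrite /ccdf /distribution /pushforward.
    by congr (PS _); apply/seteqP; split => w /=; rewrite in_itv/= andbT.
  - by apply: measurable_funTS; apply: emeasurable_funM => //; exact: measurable_cst.
  - move=> s; rewrite /= in_itv/= andbT => s0; rewrite exponential_pdfE//.
    rewrite -EFinM mulKf ?gt_eqF//.
    have mset : measurable [set w | s < Num.max 0 (S w)].
      by rewrite -[X in measurable X]setTI; apply: (measurable_fun_ltr (f := cst s)).
    move: s0 mset; rewrite le_eqVlt => /orP[/eqP <-|s0] mset.
      by rewrite mulr0 expR0 probability_le1.
    have mS : measurable_fun setT S by exact: measurable_funP.
    have mS0 : measurable (S @^-1` `[0, s]).
      by rewrite -[X in measurable X]setTI; exact: (mS measurableT).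
    apply: (@le_trans _ _ (PS (~` (S @^-1` `[0, s])))).
      apply: le_measure; rewrite ?inE//; first exact: measurableC.
      move=> w /=; rewrite in_itv/= lt_max ltNge (ltW s0)/= => Sw /andP[_].
        by rewrite leNgt Sw.
    rewrite probability_setC// -[PS (S @^-1` _)]/(distribution PS S `[0, s]) hS//.
    have -> : exponential_prob theta `[0, s] = (1 - expR (- theta * s))%:E.
      by rewrite exponential_prob_itv0c// EFinB.
    by rewrite -EFinB lee_fin; lra.
rewrite ge0_integralZl//; last by apply: measurable_funTS.
apply: lte_mul_pinfty => //.
apply: (@le_lt_trans _ _ (\int[lebesgue_measure]_s (exponential_pdf theta s)%:E)%E).
  by apply: ge0_subset_integral.
by rewrite integral_exponential_pdf// ltry.
Qed.

(** A null mean would put all the mass of [S] at 0, where a law with a density has no atom. *)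
Lemma mean_level_gt0 : 0 < fine mean_level.
Proof.
rewrite fine_gt0// -ge0_fin_numE ?mean_level_fin_num ?andbT; last first.
  by apply: integral_ge0 => w _; rewrite lee_fin le_max lexx.
rewrite lt_neqAle; apply/andP; split; last first.
  by apply: integral_ge0 => w _; rewrite lee_fin le_max lexx.
apply/eqP => h.
have : (\int[PS]_w `|(Num.max 0 (S w))%:E| = 0)%E.
  by rewrite [RHS]h; apply: eq_integral => w _; rewrite gee0_abs// lee_fin le_max lexx.
move=> /ae_eq_integral_abs h0.
have m1 : measurable_fun setT (fun w => (Num.max 0 (S w))%:E) by exact/measurable_EFinP.
have {}h0 := h0 measurableT m1.
have S0 : {ae PS, forall w, (S @^-1` [set 0]) w}.
  apply: filterS2 h0 exponential_level_ge0 => w /(_ I)/= [] mx S0.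
  by rewrite /preimage/= -mx max_r.
have mS0 : measurable (S @^-1` [set 0]).
  by rewrite -[X in measurable X]setTI; apply: measurable_funP => //; exact: measurable_set1.
have := probability_ae mS0 S0.
have := hS (measurable_set1 0); rewrite /distribution /pushforward => ->.
rewrite /exponential_prob => /eqP; rewrite integral_set1// eq_sym onee_eq0//.
Qed.

End exponential_level.

(** * The two Green functions and their difference *)

Section killed_green_functions.
Context {R : realType} {dE} {E : measTopologicalType dE}
  {d} {W : measurableType d}.
Variables (X : markov_process R E W) (L : E -> R -> W -> R) (a : E).
Hypotheses (HL : local_time_process X L) (recX : recurrent X).
Notation tau := (inverse_local_time L).
Notation hit := (hitting_time (Defs.path X) a).

Let stopped_total_mean (T : W -> \bar R) z y : stopping_time (history X) T ->
  {ae law X z, forall w, (T w < +oo)%E} ->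
  (\int[law X z]_w total_local_time (killed_local_time L T) y w = mean_time X L T z y)%E.
Proof.
move=> hT Too; have Ly := local_time_process_clock HL y.
have mT := measurable_stopping hT.
apply: ae_eq_integral => //.
- exact: (measurable_stopped_total Ly mT hT.1).
- by apply/measurable_EFinP; exact: (measurable_local_time_at HL).
- apply: filterS Too => w {}Too _; exact: (stopped_total_fin Ly (hT.1 w) Too).
Qed.

Lemma green_killed_at_hittingE z y :
  green_killed_at_hitting X L a z y = (hit_green X L a z y)%:E.
Proof.
rewrite /hit_green fineK ?mean_time_hit_fin_num//.
apply: stopped_total_mean; first exact: stopping_hitting.
exact: (hitting_finite recX).
Qed.

Lemma hit_green_self z : hit_green X L a z a = 0.
Proof.
rewrite /hit_green /mean_time (_ : (\int[_]_w _)%E = 0%E)//.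
rewrite -(integral0 (law X z) setT); apply: ae_eq_integral => //.
- apply/measurable_EFinP; apply: (measurable_local_time_at HL); exact: stopping_hitting.
- by apply: filterS (local_time_at_hitting HL z a) => w -> _.
Qed.

Context {dS} {WS : measurableType dS} (PS : probability WS R).
Variables (S : {RV PS >-> R}) (theta : R).
Hypothesis theta0 : 0 < theta.
Hypothesis hS : forall B : set R, measurable B ->
  distribution PS S B = exponential_prob theta B.

(** Tonelli with the level outermost: at a fixed level [s >= 0] the mean local time is
    [hit_green + s * rate], affine in [s], so only the mean of the level enters. *)
Lemma green_killed_at_inverseE z y :
  green_killed_at_inverse X L a PS S z y =
  (hit_green X L a z y + fine (mean_level S) * rate X L a y)%:E.
Proof.
pose P := pker_law (law X) z.
have mS : measurable_fun setT S by exact: measurable_funP.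
pose T (w : W * WS) := tau a (S w.2) w.1.
have LP b : clock_process (fun t (w : W * WS) => L b t w.1).
  apply: clock_process_comp; first exact: measurable_fst.
  exact: (local_time_process_clock HL).
have mT : measurable_fun setT T.
  by apply: (measurable_clock_inv (LP a)); exact: (measurableT_comp mS).
have T0 w : (0 <= T w)%E by exact: tau_ge0.
have mt := measurable_stopped_total (LP y) mT T0.
have t0 w : (0 <= total_local_time (killed_local_time (fun y t (w : W * WS) => L y t w.1) T) y w)%E.
  apply: ereal_sup_ubound; exists 0 => //=; rewrite /killed_local_time.
  rewrite (_ : mine _ _ = 0%E) ?(clock0 (local_time_clock HL y _))//.
  by apply/eqP; rewrite eq_minl.
transitivity (\int[PS]_s \int[law X z]_w
   total_local_time (killed_local_time (fun y t (w : W * WS) => L y t w.1) T) y (w, s))%E.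
  exact: (@fubini_tonelli2 _ _ _ _ R P PS _ mt t0).
have max0 s : (0 <= (Num.max 0 (S s))%:E :> \bar R)%E by rewrite lee_fin le_max lexx.
have mmax : measurable_fun setT (fun s => (Num.max 0 (S s))%:E).
  by apply/measurable_EFinP; apply: measurable_maxr.
transitivity (\int[PS]_s ((hit_green X L a z y)%:E + (rate X L a y)%:E * (Num.max 0 (S s))%:E))%E.
  apply: ae_eq_integral => //.
  - by have := @measurable_fun_fubini_tonelli_G _ _ _ _ R P _ mt t0; apply.
  - by apply: emeasurable_funD => //; apply: emeasurable_funM.
  - apply: filterS (exponential_level_ge0 hS) => s s0 _.
    rewrite max_r// -EFinM mulrC.
    transitivity (mean_time X L (tau a (S s)) z y).
      rewrite -stopped_total_mean//; first exact: stopping_tau.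
      exact: (tau_finite HL recX).
    rewrite (mean_time_tau HL recX)// (mean_time_tauE HL recX)// /hit_green fineK//.
    exact: mean_time_hit_fin_num.
have g0 : 0 <= hit_green X L a z y.
  by apply: fine_ge0; apply: (mean_time_ge0 HL) => w; exact: first_time_ge0.
have r0 : 0 <= rate X L a y by exact: rate_ge0.
rewrite ge0_integralD//; last 2 first.
- by move=> s _; rewrite mule_ge0// lee_fin.
- by apply: emeasurable_funM.
have -> : (\int[PS]_s (hit_green X L a z y)%:E = (hit_green X L a z y)%:E)%E.
  rewrite -[RHS]mule1 -(probability_setT PS).
  exact: (integral_cst PS measurableT (hit_green X L a z y)%:E).
rewrite ge0_integralZl//.
rewrite -/(mean_level S) -[mean_level S]fineK ?(mean_level_fin_num theta0 hS)//.
by rewrite -EFinM -EFinD mulrC.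
Qed.

End killed_green_functions.

(** * Uniqueness of Laplace transforms *)

Section cutoff.
Context {R : realType}.
Implicit Types (c v u : R).

Lemma expr_one_sub_ge u m : 0 <= u <= 1 -> 1 - m%:R * u <= (1 - u) ^+ m.
Proof.
move=> /andP[u0 u1]; elim: m => [|m ih]; first by rewrite mul0r subr0 expr0.
rewrite exprS; apply: (@le_trans _ _ ((1 - u) * (1 - m%:R * u))).
  rewrite -natr1 -subr_ge0.
  have -> : (1 - u) * (1 - m%:R * u) - (1 - (m%:R + 1) * u) = m%:R * u ^+ 2 by ring.
  by rewrite mulr_ge0// sqr_ge0.
by rewrite ler_wpM2l// subr_ge0.
Qed.

Lemma expr_one_sub_le_expR u m : u <= 1 -> (1 - u) ^+ m <= expR (- (m%:R * u)).
Proof.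
move=> u1; rewrite -mulrN expRM_natl lerXn2r ?nnegrE ?subr_ge0 ?expR_ge0//.
exact: expR_ge1Dx.
Qed.

Lemma expRN_le_inv v : 0 < v -> expR (- v) <= 4 / v ^+ 2.
Proof.
move=> v0; rewrite expRN -[leRHS]invf_div lef_pV2 ?posrE ?expR_gt0//; last first.
  by rewrite divr_gt0// exprn_gt0.
rewrite [in leRHS](splitr v) expRD.
have h : v / 2 <= expR (v / 2) by apply: le_trans (expR_ge1Dx _); rewrite lerDr.
have v2 : 0 <= v / 2 by rewrite divr_ge0// ltW.
rewrite (_ : v ^+ 2 / 4 = v / 2 * (v / 2)); last by field.
exact: ler_pM.
Qed.

(* For large n this is a steep step at c, yet it is a polynomial in expR (- v)
   raised to a power, so its integrals are determined by Laplace transforms. *)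
Definition cutoff c n v : R :=
  (1 - expR (- (n.+1%:R * v))) ^+ (n.+1 * (Num.truncn (expR (n.+1%:R * c))).+1).

Lemma cutoff_itv c n v : 0 <= v -> 0 <= cutoff c n v <= 1.
Proof.
move=> v0; have e1 : expR (- (n.+1%:R * v)) <= 1.
  by rewrite -expR0 ler_expR oppr_le0 mulr_ge0.
by rewrite /cutoff exprn_ge0 ?exprn_ile1 ?subr_ge0//= lerBlDr lerDl expR_ge0.
Qed.

(** Write [k] for [n.+1]; the power is of order [k * expR (k * c)]. For [c < v], Bernoulli's
    inequality bounds the distance to 1 by [2 * k * expR (- (k * (v - c)))]. For [v <= c] the value
    is at most [expR (- k)]: the additional factor [k] in the power makes the limit 0 even at
    [v = c]. *)
Lemma cvg_cutoff c v : 0 <= v -> 0 <= c ->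
  cutoff c n v @[n --> \oo] --> ((c < v)%R%:R : R).
Proof.
move=> v0 c0; have h := @cvg_harmonic R.
have e1 n : expR (- (n.+1%:R * v)) <= 1.
  by rewrite -expR0 ler_expR oppr_le0 mulr_ge0.
pose m n := (Num.truncn (expR (n.+1%:R * c))).+1.
have m1 n : expR (n.+1%:R * c) <= (m n)%:R.
  by have /andP[_ /ltW] := truncn_itv (expR_ge0 (n.+1%:R * c)).
have m2 n : (m n)%:R <= 2 * expR (n.+1%:R * c).
  have /andP[a _] := truncn_itv (expR_ge0 (n.+1%:R * c)).
  rewrite /m -natr1 -[2]/(1 + 1 : R) mulrDl mul1r lerD//.
  by rewrite -expR0 ler_expR mulr_ge0.
have [cv|vc] := ltP c v.
- have d0 : 0 < v - c by rewrite subr_gt0.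
  (* The constant 8 is the 2 of [m2] times the 4 of [expRN_le_inv]. *)
  apply: (@squeeze_cvgr _ _ _ _ (fun n => 1 - (8 / (v - c) ^+ 2) * harmonic n) (cst 1)).
  + apply: nearW => n; have /andP[_ ->] := cutoff_itv c n v0; rewrite andbT.
    apply: le_trans (expr_one_sub_ge _ _); last by rewrite expR_ge0 e1.
    rewrite lerD2l lerN2 natrM -mulrA.
    apply: (@le_trans _ _ (n.+1%:R * (2 * expR (n.+1%:R * c) * expR (- (n.+1%:R * v))))).
      by rewrite ler_wpM2l// ler_wpM2r ?expR_ge0// m2.
    rewrite -mulrA -expRD -[X in expR X]opprK opprD opprK.
    have -> : - (n.+1%:R * c) + n.+1%:R * v = n.+1%:R * (v - c) by ring.
    apply: (@le_trans _ _ (n.+1%:R * (2 * (4 / (n.+1%:R * (v - c)) ^+ 2)))).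
      by rewrite !ler_wpM2l// expRN_le_inv// mulr_gt0.
    rewrite le_eqVlt /=; apply/orP; left; apply/eqP; field.
    by rewrite !(lt0r_neq0, gt_eqF) //= pnatr_eq0.
  + rewrite -[X in _ --> X]subr0 -[X in _ --> _ - X](mulr0 (8 / (v - c) ^+ 2)).
    by apply: cvgB; [exact: cvg_cst|apply: cvgM; [exact: cvg_cst|exact: h]].
  + exact: cvg_cst.
- apply: (@squeeze_cvgr _ _ _ _ (cst 0) harmonic) => //; last exact: cvg_cst.
  apply: nearW => n; have /andP[-> _] := cutoff_itv c n v0; rewrite andTb.
  apply: le_trans (expr_one_sub_le_expR _ (e1 n)) _.
  rewrite natrM -mulrA.
  apply: (@le_trans _ _ (expR (- n.+1%:R))).
    rewrite ler_expR lerN2 -[leLHS]mulr1 ler_wpM2l//.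
    apply: (@le_trans _ _ (expR (n.+1%:R * c) * expR (- (n.+1%:R * v)))).
      by rewrite -expRD -expR0 ler_expR -mulrBr mulr_ge0// subr_ge0.
    by rewrite ler_wpM2r ?expR_ge0.
  rewrite expRN lef_pV2 ?posrE ?expR_gt0//.
  by apply: le_trans (expR_ge1Dx _); rewrite lerDr.
Qed.

Lemma measurable_cutoff c n : measurable_fun setT (cutoff c n).
Proof.
apply: measurable_funX; apply: measurable_funB => //.
by apply: measurableT_comp => //; apply: measurableT_comp => //.
Qed.

End cutoff.

Section laplace_unique.
Context {R : realType} {d1 d2} {T1 : measurableType d1} {T2 : measurableType d2}.
Variables (P1 : probability T1 R) (P2 : probability T2 R).

Lemma integrable_itv01 {d} {T : measurableType d} (P : probability T R) (g : T -> R) :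
  measurable_fun setT g -> (forall w, 0 <= g w <= 1) ->
  P.-integrable setT (EFin \o g).
Proof.
move=> mg g01; apply: measurable_bounded_integrable => //.
  by rewrite (le_lt_trans (probability_le1 _ _))// ltry.
exists 1; split=> // M M1 w _; have /andP[g0 g1] := g01 w.
by rewrite /= ger0_norm// (le_trans g1)// ltW.
Qed.

Variables (w1 f1 : T1 -> R) (w2 f2 : T2 -> R).
Hypotheses (mw1 : measurable_fun setT w1) (mw2 : measurable_fun setT w2).
Hypotheses (mf1 : measurable_fun setT f1) (mf2 : measurable_fun setT f2).
Hypotheses (w1_itv : forall w, 0 <= w1 w <= 1) (w2_itv : forall w, 0 <= w2 w <= 1).
Hypotheses (f1_ge0 : forall w, 0 <= f1 w) (f2_ge0 : forall w, 0 <= f2 w).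
Hypothesis laplaceE : forall b, 0 <= b ->
  (\int[P1]_w (w1 w * expR (- (b * f1 w)))%:E =
   \int[P2]_w (w2 w * expR (- (b * f2 w)))%:E)%E.

Let bin (al b v : R) m := expR (- (b * v)) * (1 - expR (- (al * v))) ^+ m.

Let bin_itv al b v m : 0 <= al -> 0 <= b -> 0 <= v -> 0 <= bin al b v m <= 1.
Proof.
move=> al0 b0 v0; have e1 c : 0 <= c -> 0 <= expR (- (c * v)) <= 1.
  by move=> c0; rewrite expR_ge0 -expR0 ler_expR oppr_le0 mulr_ge0.
have /andP[a1 a2] := e1 _ al0; have /andP[b1 b2] := e1 _ b0.
rewrite /bin mulr_ge0 ?exprn_ge0 ?subr_ge0//= mulr_ile1 ?exprn_ge0 ?subr_ge0//.
by rewrite exprn_ile1 ?subr_ge0// lerBlDr lerDl.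
Qed.

Let measurable_bin al b m {d} {T : measurableType d} (f : T -> R) :
  measurable_fun setT f -> measurable_fun setT (fun w => bin al b (f w) m).
Proof.
move=> mf; apply: measurable_funM.
  apply: measurableT_comp => //; apply: measurableT_comp => //.
  by apply: measurable_funM.
apply: measurable_funX; apply: measurable_funB => //.
apply: measurableT_comp => //; apply: measurableT_comp => //.
by apply: measurable_funM.
Qed.

Let int_bin {d} {T : measurableType d} (P : probability T R) (w f : T -> R) al b m :
  measurable_fun setT w -> measurable_fun setT f ->
  (forall x, 0 <= w x <= 1) -> (forall x, 0 <= f x) -> 0 <= al -> 0 <= b ->
  P.-integrable setT (EFin \o (fun x => w x * bin al b (f x) m)).
Proof.
move=> mw mf w01 f0 al0 b0; apply: integrable_itv01.
  by apply: measurable_funM => //; exact: measurable_bin.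
move=> x; have /andP[u0 u1] := bin_itv m al0 b0 (f0 x); have /andP[v0 v1] := w01 x.
by rewrite mulr_ge0//= mulr_ile1.
Qed.

(** Induction on [m] for all [b] at once: one more factor [1 - expR (- (al * v))] is a difference of
    the terms at [b] and at [b + al]. *)
Lemma laplace_binomial al m b : 0 <= al -> 0 <= b ->
  (\int[P1]_w (w1 w * bin al b (f1 w) m)%:E = \int[P2]_w (w2 w * bin al b (f2 w) m)%:E)%E.
Proof.
move=> al0; elim: m b => [|m ih] b b0.
  have E (d : measure_display) (T : measurableType d) (w f : T -> R) :
      (fun x => (w x * bin al b (f x) 0)%:E) = (fun x => (w x * expR (- (b * f x)))%:E).
    by apply/funext => x; rewrite /bin expr0 mulr1.
  by rewrite !E laplaceE.
have E (d : measure_display) (T : measurableType d) (P : probability T R) (w f : T -> R) :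
    measurable_fun setT w -> measurable_fun setT f ->
    (forall x, 0 <= w x <= 1) -> (forall x, 0 <= f x) ->
    (\int[P]_x (w x * bin al b (f x) m.+1)%:E =
     \int[P]_x (w x * bin al b (f x) m)%:E -
     \int[P]_x (w x * bin al (b + al) (f x) m)%:E)%E.
  move=> mw mf w01 f0; rewrite -integralB//.
  - apply: eq_integral => x _; rewrite -EFinB /bin exprS; congr EFin.
    have -> : - ((b + al) * f x) = - (b * f x) + - (al * f x).
      by rewrite mulrDl [LHS]opprD.
    rewrite expRD -mulrBr; congr (_ * _).
    by rewrite mulrBl mul1r mulrBr mulrA.
  - by apply: int_bin.
  - by apply: int_bin => //; rewrite addr_ge0.
rewrite (E _ _ P1 w1 f1)// (E _ _ P2 w2 f2)// ih// (ih (b + al))//.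
exact: addr_ge0.
Qed.

Lemma laplace_unique_gt c :
  (\int[P1]_w (w1 w * (c < f1 w)%R%:R)%:E =
   \int[P2]_w (w2 w * (c < f2 w)%R%:R)%:E)%E.
Proof.
have [c0|c0] := ltP c 0.
  have E (d : measure_display) (T : measurableType d) (w f : T -> R) : (forall x, 0 <= f x) ->
      (fun x => (w x * (c < f x)%R%:R)%:E) = (fun x => (w x * expR (- (0 * f x)))%:E).
    by move=> f0; apply/funext => x; rewrite (lt_le_trans c0 (f0 x)) mul0r oppr0 expR0.
  by rewrite !E// laplaceE.
have C (d : measure_display) (T : measurableType d) (P : probability T R) (w f : T -> R) :
    measurable_fun setT w -> measurable_fun setT f ->
    (forall x, 0 <= w x <= 1) -> (forall x, 0 <= f x) ->
    ((\int[P]_x (w x * cutoff c n (f x))%:E)%E @[n --> \oo] -->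
     (\int[P]_x (w x * (c < f x)%R%:R)%:E)%E).
  move=> mw mf w01 f0.
  have [] // := @dominated_convergence _ T R P setT measurableT
    (fun n x => (w x * cutoff c n (f x))%:E) (fun x => (w x * (c < f x)%R%:R)%:E)
    (cst 1%E).
  - move=> n; apply/measurable_EFinP; apply: measurable_funM => //.
    exact: (measurableT_comp (measurable_cutoff c n)).
  - apply/measurable_EFinP; apply: measurable_funM => //.
    apply: measurableT_comp => //.
    by apply: measurable_fun_ltr.
  - apply: aeW => x _; apply/fine_cvgP; split; first by apply: nearW.
    by apply: cvgM; [exact: cvg_cst|exact: cvg_cutoff].
  - exact: finite_measure_integrable_cst.
  - apply: aeW => x n _; have /andP[u0 u1] := cutoff_itv c n (f0 x).
    have /andP[v0 v1] := w01 x.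
    by rewrite abse_EFin lee_fin ger0_norm ?mulr_ge0// mulr_ile1.
pose k n := (n.+1 * (Num.truncn (expR (n.+1%:R * c))).+1)%N.
have E (d : measure_display) (T : measurableType d) (w f : T -> R) n :
    (fun x => (w x * cutoff c n (f x))%:E) = (fun x => (w x * bin n.+1%:R 0 (f x) (k n))%:E).
  by apply/funext => x; rewrite /bin mul0r oppr0 expR0 mul1r.
have C1 := C _ _ P1 w1 f1 mw1 mf1 w1_itv f1_ge0.
have C2 := C _ _ P2 w2 f2 mw2 mf2 w2_itv f2_ge0.
apply: (@cvg_unique _ (@ereal_hausdorff R) _ _ _ _ C1).
rewrite (_ : (fun n => _) = (fun n => \int[P2]_x (w2 x * cutoff c n (f2 x))%:E)%E)//.
by apply/funext => n; rewrite (E _ _ w1 f1 n) (E _ _ w2 f2 n) laplace_binomial.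
Qed.

End laplace_unique.

(** * Finite families of half-lines in the function space *)

Section rays.
Context {R : realType} {E : Type}.
Implicit Types (t : seq (R * E)).

(** Lists make these sets a pi-system at no cost: concatenation is intersection and the empty list
    is the whole space. *)
Definition ray t : set (functionSpace R E) := [set q | all (fun p => p.1 < q p.2) t].

Lemma measurable_coordinate (x : E) :
  measurable_fun setT (fun q : functionSpace R E => q x).
Proof.
move=> _ B mB; rewrite setTI; apply: sub_sigma_algebra.
by exists x, B.
Qed.

Lemma measurable_functionSpace {d} {T : measurableType d} (Y : E -> T -> R) :
  (forall x, measurable_fun setT (Y x)) ->
  measurable_fun setT ((fun w x => Y x w) : T -> functionSpace R E).
Proof.
move=> mY; apply: (@measurability _ _ T (functionSpace R E) setT _ (coordinate_sets R E)) => //.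
move=> _ [_ [x [B [mB ->]]] <-].
exact: (mY x measurableT B mB).
Qed.

Lemma measurable_ray t : measurable (ray t).
Proof.
elim: t => [|p t ih]; first by rewrite (_ : ray [::] = setT)//; apply/seteqP; split.
rewrite (_ : ray _ = (fun q : functionSpace R E => q p.2) @^-1` `]p.1, +oo[ `&` ray t).
  apply: measurableI => //; rewrite -[X in measurable X]setTI.
  exact: (measurable_coordinate p.2 measurableT (measurable_itv _)).
by apply/seteqP; split => q /=; rewrite in_itv/= andbT => /andP.
Qed.

Lemma measurable_functionSpaceE :
  @measurable _ (functionSpace R E) = <<s range ray >>.
Proof.
apply/seteqP; split.
  apply: smallest_sub; first exact: smallest_sigma_algebra.
  move=> _ [x [B [mB ->]]].
  pose T := g_sigma_algebraType (range ray).
  have mx : measurable_fun setT ((fun q => q x) : T -> R).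
    apply: (measurability (@RGenOInfty.G R)); first exact: RGenOInfty.measurableE.
    move=> _ [_ [r ->] <-]; rewrite setTI; apply: sub_sigma_algebra.
    exists [:: (r, x)] => //.
  by have := mx measurableT B mB; rewrite setTI.
apply: smallest_sub; first exact: sigma_algebra_measurable.
by move=> _ [t _ <-]; exact: measurable_ray.
Qed.

Lemma ray_unique (m1 m2 : {finite_measure set (functionSpace R E) -> \bar R}) :
  (forall t, m1 (ray t) = m2 (ray t)) ->
  forall A, measurable A -> m1 A = m2 A.
Proof.
move=> m12; apply: (measure_unique (range ray) (fun=> ray [::])) => //.
- exact: measurable_functionSpaceE.
- move=> _ _ [s _ <-] [t _ <-]; exists (s ++ t) => //.
  by apply/seteqP; split => q; rewrite /ray/= all_cat => /andP.
- apply/seteqP; split=> // q _; exists 0%N => //.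
- by move=> _ [t _ <-]; exact: m12.
- by move=> _; rewrite -ge0_fin_numE// fin_num_measure//; exact: measurable_ray.
Qed.

End rays.

Section laplace_unique_process.
Context {R : realType} {E : Type} {d1 d2} {T1 : measurableType d1} {T2 : measurableType d2}.
Variables (P1 : probability T1 R) (P2 : probability T2 R).
Variables (Y1 : E -> T1 -> R) (Y2 : E -> T2 -> R).
Hypotheses (mY1 : forall x, measurable_fun setT (Y1 x)) (mY2 : forall x, measurable_fun setT (Y2 x)).
Hypotheses (Y1_ge0 : forall x w, 0 <= Y1 x w) (Y2_ge0 : forall x w, 0 <= Y2 x w).
Hypothesis laplaceE : forall n (al : 'rV[R]_n) (x : 'I_n -> E), (forall i, 0 <= al 0 i) ->
  (\int[P1]_w (expR (- (2^-1 * \sum_i al 0 i * Y1 (x i) w)))%:E =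
   \int[P2]_w (expR (- (2^-1 * \sum_i al 0 i * Y2 (x i) w)))%:E)%E.

Let lap (s : seq (R * E)) {T} (Y : E -> T -> R) w := expR (- \sum_(p <- s) p.1 * Y p.2 w).
Let gts (t : seq (R * E)) {T} (Y : E -> T -> R) w : R := (all (fun p => p.1 < Y p.2 w) t)%:R.

Let measurable_gts t {d} {T : measurableType d} (Y : E -> T -> R) :
  (forall x, measurable_fun setT (Y x)) -> measurable_fun setT (gts t Y).
Proof.
move=> mY; elim: t => [|p t ih]; first exact: measurable_cst.
rewrite (_ : gts _ _ = fun w => (p.1 < Y p.2 w)%R%:R * gts t Y w).
  apply: measurable_funM => //; apply: measurableT_comp => //.
  by apply: measurable_fun_ltr.
by apply/funext => w; rewrite /gts/=; case: (_ < _); rewrite ?mul1r ?mul0r.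
Qed.

Let measurable_lap s {d} {T : measurableType d} (Y : E -> T -> R) :
  (forall x, measurable_fun setT (Y x)) -> measurable_fun setT (lap s Y).
Proof.
move=> mY; apply: measurableT_comp => //; apply: measurableT_comp => //.
by apply: measurable_sum => p; apply: measurable_funM.
Qed.

Let weight_itv s t {T} (Y : E -> T -> R) w : all (fun p => 0 <= p.1) s ->
  (forall x w, 0 <= Y x w) -> 0 <= gts t Y w * lap s Y w <= 1.
Proof.
move=> s0 Y0; rewrite mulr_ge0 ?expR_ge0//=; rewrite mulr_ile1 ?expR_ge0//.
  by rewrite /gts lern1 leq_b1.
rewrite -expR0 ler_expR oppr_le0; elim: s s0 => [|p s ih]/=; first by rewrite big_nil.
by move=> /andP[p0 s0]; rewrite big_cons addr_ge0 ?mulr_ge0// ih.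
Qed.

(** Coordinates are converted one at a time from exponential factors into half-line indicators, the
    other factors forming the weight of the one-dimensional result. The statement is for all [s]
    because the parameter [b] of that result is pushed onto [s] in the induction. *)
Lemma laplace_unique_weights t s : all (fun p => 0 <= p.1) s ->
  (\int[P1]_w (gts t Y1 w * lap s Y1 w)%:E = \int[P2]_w (gts t Y2 w * lap s Y2 w)%:E)%E.
Proof.
elim: t s => [|p t ih] s s0.
  (* The factor 2 cancels the [2^-1] of the transforms in [laplaceE]. *)
  pose al : 'rV[R]_(size s) := \row_i (2 * (tnth (in_tuple s) i).1).
  pose x i := (tnth (in_tuple s) i).2.
  have al0 i : 0 <= al 0 i.
    rewrite mxE mulr_ge0//.
    by have /all_tnthP/(_ i) := s0 : all _ (in_tuple s).
  have E1 (T : Type) (Y : E -> T -> R) : (fun w => (gts [::] Y w * lap s Y w)%:E) =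
      (fun w => (expR (- (2^-1 * \sum_i al 0 i * Y (x i) w)))%:E).
    apply/funext => w; rewrite /gts mul1r /lap; congr (expR (- _))%:E.
    rewrite big_tnth mulr_sumr; apply: eq_bigr => i _; rewrite mxE.
    by rewrite -mulrA mulKf.
  by rewrite (E1 _ Y1) (E1 _ Y2) laplaceE.
have E1 (T : Type) (Y : E -> T -> R) : (fun w => (gts (p :: t) Y w * lap s Y w)%:E) =
    (fun w => (gts t Y w * lap s Y w * (p.1 < Y p.2 w)%R%:R)%:E).
  by apply/funext => w; rewrite /gts/=; case: (_ < _) => /=; rewrite ?mul0r ?mulr0 ?mulr1.
rewrite (E1 _ Y1) (E1 _ Y2).
apply: laplace_unique_gt => //.
- by apply: measurable_funM; [exact: measurable_gts|exact: measurable_lap].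
- by apply: measurable_funM; [exact: measurable_gts|exact: measurable_lap].
- by move=> w; exact: weight_itv.
- by move=> w; exact: weight_itv.
move=> b b0; have := ih ((b, p.2) :: s); rewrite /= b0 => /(_ s0).
have E2 (T : Type) (Y : E -> T -> R) : (fun w => (gts t Y w * lap ((b, p.2) :: s) Y w)%:E) =
    (fun w => (gts t Y w * lap s Y w * expR (- (b * Y p.2 w)))%:E).
  by apply/funext => w; rewrite /lap big_cons opprD expRD mulrA mulrAC.
by rewrite (E2 _ Y1) (E2 _ Y2).
Qed.

Lemma laplace_unique_process (A : set (functionSpace R E)) : measurable A ->
  P1 [set w | A (fun x => Y1 x w)] = P2 [set w | A (fun x => Y2 x w)].
Proof.
move: A; apply: (ray_unique (m1 := image_measure P1 (measurable_functionSpace mY1))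
   (m2 := image_measure P2 (measurable_functionSpace mY2))) => t.
have := laplace_unique_weights t (s := [::]) erefl.
have E1 (d : measure_display) (T : measurableType d) (P : probability T R) (Y : E -> T -> R) :
    (forall x, measurable_fun setT (Y x)) ->
    (\int[P]_w (gts t Y w * lap [::] Y w)%:E = P [set w | ray t (fun x => Y x w)])%E.
  move=> mY; have mS : measurable [set w | ray t (fun x => Y x w)].
    rewrite -[X in measurable X]setTI.
    exact: (measurable_functionSpace mY measurableT (measurable_ray t)).
  rewrite -[X in P X]setIT -integral_indic//; apply: eq_integral => w _.
  rewrite /lap big_nil oppr0 expR0 mulr1 /gts indicE; congr (_ %:R)%:E.
  by congr nat_of_bool; apply/idP/idP => [h|]; rewrite inE.
by rewrite (E1 _ _ P1 Y1 mY1) (E1 _ _ P2 Y2 mY2).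
Qed.

End laplace_unique_process.

(** * The law of the square of a Gaussian variable *)

Section normal_square.
Context {R : realType}.
Implicit Types (m s b : R).
Local Notation mu := (@lebesgue_measure R).

Lemma integral_normal_prob m s (f : R -> R) : measurable_fun setT f ->
  (forall x, 0 <= f x <= 1) ->
  (\int[normal_prob m s]_x (f x)%:E = \int[mu]_x (f x * normal_pdf m s x)%:E)%E.
Proof.
move=> mf f01.
have dom := normal_prob_dominates m s.
rewrite -(Radon_Nikodym_change_of_variables dom)//=; last exact: integrable_itv01.
transitivity (\int[mu]_x ((f x)%:E * (normal_pdf m s x)%:E))%E; last by apply: eq_integral.
have mF : measurable_fun setT (fun x => (f x)%:E) by exact/measurable_EFinP.
have mg : measurable_fun setT (fun x => (normal_pdf m s x)%:E).
  by apply/measurable_EFinP; exact: measurable_normal_pdf.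
apply: ae_eq_integral => //.
- exact: emeasurable_funM.
- exact: (emeasurable_funM mF mg).
- apply: ae_eqe_mul2l => /=.
  rewrite Radon_NikodymE//=.
  case: cid => /= h [h1 h2 h3].
  apply: integral_ae_eq => //=.
  by move=> E E01 mE; rewrite -h3.
Qed.

(** With [q = 1 + b * s ^+ 2], the exponential factor turns the Gaussian density of deviation [s]
    into that of deviation [s / Num.sqrt q], times [(Num.sqrt q)^-1]. *)
Lemma laplace_square_normal s b : 0 < s -> 0 <= b ->
  (\int[normal_prob 0 s]_z (expR (- (2^-1 * (b * z ^+ 2))))%:E =
   ((Num.sqrt (1 + b * s ^+ 2))^-1)%:E)%E.
Proof.
move=> s0 b0.
have mf : measurable_fun setT (fun z : R => expR (- (2^-1 * (b * z ^+ 2)))).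
  apply: measurableT_comp => //; apply: measurableT_comp => //.
  by apply: measurable_funM => //; apply: measurable_funM => //; exact: measurable_funX.
rewrite integral_normal_prob//; last first.
  move=> z; rewrite expR_ge0 -[leRHS]expR0 ler_expR oppr_le0.
  by rewrite /= mulr_ge0// mulr_ge0// sqr_ge0.
set q := 1 + b * s ^+ 2.
have q0 : 0 < q by rewrite ltr_wpDr// mulr_ge0// sqr_ge0.
have sq0 : 0 < Num.sqrt q by rewrite sqrtr_gt0.
have sqE : Num.sqrt q ^+ 2 = q by rewrite sqr_sqrtr// ltW.
pose s' := s / Num.sqrt q.
have s'0 : 0 < s' by rewrite divr_gt0.
have E z : expR (- (2^-1 * (b * z ^+ 2))) * normal_pdf 0 s z =
    (Num.sqrt q)^-1 * normal_pdf 0 s' z.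
  rewrite !normal_pdfE ?gt_eqF//.
  have -> : normal_peak s' = Num.sqrt q * normal_peak s.
    rewrite /normal_peak /s' exprMn exprVn sqE.
    rewrite (_ : s ^+ 2 / q * pi *+ 2 = q^-1 * (s ^+ 2 * pi *+ 2)); last first.
      by rewrite -mulrnAr -mulrA mulrCA mulrnAr.
    by rewrite sqrtrM ?invr_ge0 1?ltW// sqrtrV ?ltW// invfM invrK.
  rewrite -mulrA mulrA mulVf ?gt_eqF// mul1r mulrCA; congr (_ * _).
  rewrite /normal_fun -expRD /s' exprMn exprVn sqE; congr expR.
  rewrite /q; field.
  by rewrite !gt_eqF//.
transitivity (\int[mu]_z (((Num.sqrt q)^-1)%:E * (normal_pdf 0 s' z)%:E))%E.
  by apply: eq_integral => z _; rewrite E.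
rewrite ge0_integralZl ?integral_normal_pdf ?mule1//.
- by apply/measurable_EFinP; exact: measurable_normal_pdf.
- by move=> z _; rewrite lee_fin normal_pdf_ge0.
Qed.

Lemma normal_prob_itv_gt0 s (u v : R) : 0 < s -> u < v ->
  (0 < normal_prob 0%R s `]u, v[%classic)%E.
Proof.
move=> s0 uv; rewrite lt0e measure_ge0 andbT; apply/eqP => n0.
have mp : measurable_fun `]u, v[ (fun x => (normal_pdf 0 s x)%:E).
  by apply/measurable_EFinP/measurable_funTS; exact: measurable_normal_pdf.
have : ae_eq mu `]u, v[%classic (fun x => (normal_pdf 0 s x)%:E) (cst 0%E).
  apply/(ae_eq_integral_abs mu (measurable_itv _) mp).
  rewrite -[RHS]n0; apply: eq_integral => x _.
  by rewrite gee0_abs// lee_fin normal_pdf_ge0.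
move=> [N [mN N0 sN]].
have : (mu `]u, v[%classic <= mu N)%E.
  apply: le_measure; rewrite ?inE//; apply: subset_trans sN => x xuv /= /(_ xuv).
  apply/eqP; rewrite eqe gt_eqF//.
  rewrite normal_pdfE ?gt_eqF// mulr_gt0 ?expR_gt0//.
  by rewrite normal_peak_gt0// gt_eqF.
by rewrite N0 lebesgue_measure_itv/= lte_fin uv -EFinB lee_fin subr_le0 leNgt uv.
Qed.

Lemma square_law_itv_gt0 {d} {T : measurableType d} (P : probability T R) (Z : T -> R)
    (m : R) : 0 < m -> measurable_fun setT Z -> (forall w, 0 <= Z w) ->
  (forall b, 0 <= b ->
    (\int[P]_w (expR (- (2^-1 * (b * Z w))))%:E = ((Num.sqrt (1 + b * m))^-1)%:E)%E) ->
  forall u v : R, 0 <= u -> u < v -> (0 < P [set w | (u < Z w < v)%R])%E.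
Proof.
move=> m0 mZ Z0 lapZ u v u0 uv.
pose s := Num.sqrt m; have s0 : 0 < s by rewrite sqrtr_gt0.
have sE : s ^+ 2 = m by rewrite sqr_sqrtr// ltW.
pose Q := normal_prob 0 s.
(* A single variable is a process indexed by [unit], to which uniqueness for processes applies. *)
pose Y1 (_ : unit) := Z; pose Y2 (_ : unit) (z : R) := z ^+ 2.
pose A := [set q : functionSpace R unit | u < q tt < v].
have mA : measurable A.
  have := measurable_coordinate (R := R) tt measurableT (measurable_itv `]u, v[).
  by rewrite setTI; congr measurable; apply/seteqP; split => q; rewrite /= in_itv.
have -> : [set w | u < Z w < v] = [set w | A (fun x => Y1 x w)] by [].
rewrite (laplace_unique_process (P2 := Q) (Y2 := Y2))//.
- apply: (@lt_le_trans _ _ (Q `]Num.sqrt u, Num.sqrt v[%classic)).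
    by apply: normal_prob_itv_gt0 => //; rewrite ltr_sqrt// (le_lt_trans u0).
  apply: le_measure; rewrite ?inE//.
    rewrite -[X in measurable X]setTI.
    have mY : forall x, measurable_fun setT (Y2 x).
      by move=> x; exact: measurable_funX.
    exact: (measurable_functionSpace mY measurableT mA).
  move=> z; rewrite /A/= in_itv/= => /andP[uz zv].
  have z0 : 0 <= z by rewrite (le_trans (sqrtr_ge0 _) (ltW uz)).
  rewrite /Y2; apply/andP; split.
    by rewrite -(sqr_sqrtr u0) ltr_pXn2r// nnegrE sqrtr_ge0.
  rewrite -[ltRHS](sqr_sqrtr (ltW (le_lt_trans u0 uv))).
  by rewrite ltr_pXn2r// nnegrE sqrtr_ge0.
- by move=> x; exact: measurable_funX.
- by move=> x z; rewrite sqr_ge0.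
- move=> n al x al0.
  have b0 : 0 <= \sum_i al 0 i by apply: sumr_ge0.
  under eq_integral do rewrite /Y1 -mulr_suml.
  under [in RHS]eq_integral do rewrite /Y2 -mulr_suml.
  by rewrite lapZ// laplace_square_normal// sE.
Qed.

End normal_square.

(** * Uniqueness of the conditional laws *)

Section levels.
Context {R : realType} {d} {T : measurableType d}.
Implicit Types (P : probability T R) (f : T -> R).

Lemma sum_le_truncn (m : nat) (v : R) : 0 <= v <= m%:R ->
  \sum_(j < m) ((j.+1%:R <= v)%R%:R : R) = (Num.truncn v)%:R.
Proof.
move=> /andP[v0 vm].
have tm : (Num.truncn v <= m)%N.
  by rewrite -(ler_nat R) (le_trans _ vm)//; have /andP[] := truncn_itv v0.
rewrite -natr_sum; congr (_ %:R).
under eq_bigr => j _ do rewrite -truncn_ge_nat//.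
have sumE k (n : nat) : (\sum_(j < n) (j < k)%N)%N = minn n k.
  elim: n => [|n ih]; first by rewrite big_ord0 min0n.
  rewrite big_ord_recr/= ih; case: (ltnP n k) => nk /=.
    by rewrite addn1 (minn_idPl nk).
  by rewrite addn0 (minn_idPr (leqW nk)).
by rewrite sumE; apply/minn_idPr.
Qed.

(** Countably many events determine the integral. This matters because two conditional laws agree on
    a given event only for almost every [r], and the exceptional sets have to be united. The
    function is approximated within [m.+1%:R^-1] by [truncn (m.+1%:R * f) / m.+1%:R]. *)
Lemma integral_eq_levels P1 P2 f : measurable_fun setT f ->
  (forall w, 0 <= f w <= 1) ->
  (forall m j : nat, P1 [set w | j%:R <= m%:R * f w] = P2 [set w | j%:R <= m%:R * f w]) ->
  (\int[P1]_w (f w)%:E = \int[P2]_w (f w)%:E)%E.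
Proof.
move=> mf f01 P12.
pose lev (m j : nat) := [set w | j%:R <= m%:R * f w].
have mlev (m j : nat) : measurable (lev m j).
  have mmf : measurable_fun setT (fun w => m%:R * f w) by exact: measurable_funM.
  have := mmf measurableT _ (measurable_itv `[j%:R, +oo[); rewrite setTI.
  by congr measurable; apply/seteqP; split => w; rewrite /= in_itv/= andbT.
pose h (m : nat) w := m.+1%:R^-1 * (Num.truncn (m.+1%:R * f w))%:R : R.
have hE m w : h m w = m.+1%:R^-1 * \sum_(j < m.+1) \1_(lev m.+1 j.+1) w.
  rewrite /h -(@sum_le_truncn m.+1); last first.
    by have /andP[f0 f1] := f01 w; rewrite mulr_ge0//= ler_piMr.
  congr (_ * _); apply: eq_bigr => j _; rewrite indicE; congr (nat_of_bool _)%:R.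
  by apply/idP/idP => [?|]; rewrite inE.
have h0 m w : 0 <= h m w by rewrite mulr_ge0.
have mh m : measurable_fun setT (h m).
  rewrite (_ : h m = fun w => m.+1%:R^-1 * \sum_(j < m.+1) \1_(lev m.+1 j.+1) w).
    apply: measurable_funM => //; apply: measurable_sum => j.
    by apply: measurable_indic.
  by apply/funext => w; exact: hE.
have hf m w : h m w <= f w <= h m w + m.+1%:R^-1.
  have mf0 : 0 <= m.+1%:R * f w by have /andP[f0 f1] := f01 w; rewrite mulr_ge0.
  have /andP[t1 t2] := truncn_itv mf0.
  rewrite /h -[X in _ <= _ + X]mulr1 -mulrDr !(mulrC m.+1%:R^-1).
  rewrite ler_pdivrMr ?ltr0n// ler_pdivlMr ?ltr0n// ![f w * _]mulrC t1/=.
  by rewrite natr1 ltW.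
have ih P m : (\int[P]_w (h m w)%:E = (m.+1%:R^-1)%:E *
    \sum_(j < m.+1) P (lev m.+1 j.+1))%E.
  transitivity (\int[P]_w ((m.+1%:R^-1)%:E *
      \sum_(j < m.+1) (\1_(lev m.+1 j.+1) w)%:E))%E.
    by apply: eq_integral => w _; rewrite hE EFinM sumEFin.
  rewrite ge0_integralZl//; last 2 first.
  - by apply: emeasurable_sum => j; apply/measurable_EFinP/measurable_indic.
  - by move=> w _; apply: sume_ge0 => j _; rewrite lee_fin indicE.
  congr (_ * _)%E; rewrite ge0_integral_sum//; last first.
    by move=> j; apply/measurable_EFinP/measurable_indic.
  by apply: eq_bigr => j _; rewrite integral_indic// setIT.
have half P P' : (forall m j : nat, P (lev m j) = P' (lev m j)) ->
    (\int[P]_w (f w)%:E <= \int[P']_w (f w)%:E)%E.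
  move=> PP'; apply/lee_addgt0Pr => e e0.
  have [m me] : exists m : nat, m.+1%:R^-1 < e.
    exists (Num.truncn e^-1); rewrite -[X in _ < X]invrK ltf_pV2 ?posrE ?invr_gt0//.
    have e10 : 0 <= e^-1 by rewrite invr_ge0 ltW.
    by have /andP[] := truncn_itv e10.
  apply: (@le_trans _ _ (\int[P]_w ((h m w)%:E + (m.+1%:R^-1)%:E))%E).
    apply: ge0_le_integral => //.
    - by move=> w _; rewrite lee_fin; have /andP[] := f01 w.
    - exact/measurable_EFinP.
    - by apply: emeasurable_funD => //; exact/measurable_EFinP.
    - by move=> w _; rewrite -EFinD lee_fin; have /andP[] := hf m w.
  rewrite ge0_integralD//; last 2 first.
  - by move=> w _; rewrite lee_fin.
  - exact/measurable_EFinP.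
  apply: leeD; last first.
    have -> : (\int[P]_w (m.+1%:R^-1)%:E = (m.+1%:R^-1)%:E)%E.
      rewrite -[RHS]mule1 -(probability_setT P).
      exact: (integral_cst P measurableT (m.+1%:R^-1)%:E).
    by rewrite lee_fin ltW.
  rewrite ih (eq_bigr (fun j : 'I_m.+1 => P' (lev m.+1 j.+1))) ?PP'//.
  rewrite -ih; apply: ge0_le_integral => //.
  - by move=> w _; rewrite lee_fin.
  - exact/measurable_EFinP.
  - exact/measurable_EFinP.
  - by move=> w _; rewrite lee_fin; have /andP[] := hf m w.
by apply/eqP; rewrite eq_le !half// => m j; rewrite P12.
Qed.

End levels.

Lemma continuous_prod {R : realType} {T : topologicalType} (I : Type) (s : seq I)
    (f : I -> T -> R) :
  (forall i, continuous (f i)) -> continuous (fun v => \prod_(i <- s) f i v).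
Proof.
move=> cf v; elim: s => [|i s ih].
  rewrite (_ : (fun _ => _) = cst 1); first exact: cst_continuous.
  by apply/funext => w; rewrite big_nil.
rewrite (_ : (fun _ => _) = (fun w => f i w * \prod_(j <- s) f j w)); last first.
  by apply/funext => w; rewrite big_cons.
by apply: cvgM => //; exact: cf.
Qed.

Section ramp.
Context {R : realType}.
Implicit Types (v : R) (k : nat).

(** As [v + |v|] is twice the positive part of [v], these are continuous approximations from below
    of the indicator of [0 < v]; continuity of conditional laws in [r] is only known against
    continuous functions. *)
Definition ramp k v : R := 1 - expR (- (k.+1%:R * (v + `|v|))).

Lemma ramp_le0 k v : v <= 0 -> ramp k v = 0.
Proof. by move=> v0; rewrite /ramp ler0_norm// subrr mulr0 oppr0 expR0 subrr. Qed.

Lemma ramp_itv k v : 0 <= ramp k v <= 1.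
Proof.
have v0 : 0 <= v + `|v| by rewrite -lerBlDl sub0r -normrN ler_norm.
by rewrite /ramp subr_ge0 -[X in _ <= X]expR0 ler_expR oppr_le0 mulr_ge0//= lerBlDr lerDl expR_ge0.
Qed.

Lemma continuous_ramp k : continuous (ramp k).
Proof.
move=> v; apply: cvgB; first exact: cvg_cst.
apply: continuous_cvg; first exact: continuous_expR.
apply: cvgN; apply: cvgM; first exact: cvg_cst.
by apply: cvgD; [exact: cvg_id|exact: norm_continuous].
Qed.

Lemma continuous_ramp_sub {T : topologicalType} (f : T -> R) k (c : R) :
  continuous f -> continuous (fun y => ramp k (f y - c)).
Proof.
move=> cf y; apply: continuous_cvg; first exact: continuous_ramp.
by apply: cvgB; [exact: cf|exact: cvg_cst].
Qed.

Lemma cvg_ramp v : ramp k v @[k --> \oo] --> ((0 < v)%R%:R : R).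
Proof.
have [v0|v0] := ltP 0 v; last first.
  rewrite (_ : (fun k => _) = cst 0); first exact: cvg_cst.
  by apply/funext => k; rewrite ramp_le0.
apply: (@squeeze_cvgr _ _ _ _ (fun k => 1 - v^-1 * harmonic k) (cst 1)).
- apply: nearW => k; have /andP[_ ->] := ramp_itv k v; rewrite andbT.
  rewrite /ramp lerD2l lerN2 /= -invfM expRN lef_pV2 ?posrE ?expR_gt0 ?mulr_gt0//.
  apply: le_trans (expR_ge1Dx _); rewrite ger0_norm ?ltW//.
  have : 0 <= v * k.+1%:R by rewrite mulr_ge0// ltW.
  by lra.
- rewrite -[X in _ --> X]subr0 -[X in _ --> _ - X](mulr0 v^-1).
  by apply: cvgB; [exact: cvg_cst|apply: cvgM; [exact: cvg_cst|exact: cvg_harmonic]].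
- exact: cvg_cst.
Qed.

Lemma measurable_ramp k : measurable_fun setT (ramp k).
Proof. by apply: continuous_measurable_fun; exact: continuous_ramp. Qed.

End ramp.

Section conditional_law_unique.
Context {R : realType} {E : Type} {d} {W : measurableType d}.
Variables (P : probability W R) (psi : E -> {RV P >-> R}) (a : E).
Implicit Types (kappa : R.-pker R ~> functionSpace R E) (t : seq (R * E)).
Hypothesis charge : forall u v : R, 0 <= u -> u < v ->
  (0 < P [set w | (u < psi a w < v)%R])%E.
Local Notation D := (distribution P (psi a)).

Lemma conditional_law_ae kappa1 kappa2 (A : set (functionSpace R E)) :
  conditional_law psi a kappa1 -> conditional_law psi a kappa2 ->
  measurable A -> {ae D, forall r, kappa1 r A = kappa2 r A}.
Proof.
move=> [dis1 _] [dis2 _] mA.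
have h : ae_eq D setT (kappa1 ^~ A) (kappa2 ^~ A).
  apply: integral_ae_eq => //.
  - apply/integrableP; split; first exact: measurable_kernel.
    apply: (@le_lt_trans _ _ (\int[D]_r cst 1%E r)%E).
      apply: ge0_le_integral => //.
      + by apply: measurableT_comp => //; exact: measurable_kernel.
      + move=> r _; rewrite gee0_abs//.
        exact: (@probability_le1 _ _ _ (pker_law kappa1 r)).
    by rewrite integral_cst// mul1e (le_lt_trans (probability_le1 _ _))// ltry.
  - exact: measurable_kernel.
  - by move=> B _ mB; rewrite -dis1// -dis2.
by apply: filterS h => r /(_ I).
Qed.

Lemma conditional_law_integral_ae kappa1 kappa2 (f : functionSpace R E -> R) :
  conditional_law psi a kappa1 -> conditional_law psi a kappa2 ->
  measurable_fun setT f -> (forall q, 0 <= f q <= 1) ->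
  {ae D, forall r, (\int[kappa1 r]_q (f q)%:E = \int[kappa2 r]_q (f q)%:E)%E}.
Proof.
move=> h1 h2 mf f01.
have mlev (m j : nat) : measurable [set q | j%:R <= m%:R * f q].
  have mmf : measurable_fun setT (fun w => m%:R * f w) by exact: measurable_funM.
  have := mmf measurableT _ (measurable_itv `[j%:R, +oo[); rewrite setTI.
  by congr measurable; apply/seteqP; split => w; rewrite /= in_itv/= andbT.
have : {ae D, forall r, forall m j : nat,
    kappa1 r [set q | j%:R <= m%:R * f q] = kappa2 r [set q | j%:R <= m%:R * f q]}.
  apply/ae_foralln => m; apply/ae_foralln => j.
  exact: conditional_law_ae.
apply: filterS => r h.
exact: (@integral_eq_levels _ _ _ (pker_law kappa1 r) (pker_law kappa2 r)).
Qed.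

Let test k n (c : 'I_n -> R) (v : 'rV[R]_n) := \prod_i ramp k (v 0 i - c i).

Let test_itv k n (c : 'I_n -> R) v : 0 <= test k c v <= 1.
Proof.
apply/andP; split; first by apply: prodr_ge0 => i _; have /andP[] := ramp_itv k (v 0 i - c i).
by apply: prodr_ile1 => i _; exact: ramp_itv.
Qed.

Let continuous_test k n (c : 'I_n -> R) : continuous (test k c).
Proof.
apply: continuous_prod => i.
by apply: (continuous_ramp_sub (f := fun w : 'rV[R]_n => w 0 i)); exact: coord_continuous.
Qed.

Let measurable_test k n (c : 'I_n -> R) (x : 'I_n -> E) :
  measurable_fun setT (fun q : functionSpace R E => test k c (\row_i q (x i))).
Proof.
apply: measurable_prod => i _; apply: measurableT_comp; first exact: measurable_ramp.
rewrite (_ : (fun q => _) = (fun q : functionSpace R E => q (x i) - c i)); last first.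
  by apply/funext => q; rewrite mxE.
by apply: measurable_funB => //; exact: measurable_coordinate.
Qed.

Let right_limit kappa n (x : 'I_n -> E) (f : 'rV[R]_n -> R) (r : R) :
  conditional_law psi a kappa -> continuous f -> (forall v, 0 <= f v <= 1) -> 0 <= r ->
  \int[kappa s]_q f (\row_i q (x i)) @[s --> r^'+] --> \int[kappa r]_q f (\row_i q (x i)).
Proof.
move=> [_ cts] cf f01 r0.
have fM : exists M, forall v, `|f v| <= M.
  by exists 1 => v; have /andP[u0 u1] := f01 v; rewrite ger0_norm.
have h := cts n x f cf fM.
have sub : `[r, +oo[%classic `<=` `[0, +oo[%classic.
  by move=> s /=; rewrite !in_itv/= !andbT; exact: le_trans.
by have /continuous_within_itvcyP[_] := continuous_subspaceW sub h.
Qed.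

(** If the two integrals differed at [r], right continuity would make them differ on some []r, r +
    e[], which [psi a] charges although the integrals agree almost everywhere. Right limits treat
    [r = 0] like any other level. *)
Lemma conditional_law_test kappa1 kappa2 k n (c : 'I_n -> R) (x : 'I_n -> E) (r : R) :
  conditional_law psi a kappa1 -> conditional_law psi a kappa2 -> 0 <= r ->
  \int[kappa1 r]_q test k c (\row_i q (x i)) = \int[kappa2 r]_q test k c (\row_i q (x i)).
Proof.
move=> h1 h2 r0; apply/eqP/negP => /negP ne.
have c1 := right_limit (x := x) h1 (@continuous_test k n c) (test_itv k c) r0.
have c2 := right_limit (x := x) h2 (@continuous_test k n c) (test_itv k c) r0.
have c12 := cvgB c1 c2; rewrite -subr_eq0 in ne.
have [e /= e0 he] := cvgr_neq0 _ (c12 _) ne.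
have [N [mN N0 sN]] := conditional_law_integral_ae h1 h2 (measurable_test k c x)
  (fun q => test_itv k c _).
have := charge r0 (ltr_pwDr e0 (lexx r)); apply/negP; rewrite -leNgt -N0.
apply: le_measure; rewrite ?inE//.
  have := @measurable_funPTI _ _ _ _ (psi a) _ (measurable_itv `]r, (r + e)[).
  by congr measurable; apply/seteqP; split => w; rewrite /= in_itv.
  exact: measurable_funPTI.
move=> w /= /andP[rw we]; apply: sN => /= hw.
have hd : ball r e (psi a w).
  by rewrite /ball/= ltr_distlC we andbT (lt_trans _ rw)// ltrBlDr ltrDl.
have /negP := he _ hd rw; apply; apply/eqP.
change (\int[kappa1 (psi a w)]_q test k c (\row_i q (x i)) -
  \int[kappa2 (psi a w)]_q test k c (\row_i q (x i)) = 0).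
by rewrite /Rintegral hw subrr.
Qed.

(** Products of ramps tend to the indicator of a [ray], and rays determine a finite measure. *)
Lemma conditional_law_unique kappa1 kappa2 (r : R) (A : set (functionSpace R E)) :
  conditional_law psi a kappa1 -> conditional_law psi a kappa2 -> 0 <= r ->
  measurable A -> kappa1 r A = kappa2 r A.
Proof.
move=> h1 h2 r0; move: A.
apply: (@ray_unique _ _ (pker_law kappa1 r) (pker_law kappa2 r)) => t.
pose c i := (tnth (in_tuple t) i).1; pose x i := (tnth (in_tuple t) i).2.
have key kappa : conditional_law psi a kappa ->
    ((\int[kappa r]_q (test k c (\row_i q (x i)))%:E)%E @[k --> \oo] --> kappa r (ray t)).
  move=> h; pose K := pker_law kappa r.
  have -> : kappa r (ray t) = (\int[K]_q (\1_(ray t) q)%:E)%E.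
    by rewrite integral_indic ?setIT//; exact: measurable_ray.
  have [] // := @dominated_convergence _ _ R K setT measurableT
    (fun k q => (test k c (\row_i q (x i)))%:E) (fun q => (\1_(ray t) q)%:E) (cst 1%E).
  - by move=> k; apply/measurable_EFinP; exact: measurable_test.
  - by apply/measurable_EFinP/measurable_indic; exact: measurable_ray.
  - apply: aeW => q _; apply/fine_cvgP; split; first by apply: nearW.
    rewrite (_ : \1_(ray t) q = \prod_(p <- t) (0 < q p.2 - p.1)%R%:R); last first.
      rewrite indicE /ray; have -> : (q \in [set q0 | all (fun p => p.1 < q0 p.2) t]) =
          all (fun p => p.1 < q p.2) t.
        by apply/idP/idP => [|?]; rewrite inE.
      elim: (t) => [|p s ih] /=; first by rewrite big_nil.
      by rewrite big_cons -ih subr_gt0; case: (_ < _); rewrite ?mul1r ?mul0r.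
    rewrite (_ : fine \o _ = (fun k => \prod_(p <- t) ramp k (q p.2 - p.1))); last first.
      apply/funext => k /=; rewrite /test [RHS]big_tnth.
      by apply: eq_bigr => i _; rewrite mxE.
    elim: (t) => [|p s ih].
      rewrite (_ : (fun k => _) = cst 1); first by rewrite big_nil; exact: cvg_cst.
      by apply/funext => k; rewrite big_nil.
    rewrite (_ : (fun k => _) = (fun k => ramp k (q p.2 - p.1) *
        \prod_(p <- s) ramp k (q p.2 - p.1))); last first.
      by apply/funext => k; rewrite big_cons.
    by rewrite big_cons; apply: cvgM => //; exact: cvg_ramp.
  - exact: finite_measure_integrable_cst.
  - apply: aeW => q k _; have /andP[u0 u1] := test_itv k c (\row_i q (x i)).
    by rewrite abse_EFin lee_fin ger0_norm.
have fin kappa k : (\int[kappa r]_q (test k c (\row_i q (x i)))%:E)%E \is a fin_num.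
  apply: (@integrable_fin_num _ _ _ (pker_law kappa r)) => //.
  by apply: integrable_itv01; [exact: measurable_test|move=> q; exact: test_itv].
have E12 : (fun k => \int[kappa1 r]_q (test k c (\row_i q (x i)))%:E)%E =
    (fun k => \int[kappa2 r]_q (test k c (\row_i q (x i)))%:E)%E.
  apply/funext => k; rewrite -[LHS]fineK// -[RHS]fineK//; congr EFin.
  exact: conditional_law_test.
have k1 := key _ h1; have k2 := key _ h2; rewrite E12 in k1.
exact: (@cvg_unique _ (@ereal_hausdorff R) _ _ _ _ k1 k2).
Qed.

End conditional_law_unique.

(** * Continuity of local times in the level *)

Section level_continuity.
Context {R : realType} {dE} {E : measTopologicalType dE}
  {d} {W : measurableType d}.
Variables (X : markov_process R E W) (L : E -> R -> W -> R).
Hypotheses (HL : local_time_process X L) (recX : recurrent X).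
Notation tau := (inverse_local_time L).

(** Integer levels suffice for a common null set, since the inverse is monotone in the level. *)
Lemma tau_finite_all z y : {ae law X z, forall w, forall r, (tau y r w < +oo)%E}.
Proof.
have : {ae law X z, forall w, forall n : nat, (tau y n%:R w < +oo)%E}.
  by apply/ae_foralln => n; exact: (tau_finite HL recX).
apply: filterS => w h r; apply: le_lt_trans (h (Num.truncn `|r|).+1).
have /andP[_ /ltW t] := truncn_itv (normr_ge0 r).
by apply: tau_homo; exact: le_trans (ler_norm r) t.
Qed.

Lemma local_time_ge0 y t w : 0 <= t -> 0 <= L y t w.
Proof.
by move=> t0; rewrite -(local_time_start HL y w); exact: local_time_nondecreasing HL _ _ _ _ _ _.
Qed.

Lemma local_time_tau_ge0 y a r w : 0 <= L y (fine (tau a r w)) w.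
Proof. by apply: local_time_ge0; apply: fine_ge0; exact: tau_ge0. Qed.

Lemma local_time_tau_homo y a w r s : (tau a s w < +oo)%E -> r <= s ->
  L y (fine (tau a r w)) w <= L y (fine (tau a s w)) w.
Proof.
move=> soo rs; have le_tau := tau_homo L a w rs.
have roo : (tau a r w < +oo)%E by exact: le_lt_trans le_tau soo.
apply: local_time_nondecreasing HL _ _ _ _ _ _; first by apply: fine_ge0; exact: tau_ge0.
by apply: fine_le => //; exact: first_time_fin.
Qed.

Lemma measurable_local_time_tau y a r :
  measurable_fun setT (fun w => L y (fine (tau a r w)) w).
Proof. by apply: (measurable_local_time_at HL); exact: stopping_tau. Qed.

(* The expected increment of the local time at y between the levels p <= q of
   the local time at a is (q - p) * rate y, so there is no jump at a fixed level. *)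
Lemma local_time_tau_cvg y a (s : R) : 0 <= s -> {ae law X a, forall w, forall u : nat -> R,
  (forall n, 0 <= u n) -> u n @[n --> \oo] --> s ->
  L y (fine (tau a (u n) w)) w @[n --> \oo] --> L y (fine (tau a s w)) w}.
Proof.
move=> s0; pose P := pker_law (law X) a.
pose G r w := L y (fine (tau a r w)) w.
have mG r : measurable_fun setT (G r) by exact: measurable_local_time_tau.
have G0 r w : 0 <= G r w by exact: local_time_tau_ge0.
pose p n := Num.max 0 (s - n.+1%:R^-1); pose q n := s + n.+1%:R^-1.
have p0 n : 0 <= p n by rewrite le_max lexx.
have pq n : p n <= q n.
  rewrite ge_max; apply/andP; split; first by rewrite addr_ge0.
  by rewrite lerD2l (@le_trans _ _ 0)// oppr_le0.
pose h n w := `|G (q n) w - G (p n) w|%:E.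
have mh n : measurable_fun setT (h n).
  by apply/measurable_EFinP; apply: measurableT_comp => //; exact: measurable_funB.
have h0 n w : (0 <= h n w)%E by rewrite lee_fin.
have ih n : (\int[P]_w h n w <= ((2 * rate X L a y) * n.+1%:R^-1)%:E)%E.
  have mean r : 0 <= r -> (\int[P]_w (G r w)%:E = (r * rate X L a y)%:E)%E.
    by move=> r0; exact: (mean_time_tauE HL recX).
  have E1 : ((q n * rate X L a y)%:E = (p n * rate X L a y)%:E + \int[P]_w h n w)%E.
    rewrite -!mean//; last by rewrite (le_trans (p0 n)).
    rewrite -ge0_integralD//; last 2 first.
    - by move=> w _; rewrite lee_fin.
    - exact/measurable_EFinP.
    apply: ae_eq_integral => //.
    - exact/measurable_EFinP.
    - by apply: emeasurable_funD => //; exact/measurable_EFinP.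
    - apply: filterS (tau_finite_all a a) => w fw _.
      have := local_time_tau_homo y (fw (q n)) (pq n); rewrite -subr_ge0 => /ger0_norm.
      by rewrite /h -/(G _ _) -/(G _ _) => ->; rewrite -EFinD addrC subrK.
  have fh : (\int[P]_w h n w)%E \is a fin_num.
    rewrite ge0_fin_numE ?integral_ge0//; move: E1; case: (\int[P]_w h n w)%E => // r.
    by rewrite ltry.
  rewrite -(fineK fh) lee_fin; move: E1; rewrite -(fineK fh) -EFinD => -[E1].
  have -> : fine (\int[P]_w h n w)%E = (q n - p n) * rate X L a y.
    by rewrite mulrBl E1 [RHS]addrC addKr.
  rewrite mulrAC ler_wpM2r//; first exact: rate_ge0.
  have : s - n.+1%:R^-1 <= p n by rewrite le_max lexx orbT.
  by rewrite /q; move: (p n) (n.+1%:R^-1) => z e; lra.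
(* An infimum over [n] is enough: the local time is monotone in the level, so one bracket around [s]
   with a small increment controls all nearby levels. Its mean is 0, being below every [ih n]. *)
pose J w := einfs (h ^~ w) 0.
have J0 w : (0 <= J w)%E by apply: le_ereal_inf_tmp => _ [n _ <-].
have mJ : measurable_fun setT J by apply: (measurable_fun_einfs mh).
have hJ n w : (J w <= h n w)%E by apply: ereal_inf_lbound; exists n.
have iJ : (\int[P]_w J w = 0)%E.
  apply/eqP; rewrite eq_le integral_ge0// andbT.
  have c : ((2 * rate X L a y * n.+1%:R^-1)%:E @[n --> \oo] --> 0)%E.
    apply/fine_cvgP; split; first exact: nearW.
    rewrite -[X in _ --> X](mulr0 (2 * rate X L a y)).
    by apply: cvgM; [exact: cvg_cst|exact: cvg_harmonic].
  rewrite -[leRHS](cvg_lim _ c)//; apply: lime_ge; first by apply/cvg_ex; exists 0%E.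
  apply: nearW => n; apply: le_trans (ih n).
  by apply: ge0_le_integral => // w _.
have J_ae : ae_eq P setT J (cst 0%E).
  apply/(ae_eq_integral_abs P measurableT mJ); rewrite -[RHS]iJ.
  by apply: eq_integral => w _; rewrite gee0_abs.
apply: filterS2 J_ae (tau_finite_all a a) => w /(_ I) Jw fw u u0 us.
apply/cvgrPdist_lt => e e0.
have Je : (J w < e%:E)%E by rewrite Jw lte_fin.
have [_ [n _ <-]] := ereal_inf_lt Je.
rewrite /h lte_fin => he.
have n0 : 0 < n.+1%:R^-1 :> R by rewrite invr_gt0.
near=> k.
have : `|s - u k| < n.+1%:R^-1 by near: k; move/cvgrPdist_lt: us; exact.
rewrite ltr_distlC => /andP[k1 k2].
have leG r1 r2 : r1 <= r2 -> G r1 w <= G r2 w by move=> ?; exact: local_time_tau_homo.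
have pu : G (p n) w <= G (u k) w by apply: leG; rewrite ge_max u0 ltW.
have uq : G (u k) w <= G (q n) w by apply: leG; rewrite ltW.
have ps : G (p n) w <= G s w by apply: leG; rewrite ge_max s0 lerBlDr lerDl ltW.
have sq : G s w <= G (q n) w by apply: leG; rewrite lerDl ltW.
apply: le_lt_trans he; rewrite -/(G _ _) -/(G _ _).
rewrite [leRHS]ger0_norm ?subr_ge0 ?(le_trans pu)//.
by rewrite ler_norml; apply/andP; split; lra.
Unshelve. all: by end_near.
Qed.

End level_continuity.

(** * The candidate for the conditional law *)

Section field.
Context {R : realType} {dE} {E : measTopologicalType dE}
  {d} {W : measurableType d}.
Variables (X : markov_process R E W) (L : E -> R -> W -> R).
Hypotheses (HL : local_time_process X L) (recX : recurrent X).
Variable a : E.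
Context {dphi} {Wphi : measurableType dphi} (Pphi : probability Wphi R).
Variable phi : E -> {RV Pphi >-> R}.
Notation tau := (inverse_local_time L).

(** The half compensates the factor 2 in [field], so that the field equals [r] at [a]. The
    truncation extends the kernel continuously to negative [r], which [psi a] never takes. *)
Definition level (r : R) : R := Num.max 0 (r / 2).

Lemma level_ge0 r : 0 <= level r. Proof. by rewrite le_max lexx. Qed.

Lemma levelE r : 0 <= r -> level r = r / 2.
Proof. by move=> r0; rewrite /level max_r// divr_ge0. Qed.

Lemma continuous_level : continuous level.
Proof.
move=> r; apply: (@continuous_max _ _ (cst 0 : R -> R^o) (fun r : R => r / 2 : R^o)).
  exact: cst_continuous.
by apply: mulrr_continuous.
Qed.

(* Twice the process on the left-hand side of the isomorphism, with r / 2 for r: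
   this is the candidate for psi conditioned on psi a = r. *)
Definition field (x : E) (r : R) (w : W * Wphi) : R :=
  2 * L x (fine (tau a (level r) w.1)) w.1 + phi x w.2.

Lemma measurable_field_joint x :
  measurable_fun setT (fun z : R * (W * Wphi) => field x z.1 z.2).
Proof.
have mz1 : measurable_fun setT (fun z : R * (W * Wphi) => z.2.1).
  by apply: measurableT_comp; [exact: measurable_fst|exact: measurable_snd].
have LP b : clock_process (fun t (z : R * (W * Wphi)) => L b t z.2.1).
  apply: (clock_process_comp (l := L b)) => //.
  exact: (local_time_process_clock HL).
have ml : measurable_fun setT (fun z : R * (W * Wphi) => level z.1).
  by apply: measurable_maxr => //; apply: measurable_funM.
apply: measurable_funD.
  apply: measurable_funM => //.
  apply: (measurable_clock_at_time (LP x) (S := fun z => tau a (level z.1) z.2.1)).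
    exact: (measurable_clock_inv (LP a) ml).
  by move=> z; exact: tau_ge0.
apply: measurableT_comp; first exact: measurable_funP.
by apply: measurableT_comp; [exact: measurable_snd|exact: measurable_snd].
Qed.

Lemma measurable_field x r : measurable_fun setT (field x r).
Proof.
have mp : measurable_fun setT (fun w : W * Wphi => (r, w)) by exact: pair1_measurable.
exact: (measurableT_comp (measurable_field_joint x) mp).
Qed.

Definition start_law : probability (W * Wphi)%type R := (pker_law (law X) a \x Pphi)%E.

Definition field_law (r : R) : {measure set (functionSpace R E) -> \bar R} :=
  image_measure start_law (measurable_functionSpace (measurable_field ^~ r)).

Let measurable_field_law U : measurable U -> measurable_fun setT (field_law ^~ U).
Proof.
move=> mU.
pose B : set (R * (W * Wphi)) := [set z | U (fun x => field x z.1 z.2)].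
have mB : measurable B.
  rewrite -[X in measurable X]setTI.
  exact: (measurable_functionSpace measurable_field_joint measurableT mU).
have := measurable_fun_xsection start_law mB.
by apply: eq_measurable_fun => r _; rewrite /= xsectionE.
Qed.

HB.instance Definition _ := isKernel.Build _ _ _ _ R field_law measurable_field_law.

Let field_law_setT r : field_law r setT = 1%E.
Proof. exact: (probability_setT start_law). Qed.

HB.instance Definition _ := Kernel_isProbability.Build _ _ _ _ R field_law field_law_setT.

End field.

(** Brings continuity in the level within reach of dominated convergence, a statement about
    sequences. *)
Lemma sequential_continuous {R : realType} (g : R -> R) :
  (forall r (u : nat -> R), u n @[n --> \oo] --> r -> g (u n) @[n --> \oo] --> g r) ->
  continuous g.
Proof.
move=> h r; apply/cvgrPdist_lt => e e0; apply: contrapT => far.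
have ex n : exists s, `|r - s| < n.+1%:R^-1 /\ e <= `|g r - g s|.
  apply: contrapT => no; apply: far.
  apply/nbhs_ballP; exists n.+1%:R^-1; first by rewrite /= invr_gt0.
  by move=> s rs; rewrite ltNge; apply/negP => es; apply: no; exists s.
have /choice[u hu] := ex.
have ur : u n @[n --> \oo] --> r.
  apply/cvgrPdist_lt => d d0; near=> n; apply: lt_trans (hu n).1 _; near: n.
  have := @cvg_harmonic R; move/cvgrPdist_lt => /(_ _ d0); apply: filterS => n.
  by rewrite sub0r normrN ger0_norm ?invr_ge0.
have /cvgrPdist_lt/(_ _ e0) [N _ hN] := h r u ur.
by have := hN N (leqnn N); rewrite /= ltNge (hu N).2.
Unshelve. all: by end_near.
Qed.

Section row_functions.
Context {R : realType}.

Lemma cvg_row n (u : nat -> 'I_n -> R) (v : 'I_n -> R) :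
  (forall i, u k i @[k --> \oo] --> v i) ->
  (\row_i u k i : 'rV[R]_n) @[k --> \oo] --> (\row_i v i : 'rV[R]_n).
Proof.
move=> uv; apply/cvg_ballP => e e0.
have : \forall k \near \oo, forall i, ball (v i) e (u k i).
  by apply: filter_forall => i; have /cvg_ballP := uv i; apply.
by apply: filterS => k h; split => // i j; rewrite !mxE; exact: h.
Qed.

Lemma cvg_floor_grid (y : R) :
  (Num.floor (k.+1%:R * y))%:~R / k.+1%:R @[k --> \oo] --> y.
Proof.
apply: (@squeeze_cvgr _ _ _ _ (fun k => y - harmonic k) (cst y)).
- apply: nearW => k; have /andP[f1 f2] := floor_itv (k.+1%:R * y).
  apply/andP; split; last by rewrite /= ler_pdivrMr ?ltr0n// (mulrC y).
  rewrite ler_pdivlMr ?ltr0n// mulrBl mulVf ?pnatr_eq0// lerBlDr (mulrC y) ltW//.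
  by rewrite intrD in f2.
- rewrite -[X in _ --> X]subr0.
  by apply: cvgB; [exact: cvg_cst|exact: cvg_harmonic].
- exact: cvg_cst.
Qed.

(* The topology of 'rV[R]_n carries no Borel structure here, so a continuous
   function of a row is approximated by its values on a grid. *)
Lemma measurable_continuous_row {d} {T : measurableType d} n (f : 'rV[R]_n -> R)
    (Y : 'I_n -> T -> R) :
  continuous f -> (forall i, measurable_fun setT (Y i)) ->
  measurable_fun setT (fun w => f (\row_i Y i w)).
Proof.
move=> cf mY.
pose grid k (z : {ffun 'I_n -> int}) : 'rV[R]_n := \row_i ((z i)%:~R / k.+1%:R).
pose g k w := f (grid k [ffun i => Num.floor (k.+1%:R * Y i w)]).
apply: (@measurable_fun_cvg _ _ _ _ g) => [k|w _]; last first.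
  apply: continuous_cvg; first exact: cf.
  rewrite (_ : (fun k => _) = (fun k => \row_i ((Num.floor (k.+1%:R * Y i w))%:~R / k.+1%:R))).
    by apply: cvg_row => i; exact: cvg_floor_grid.
  by apply/funext => k; apply/rowP => i; rewrite !mxE ffunE.
move=> _ B mB; rewrite setTI.
(* The preimage of [B] is the union, over the countably many grid points that [f] sends into [B], of
   the corresponding cells. *)
pose C z := if pselect (B (f (grid k z))) then
  \bigcap_(i in [set: 'I_n]) [set w | Num.floor (k.+1%:R * Y i w) = z i] else set0.
rewrite (_ : _ @^-1` B = \bigcup_z C z).
  apply: countable_bigcupT_measurable; first exact: countableP.
  move=> z; rewrite /C; case: pselect => [?|?] /=; last exact: measurable0.
  apply: fin_bigcap_measurable => // i _.
  have mk : measurable_fun setT (fun w => k.+1%:R * Y i w) by exact: measurable_funM.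
  have := mk measurableT _ (measurable_itv `[(z i)%:~R, (z i + 1)%:~R[).
  rewrite setTI; congr measurable; apply/seteqP; split => w /=; rewrite in_itv/=.
    exact: floor_def.
  by move=> <-; exact: floor_itv.
apply/seteqP; split => [w Bw|w [z _]].
  exists [ffun i => Num.floor (k.+1%:R * Y i w)] => //; rewrite /C.
  by case: pselect => // ? i _ /=; rewrite ffunE.
rewrite /C; case: pselect => // Bz Cz; rewrite /g/=.
suff -> : [ffun i => Num.floor (k.+1%:R * Y i w)] = z by [].
by apply/ffunP => i; rewrite ffunE; exact: Cz.
Qed.

End row_functions.

Lemma integral_image {R : realType} {d d'} {T : measurableType d} {T' : measurableType d'}
    (m : {finite_measure set T -> \bar R}) (f : T -> T') (mf : measurable_fun setT f)
    (h : T' -> \bar R) : measurable_fun setT h ->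
  (\int[image_measure m mf]_y h y = \int[m]_x h (f x))%E.
Proof.
move=> mh; rewrite integralE [RHS]integralE.
have pE : (\int[image_measure m mf]_y h^\+ y = \int[m]_x h^\+ (f x))%E.
  by apply: ge0_integral_image => //; exact: measurable_funepos.
have nE : (\int[image_measure m mf]_y h^\- y = \int[m]_x h^\- (f x))%E.
  by apply: ge0_integral_image => //; exact: measurable_funeneg.
by rewrite pE nE; congr (_ - _)%E; apply: eq_integral => x _; rewrite ?funeposE ?funenegE.
Qed.

Section product_ae.
Context {R : realType} {d1 d2} {T1 : measurableType d1} {T2 : measurableType d2}.
Variables (P1 : probability T1 R) (P2 : probability T2 R).

Lemma ae_fst (A : T1 -> Prop) : {ae P1, forall x, A x} ->
  {ae (P1 \x P2)%E, forall z, A z.1}.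
Proof.
move=> [N [mN N0 sN]]; exists (N `*` setT); split; first exact: measurableX.
  transitivity (P1 N * P2 setT)%E; first exact: product_measure1E.
  by rewrite N0 mul0e.
by move=> z /= h; split => //; exact: sN.
Qed.

Lemma ae_snd (A : T2 -> Prop) : {ae P2, forall x, A x} ->
  {ae (P1 \x P2)%E, forall z, A z.2}.
Proof.
move=> [N [mN N0 sN]]; exists (setT `*` N); split; first exact: measurableX.
  transitivity (P1 setT * P2 N)%E; first exact: product_measure1E.
  by rewrite N0 mule0.
by move=> z /= h; split => //; exact: sN.
Qed.

End product_ae.

Section field_continuity.
Context {R : realType} {dE} {E : measTopologicalType dE}
  {d} {W : measurableType d}.
Variables (X : markov_process R E W) (L : E -> R -> W -> R).
Hypotheses (HL : local_time_process X L) (recX : recurrent X).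
Variable a : E.
Context {dphi} {Wphi : measurableType dphi} (Pphi : probability Wphi R).
Variable phi : E -> {RV Pphi >-> R}.
Local Notation kap := (field_law HL a phi).
Local Notation Q := (start_law X a Pphi).

Lemma integral_field_law r (h : functionSpace R E -> \bar R) : measurable_fun setT h ->
  (\int[kap r]_q h q = \int[Q]_w h (fun x => field L a phi x r w))%E.
Proof. exact: integral_image. Qed.

(** Dominated convergence under the bound [M]; the integrands converge almost surely because the
    local times have no jump at the fixed level [level r]. *)
Lemma continuous_integral_field_law n (x : 'I_n -> E) (f : 'rV[R]_n -> R) :
  continuous f -> (exists M, forall v, `|f v| <= M) ->
  continuous (fun r => \int[kap r]_q f (\row_i q (x i))).
Proof.
move=> cf [M fM]; apply: sequential_continuous => r u ur.
have mf : measurable_fun setT (fun q : functionSpace R E => f (\row_i q (x i))).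
  by apply: measurable_continuous_row => // i; exact: measurable_coordinate.
have mF s : measurable_fun setT (fun w => f (\row_i field L a phi (x i) s w)).
  by apply: measurable_continuous_row => // i; exact: (measurable_field HL).
have KE s : (\int[kap s]_q (f (\row_i q (x i)))%:E =
    \int[Q]_w (f (\row_i field L a phi (x i) s w))%:E)%E.
  by rewrite integral_field_law//; exact/measurable_EFinP.
have fin s : Q.-integrable setT (EFin \o (fun w => f (\row_i field L a phi (x i) s w))).
  apply: measurable_bounded_integrable => //.
    by rewrite (le_lt_trans (probability_le1 _ _))// ltry.
  exists M; split; first exact: num_real.
  by move=> N MN w _; rewrite /= (le_trans (fM _))// ltW.
have [] // := @dominated_convergence _ _ R Q setT measurableT
    (fun n w => (f (\row_i field L a phi (x i) (u n) w))%:E)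
    (fun w => (f (\row_i field L a phi (x i) r w))%:E) (cst M%:E).
- by move=> k; exact/measurable_EFinP.
- exact/measurable_EFinP.
- have : {ae law X a, forall w, forall i, forall v : nat -> R,
      (forall n, 0 <= v n) -> v n @[n --> \oo] --> level r ->
      L (x i) (fine (inverse_local_time L a (v n) w)) w @[n --> \oo] -->
      L (x i) (fine (inverse_local_time L a (level r) w)) w}.
    by apply: filter_forall => i; apply: local_time_tau_cvg => //; exact: level_ge0.
  move=> /(@ae_fst _ _ _ _ _ (pker_law (law X) a) Pphi); apply: filterS => w hw _.
  apply/fine_cvgP; split; first exact: nearW.
  apply: continuous_cvg; first exact: cf.
  apply: cvg_row => i; apply: cvgD; last exact: cvg_cst.
  apply: cvgM; first exact: cvg_cst.
  apply: (hw i (fun n => level (u n))); first by move=> k; exact: level_ge0.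
  by apply: continuous_cvg => //; exact: continuous_level.
- exact: finite_measure_integrable_cst.
- by apply: aeW => w k _; rewrite abse_EFin lee_fin.
move=> _ _ c; rewrite /Rintegral.
rewrite (_ : (fun k => _) = fine \o (fun k => \int[Q]_w (f (\row_i field L a phi (x i) (u k) w))%:E)%E).
  apply: fine_cvg; rewrite KE fineK; first exact: c.
  by apply: integrable_fin_num => //; exact: fin.
by apply/funext => k; rewrite /= KE.
Qed.

End field_continuity.

(** * The isomorphism *)

Section isomorphism.
Context {R : realType} {dE} {E : measTopologicalType dE}
  {d} {W : measurableType d}.
Variables (X : markov_process R E W) (L : E -> R -> W -> R) (a : E) (theta : R).
Context {dS} {WS : measurableType dS} (PS : probability WS R).
Variable S : {RV PS >-> R}.
Context {dphi} {Wphi : measurableType dphi} (Pphi : probability Wphi R).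
Variable phi : E -> {RV Pphi >-> R}.
Context {dpsi} {Wpsi : measurableType dpsi} (Ppsi : probability Wpsi R).
Variable psi : E -> {RV Ppsi >-> R}.
Hypotheses (recX : recurrent X) (HL : local_time_process X L) (theta0 : 0 < theta).
Hypothesis hS : forall B : set R, measurable B ->
  distribution PS S B = exponential_prob theta B.
Hypothesis Hphi : permanental2 phi (green_killed_at_hitting X L a).
Hypothesis Hpsi : permanental2 psi (green_killed_at_inverse X L a PS S).

Notation tau := (inverse_local_time L).
Notation m := (fine (mean_level S)).
Notation D := (distribution Ppsi (psi a)).
Notation kap := (field_law HL a phi).
Notation Q := (start_law X a Pphi).
Notation Y := (field L a phi).

Let green0 n (x : 'I_n -> E) : 'M[R]_n := \matrix_(i, j) hit_green X L a (x i) (x j).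

Let laplace_phi n (al : 'rV[R]_n) (x : 'I_n -> E) : (forall i, 0 <= al 0 i) ->
  (\int[Pphi]_w (expR (- (2^-1 * \sum_i al 0 i * phi (x i) w)))%:E =
   ((Num.sqrt (\det (1%:M + diag_mx al *m green0 x)))^-1)%:E)%E.
Proof.
move=> al0; have := permanental2_laplace Hphi x al0; rewrite unlock => ->.
congr ((Num.sqrt (\det (_ + _ *m _)))^-1)%:E.
by apply/matrixP => i j; rewrite !mxE (green_killed_at_hittingE a HL recX).
Qed.

Let laplace_psi n (al : 'rV[R]_n) (x : 'I_n -> E) : (forall i, 0 <= al 0 i) ->
  (\int[Ppsi]_w (expR (- (2^-1 * \sum_i al 0 i * psi (x i) w)))%:E =
   ((Num.sqrt (\det (1%:M + diag_mx al *m
      \matrix_(i, j) (green0 x i j + m * rate X L a (x j)))))^-1)%:E)%E.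
Proof.
move=> al0; have := permanental2_laplace Hpsi x al0; rewrite unlock => ->.
congr ((Num.sqrt (\det (_ + _ *m _)))^-1)%:E.
by apply/matrixP => i j; rewrite !mxE (green_killed_at_inverseE a HL recX theta0 hS).
Qed.

(** At [a] the kernel reduces to [m]: [hit_green] vanishes there and [rate] is 1. *)
Let laplace_psi_self b : 0 <= b ->
  (\int[Ppsi]_w (expR (- (2^-1 * (b * psi a w))))%:E = ((Num.sqrt (1 + b * m))^-1)%:E)%E.
Proof.
move=> b0; pose al : 'rV[R]_1 := const_mx b.
have al0 i : 0 <= al 0 i by rewrite mxE.
transitivity (\int[Ppsi]_w (expR (- (2^-1 * \sum_i al 0 i * psi a w)))%:E)%E.
  by apply: eq_integral => w _; rewrite big_ord1 mxE.
rewrite laplace_psi//; congr ((Num.sqrt _)^-1)%:E.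
rewrite det_mx11 mxE mxE eqxx mxE big_ord1 !mxE eqxx mulr1n.
by rewrite (hit_green_self a HL) (rate_self HL recX) mulr1 add0r.
Qed.

Let psi_charge (u v : R) : 0 <= u -> u < v -> (0 < Ppsi [set w | (u < psi a w < v)%R])%E.
Proof.
apply: (square_law_itv_gt0 (mean_level_gt0 theta0 hS)) => //.
by move=> w; exact: permanental2_ge0 Hpsi _ _.
Qed.

(** The kernel of [phi] vanishes at [a], so [expR (- phi a)] has mean 1 while it is at most 1. *)
Let phi_self : {ae Pphi, forall w, phi a w = 0}.
Proof.
pose al : 'rV[R]_1 := const_mx 2.
have al0 i : 0 <= al 0 i by rewrite mxE.
have phi0 w : 0 <= phi a w by exact: permanental2_ge0 Hphi _ _.
have mphi : measurable_fun setT (phi a) by exact: measurable_funP.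
have me : measurable_fun setT (fun w => expR (- phi a w)).
  by apply: measurableT_comp => //; exact: measurableT_comp.
have e01 w : 0 <= expR (- phi a w) <= 1.
  by rewrite expR_ge0/= -expR0 ler_expR oppr_le0 phi0.
have E1 : (\int[Pphi]_w (expR (- phi a w))%:E = 1)%E.
  transitivity (\int[Pphi]_w (expR (- (2^-1 * \sum_i al 0 i * phi a w)))%:E)%E.
    by apply: eq_integral => w _; rewrite big_ord1 mxE mulKf.
  rewrite laplace_phi//.
  rewrite det_mx11 mxE mxE eqxx mxE big_ord1 !mxE (hit_green_self a HL) mulr0 addr0.
  by rewrite sqrtr1 invr1.
have m1e : measurable_fun setT (fun w => (1 - expR (- phi a w))%:E).
  by apply/measurable_EFinP; exact: measurable_funB.
have E0 : (\int[Pphi]_w (1 - expR (- phi a w))%:E = 0)%E.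
  have : (\int[Pphi]_w ((1 - expR (- phi a w))%:E + (expR (- phi a w))%:E) = 1)%E.
    rewrite -[RHS](probability_setT Pphi) -[RHS]mul1e -(integral_cst Pphi measurableT 1%E).
    by apply: eq_integral => w _; rewrite -EFinD subrK.
  rewrite ge0_integralD//; last 2 first.
  - by move=> w _; rewrite lee_fin subr_ge0; have /andP[] := e01 w.
  - exact/measurable_EFinP.
  rewrite E1; case: (\int[Pphi]_w _)%E => //= r [/eqP].
  by rewrite -[eqbRHS]add0r => /eqP/addIr ->.
have : ae_eq Pphi setT (fun w => (1 - expR (- phi a w))%:E) (cst 0%E).
  apply/(ae_eq_integral_abs Pphi measurableT m1e); rewrite -[RHS]E0.
  by apply: eq_integral => w _; rewrite gee0_abs// lee_fin subr_ge0; have /andP[] := e01 w.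
apply: filterS => w /(_ I) [/eqP].
by rewrite subr_eq0 eq_sym -expR0 => /eqP/expR_inj/eqP; rewrite oppr_eq0 => /eqP.
Qed.

Let field_ge0 x r w : 0 <= Y x r w.
Proof.
rewrite addr_ge0 ?mulr_ge0//; first exact: (local_time_tau_ge0 HL).
exact: permanental2_ge0 Hphi _ _.
Qed.

Let field_self r : 0 <= r -> {ae Q, forall w, Y a r w = r}.
Proof.
move=> r0.
have h1 := @ae_fst _ _ _ _ _ (pker_law (law X) a) Pphi _ (tau_finite_all HL recX a a).
have h2 := @ae_snd _ _ _ _ _ (pker_law (law X) a) Pphi _ phi_self.
apply: filterS2 h1 h2 => w w1 w2; rewrite /field w2 addr0.
by rewrite (local_time_at_tau HL) ?level_ge0 ?w1// levelE// mulrC divfK.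
Qed.

(** The factor 2 in [field] cancels the [2^-1] of the transform, leaving [weighted_time] at
    [tau a (level r)] with the weights [al]; the path and [phi] are independent. *)
Lemma laplace_field n (al : 'rV[R]_n) (x : 'I_n -> E) r : (forall i, 0 <= al 0 i) ->
  (\int[Q]_w (expR (- (2^-1 * \sum_i al 0 i * Y (x i) r w)))%:E =
   (expR (- (level r * exponent X L a x (fun i => al 0 i))))%:E *
   ((Num.sqrt (\det (1%:M + diag_mx al *m green0 x)))^-1)%:E)%E.
Proof.
move=> al0; pose P := pker_law (law X) a.
pose f (w : W) : \bar R :=
  (expR (- weighted_time L x (fun i => al 0 i) (fine (tau a (level r) w)) w))%:E.
pose g (w : Wphi) : \bar R := (expR (- (2^-1 * \sum_i al 0 i * phi (x i) w)))%:E.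
have E1 : (fun w => (expR (- (2^-1 * \sum_i al 0 i * Y (x i) r w)))%:E) =
    (fun w => f w.1 * g w.2)%E.
  apply/funext => w; rewrite /f /g -EFinM -expRD; congr (expR _)%:E.
  rewrite -opprD; congr (- _); rewrite /weighted_time.
  under eq_bigr do rewrite /field mulrDr mulrCA.
  by rewrite big_split/= -mulr_sumr mulrDr mulKf.
rewrite E1.
have mf : measurable_fun setT f.
  by apply: (measurable_expR_time HL x al0); exact: stopping_tau.
have mg : measurable_fun setT g.
  apply/measurable_EFinP; apply: measurableT_comp => //; apply: measurableT_comp => //.
  apply: measurable_funM => //; apply: measurable_sum => i.
  by apply: measurable_funM => //; exact: measurable_funP.
have f0 w : (0 <= f w)%E by rewrite lee_fin expR_ge0.
have g0 w : (0 <= g w)%E by rewrite lee_fin expR_ge0.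
have mfg : measurable_fun setT (fun w : W * Wphi => f w.1 * g w.2)%E.
  apply: emeasurable_funM; first exact: (measurableT_comp mf measurable_fst).
  exact: (measurableT_comp mg measurable_snd).
rewrite (@fubini_tonelli1 _ _ _ _ R P Pphi _ mfg); last by move=> w; rewrite mule_ge0.
transitivity (\int[P]_w (f w * \int[Pphi]_w' g w'))%E.
  by apply: eq_integral => w _; rewrite /fubini_F/= ge0_integralZl.
rewrite ge0_integralZr//; last exact: integral_ge0.
rewrite laplace_phi//; congr (_ * _)%E.
exact: (exp_mean_tauE HL recX a x al0 (level_ge0 r)).
Qed.

Let joint_law : probability (R * (W * Wphi))%type R := (D \x Q)%E.

(** The mixture is the law of the field with its level as an independent coordinate of law [D], so
    uniqueness of Laplace transforms compares it with [psi]. *)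
Lemma field_law_mixture (A : set (functionSpace R E)) : measurable A ->
  (Ppsi [set w | A (fun x => psi x w)] = \int[D]_r kap r A)%E.
Proof.
move=> mA.
transitivity (joint_law [set z | A (fun x => Y x z.1 z.2)]); last first.
  rewrite /joint_law/= /product_measure1; apply: eq_integral => r _.
  by rewrite /= xsectionE.
have mpsi x : measurable_fun setT (psi x) by exact: measurable_funP.
have psi_ge0 x w : 0 <= psi x w by exact: permanental2_ge0 Hpsi _ _.
have mfield x := measurable_field_joint HL a phi x.
have field0 x (z : R * (W * Wphi)) : 0 <= Y x z.1 z.2 by exact: field_ge0.
apply: (laplace_unique_process (P1 := Ppsi) (P2 := joint_law) mpsi mfield psi_ge0 field0 _ mA).
move=> n al x al0; pose alf i := al 0 i.
rewrite laplace_psi//.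
have mY : measurable_fun setT (fun z : R * (W * Wphi) =>
    (expR (- (2^-1 * \sum_i al 0 i * Y (x i) z.1 z.2)))%:E).
  apply/measurable_EFinP; apply: measurableT_comp => //; apply: measurableT_comp => //.
  apply: measurable_funM => //; apply: measurable_sum => i.
  by apply: measurable_funM => //; exact: (measurable_field_joint HL a phi).
rewrite (@fubini_tonelli1 _ _ _ _ R D Q _ mY)//.
set det0 := \det (1%:M + diag_mx al *m green0 x).
pose kpp := exponent X L a x alf.
have k0 : 0 <= kpp by exact: exponent_ge0.
transitivity (\int[D]_r ((expR (- (level r * kpp)))%:E * ((Num.sqrt det0)^-1)%:E))%E; last first.
  by apply: eq_integral => r _; rewrite /fubini_F/= laplace_field.
have ml : measurable_fun setT (fun r => (expR (- (level r * kpp)))%:E).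
  apply/measurable_EFinP; apply: measurableT_comp => //; apply: measurableT_comp => //.
  apply: measurable_funM => //; apply: continuous_measurable_fun.
  exact: continuous_level.
rewrite ge0_integralZr//.
rewrite ge0_integral_distribution//.
transitivity (\int[Ppsi]_w (expR (- (2^-1 * (kpp * psi a w))))%:E *
    ((Num.sqrt det0)^-1)%:E)%E; last first.
  congr (_ * _)%E; apply: eq_integral => w _; rewrite /= levelE; last first.
    exact: permanental2_ge0 Hpsi _ _.
  have E2 (z : R) : z / 2 * kpp = 2^-1 * (kpp * z) by rewrite -mulrA mulrC mulrA.
  by rewrite E2.
rewrite laplace_psi_self// -EFinM; congr EFin.
have hE i : hit_exp X L a x alf (x i) +
    \sum_j alf j * green0 x i j * hit_exp X L a x alf (x j) = 1.
  rewrite -[RHS](hit_exp_equation HL recX a x al0 (x i)); congr (_ + _).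
  by apply: eq_bigr => j _; rewrite !mxE.
rewrite (@det_one_add_diag_shift _ _ alf (fun j => m * rate X L a (x j))
  (fun i => hit_exp X L a x alf (x i)) (green0 x) al)//.
have -> : \sum_j alf j * (m * rate X L a (x j)) * hit_exp X L a x alf (x j) = kpp * m.
  rewrite /kpp (exponentE HL recX a x al0) mulr_suml; apply: eq_bigr => j _.
  by rewrite /alf; ring.
(* The sign of this factor lets the square root of the product split. *)
have km0 : 0 <= 1 + kpp * m by rewrite addr_ge0// mulr_ge0// ltW// (mean_level_gt0 theta0 hS).
by rewrite mulrC sqrtrM// invfM.
Qed.

(** The mixture formula is applied to [A] cut by the event that the value at [a] lies in [B]. For
    [r >= 0] the field is [r] at [a] almost surely, so the cut amounts to the indicator of [B] at
    [r]. *)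
Lemma conditional_law_field : conditional_law psi a kap.
Proof.
split=> [A B mA mB|n x f cf bf]; last first.
  by apply: continuous_subspaceT; exact: (continuous_integral_field_law recX cf bf).
pose Ba : set (functionSpace R E) := [set q | B (q a)].
have mBa : measurable Ba.
  rewrite -[X in measurable X]setTI.
  exact: (measurable_coordinate a measurableT mB).
have -> : Ppsi [set w | A (fun x => psi x w) /\ B (psi a w)] =
    Ppsi [set w | (A `&` Ba) (fun x => psi x w)] by [].
rewrite field_law_mixture; last exact: measurableI.
rewrite [RHS]integral_mkcond; apply: ae_eq_integral => //.
- by apply: measurable_kernel; exact: measurableI.
- by apply/(measurable_restrictT _ _).1 => //; apply: measurable_funTS; exact: measurable_kernel.
have D0 : {ae D, forall r, 0 <= r}.
  exists `]-oo, 0[%classic; split => //.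
    rewrite /distribution/= /pushforward (_ : _ @^-1` _ = set0) ?measure0//.
    apply/seteqP; split => // w /=; rewrite in_itv/= => h.
    by have := permanental2_ge0 Hpsi a w; rewrite leNgt h.
  by move=> r /= /negP; rewrite in_itv/= -ltNge.
apply: filterS D0 => r r0 _; rewrite patchE.
have mfield (C : set (functionSpace R E)) : measurable C ->
    measurable [set w | C (fun x => Y x r w)].
  move=> mC; rewrite -[X in measurable X]setTI.
  exact: (measurable_functionSpace (fun x => measurable_field HL a phi x r) measurableT mC).
have mAB := mfield _ (measurableI _ _ mA mBa).
case: ifPn => [|] ; rewrite (inE, notin_setE) => Br.
- apply: (measure_ae_eq mAB (mfield _ mA)).
  by apply: filterS (field_self r0) => w wr; split=> [[]//|Aw]; split=> //; rewrite /Ba/= wr.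
- transitivity (Q set0); last exact: measure0.
  apply: (measure_ae_eq mAB measurable0).
  by apply: filterS (field_self r0) => w wr; split=> // -[_]; rewrite /Ba/= wr.
Qed.

Lemma conditional_lawE (kappa : R.-pker R ~> functionSpace R E) r (A : set (functionSpace R E)) :
  conditional_law psi a kappa -> 0 <= r -> measurable A -> kappa r A = kap r A.
Proof.
move=> hk r0 mA.
exact: (conditional_law_unique psi_charge hk conditional_law_field r0 mA).
Qed.

(** The left-hand field is almost surely [r] at [a], as [phi a] vanishes; half of [psi a] is then
    [r], whence the level [2 * r]. The two integrals are taken under one and the same law, which
    covers every measurable [F]. *)
Lemma isomorphism_positive_level (kappa : R.-pker R ~> functionSpace R E) (r : R)
    (F : functionSpace R E -> \bar R) :
  conditional_law psi a kappa -> 0 < r -> measurable_fun setT F ->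
  (\int[law X a \x Pphi]_w
     F (fun x => (L x (fine (tau a r w.1)) w.1 + 2^-1 * phi x w.2)%R) =
   \int[kappa (2 * r)%R]_p F (fun x => (2^-1 * p x)%R))%E.
Proof.
move=> hk r0 mF.
have r20 : 0 <= 2 * r by rewrite mulr_ge0// ltW.
have mhalf : measurable_fun setT ((fun p x => 2^-1 * p x) : functionSpace R E -> functionSpace R E).
  apply: (measurable_functionSpace (Y := fun x (p : functionSpace R E) => 2^-1 * p x)) => x.
  by apply: measurable_funM => //; exact: measurable_coordinate.
transitivity (\int[kap (2 * r)%R]_p F (fun x => (2^-1 * p x)%R))%E; last first.
  apply: eq_measure_integral => A mA _; apply/esym; exact: conditional_lawE.
rewrite integral_field_law; last exact: (measurableT_comp mF mhalf).
apply: eq_integral => w _; congr F; apply/funext => x.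
by rewrite /field levelE// mulrDr mulKf// (mulrC 2 r) mulfK.
Qed.

(** From [a], [tau a 0] is almost surely 0, where all local times vanish: only [phi] is left in the
    field. *)
Lemma isomorphism_zero_level (kappa : R.-pker R ~> functionSpace R E)
    (A : set (functionSpace R E)) :
  conditional_law psi a kappa -> measurable A ->
  kappa 0 A = Pphi [set w | A (fun x => phi x w)].
Proof.
move=> hk mA; rewrite conditional_lawE//.
have mfield : measurable [set w | A (fun x => Y x 0 w)].
  rewrite -[X in measurable X]setTI.
  exact: (measurable_functionSpace (fun x => measurable_field HL a phi x 0) measurableT mA).
have mphi : measurable [set w | A (fun x => phi x w)].
  rewrite -[X in measurable X]setTI.
  by apply: (measurable_functionSpace (Y := phi) _ measurableT mA) => x; exact: measurable_funP.
have mB : measurable (setT `*` [set w | A (fun x => phi x w)] : set (W * Wphi)).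
  exact: measurableX.
transitivity (Q (setT `*` [set w | A (fun x => phi x w)])); last first.
  transitivity (pker_law (law X) a setT * Pphi [set w | A (fun x => phi x w)])%E.
    exact: product_measure1E.
  by rewrite (probability_setT (pker_law (law X) a)) mul1e.
apply: (measure_ae_eq mfield mB).
have := @ae_fst _ _ _ _ _ (pker_law (law X) a) Pphi _ (tau_start HL a).
apply: filterS => w w0.
have E0 : (fun x => Y x 0 w) = (fun x => phi x w.2).
  apply/funext => x; rewrite /field levelE// mul0r w0/= (local_time_start HL).
  by rewrite mulr0 add0r.
by split=> [Aw|[_ Aw]]; [split=> //=; rewrite -E0|rewrite /= E0].
Qed.

End isomorphism.

(** Existence of a conditional law keeps the quantification over [kappa] from being vacuous. *)
Theorem corollary3p6 (R : realType)
  (dE : measure_display) (E : measTopologicalType dE)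
  (d : measure_display) (W : measurableType d)
  (X : markov_process R E W) (L : E -> R -> W -> R) (a : E)
  (theta : R)
  (dS : measure_display) (WS : measurableType dS) (PS : probability WS R)
  (S : {RV PS >-> R})
  (dphi : measure_display) (Wphi : measurableType dphi)
  (Pphi : probability Wphi R) (phi : E -> {RV Pphi >-> R})
  (dpsi : measure_display) (Wpsi : measurableType dpsi)
  (Ppsi : probability Wpsi R) (psi : E -> {RV Ppsi >-> R}) :
  recurrent X ->
  local_time_process X L ->
  0 < theta ->
  (forall B : set R, measurable B ->
     distribution PS S B = exponential_prob theta B) ->
  permanental2 phi (green_killed_at_hitting X L a) ->
  permanental2 psi (green_killed_at_inverse X L a PS S) ->
  (exists kappa : R.-pker R ~> functionSpace R E,
     conditional_law psi a kappa) /\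
  (forall kappa : R.-pker R ~> functionSpace R E,
     conditional_law psi a kappa ->
     (forall (r : R) (F : functionSpace R E -> \bar R),
        0 < r -> measurable_fun setT F ->
        (\int[law X a \x Pphi]_w
           F (fun x => (L x (fine (inverse_local_time L a r w.1)) w.1
                        + 2^-1 * phi x w.2)%R) =
         \int[kappa (2 * r)%R]_p F (fun x => (2^-1 * p x)%R))%E) /\
     (forall A : set (functionSpace R E), measurable A ->
        kappa 0 A = Pphi [set w | A (fun x => phi x w)])).
Proof.
move=> recX HL theta0 hS Hphi Hpsi; split.
  exists (field_law HL a phi).
  exact: (conditional_law_field recX HL theta0 hS Hphi Hpsi).
move=> kappa hk; split=> [r F|A].
  exact: (isomorphism_positive_level recX HL theta0 hS Hphi Hpsi hk).
exact: (isomorphism_zero_level recX HL theta0 hS Hphi Hpsi hk).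
Qed.
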